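(* Let $n\geqslant 1$ be an integer and let $\phi:\mathbb{R}_+\rightarrow\mathbb{R}_+$ be any positive continuous function with $\lim_{r\to+\infty}\phi(r)=+\infty$. Then there exists a universal entire curve $h:\mathbb{C}\to\mathbb{C}\mathbb{P}^n$ such that $$T_h(r)\leqslant \phi(r)\cdot\log r,\qquad \forall\, r\geqslant 1.$$
   Context: An entire curve in $\mathbb{C}\mathbb{P}^n$ is a holomorphic map $f:\mathbb{C}\to\mathbb{C}\mathbb{P}^n$; $\mathscr{M}_n$ denotes the space of all entire curves in $\mathbb{C}\mathbb{P}^n$ with the topology of uniform convergence on compact sets (with respect to the Fubini-Study distance on $\mathbb{C}\mathbb{P}^n$). An entire curve $h\in\mathscr{M}_n$ is called universal if for every $g\in\mathscr{M}_n$ and every compact set $K\subset\mathbb{C}$ there is a sequence $(a_i)_{i\geqslant1}$ of complex numbers such that the maps $z\mapsto h(z+a_i)$ converge to $g$ uniformly on $K$. The Nevanlinna characteristic function of $h\in\mathscr{M}_n$ is $$T_h(r):=\int_{1}^{r}\frac{\mathrm{d}t}{t}\int_{|z|<t}h^*\omega_{\mathsf{FS}},\qquad r\geqslant 1,$$ where $\omega_{\mathsf{FS}}$ is the Fubini-Study form on $\mathbb{C}\mathbb{P}^n$, normalized so that in the affine chart $(z_1,\dots,z_n)\mapsto[1:z_1:\dots:z_n]$ it equals $\frac{i}{2\pi}\partial\bar\partial\log\big(1+\sum_{j=1}^n|z_j|^2\big)$. Here $\mathbb{R}_+$ is the set of positive real numbers. *)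

(* Defs.v *)
From mathcomp Require Import all_boot all_order all_algebra.
From mathcomp Require Import all_classical all_reals all_analysis.
From mathcomp Require Export complex.
Import Order.TTheory GRing.Theory Num.Theory.
Import numFieldNormedType.Exports.

Set Implicit Arguments.
Unset Strict Implicit.
Unset Printing Implicit Defensive.

Local Open Scope classical_set_scope.
Local Open Scope ring_scope.
Local Open Scope complex_scope.

(* The regular module [R[i]^o] makes R[i] a normed space over itself, so that
   [derivable] and [derive1] at this type mean complex differentiation. *)
Notation Cplx R := (R[i]^o).

(* A point of CP^n is a complex line through the origin of C^(n+1). *)
Definition CP (R : realType) (n : nat) : Type :=
  {L : {vspace 'rV[R[i]]_n.+1} | \dim L == 1%N}.

(* A choice of homogeneous coordinates [v_0 : ... : v_n]; they are determined
   up to a nonzero factor, and everything below is invariant under scaling. *)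
Definition hcoord (R : realType) (n : nat) (p : CP R n) : 'rV[R[i]]_n.+1 :=
  vpick (val p).

Definition chart_dom (R : realType) (n : nat) (j : 'I_n.+1) : set (CP R n) :=
  [set p | hcoord p 0 j != 0].

(* [v_0 : ... : v_n] |-> (v_0 / v_j, ..., v_n / v_j), j-th entry omitted. *)
Definition chart (R : realType) (n : nat) (j : 'I_n.+1) (p : CP R n) :
    'rV[R[i]]_n :=
  \row_(a < n) (hcoord p 0 (lift j a) / hcoord p 0 j).

(* Holomorphy is read in the charts; [chart_dom j] being a neighbourhood of
   [f z] in CP^n, continuity of f puts the nearby values in the same chart. *)
Definition entire_curve (R : realType) (n : nat) (f : Cplx R -> CP R n) : Prop :=
  forall (z : Cplx R) (j : 'I_n.+1), chart_dom j (f z) ->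
    \forall w \near z, chart_dom j (f w) /\
      forall a : 'I_n,
        derivable (fun x : Cplx R => chart j (f x) 0 a : Cplx R) w 1.

Definition cmod (R : realType) (z : R[i]) : R := complex.Re `|z|.

Definition hnorm (R : realType) (m : nat) (v : 'rV[R[i]]_m) : R :=
  Num.sqrt (\sum_(k < m) cmod (v 0 k) ^+ 2).

Definition hdot (R : realType) (m : nat) (v w : 'rV[R[i]]_m) : R[i] :=
  \sum_(k < m) v 0 k * conjc (w 0 k).

(* d([v], [w]) = arccos (|<v, w>| / (|v| |w|)), the geodesic distance of the
   Fubini-Study metric scaled so that CP^n has diameter pi / 2. Another scaling
   multiplies d by a constant, which does not affect uniform convergence. *)
Definition dist_FS (R : realType) (n : nat) (p q : CP R n) : R :=
  acos (cmod (hdot (hcoord p) (hcoord q)) /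
        (hnorm (hcoord p) * hnorm (hcoord q))).

Definition uniform_cvg_on (R : realType) (n : nat) (K : set (Cplx R))
    (f : nat -> Cplx R -> CP R n) (g : Cplx R -> CP R n) : Prop :=
  forall e : R, 0 < e ->
    \forall i \near \oo, forall z, K z -> dist_FS (f i z) (g z) < e.

Definition universal (R : realType) (n : nat) (h : Cplx R -> CP R n) : Prop :=
  entire_curve h /\
  forall g : Cplx R -> CP R n, entire_curve g ->
  forall K : set (Cplx R), compact K ->
  exists a : nat -> Cplx R, uniform_cvg_on K (fun i z => h (z + a i)) g.

(* Derivative at z of U : C^n -> C along the real line z + t v, t real. *)
Definition real_deriv (R : realType) (n : nat) (v : 'rV[R[i]]_n)
    (U : 'rV[R[i]]_n -> R[i]) (z : 'rV[R[i]]_n) : R[i] :=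
  derive1 (fun t : R => complex.Re (U (z + t%:C *: v))) 0 +i*
  derive1 (fun t : R => complex.Im (U (z + t%:C *: v))) 0.

(* Wirtinger operators d/dz_a = (d/dx_a - i d/dy_a) / 2 and
   d/dzbar_a = (d/dx_a + i d/dy_a) / 2. *)
Definition dee (R : realType) (n : nat) (a : 'I_n)
    (U : 'rV[R[i]]_n -> R[i]) (z : 'rV[R[i]]_n) : R[i] :=
  (real_deriv (delta_mx 0 a) U z
   - 'i%C * real_deriv ('i%C *: delta_mx 0 a) U z) / 2.

Definition deebar (R : realType) (n : nat) (a : 'I_n)
    (U : 'rV[R[i]]_n -> R[i]) (z : 'rV[R[i]]_n) : R[i] :=
  (real_deriv (delta_mx 0 a) U z
   + 'i%C * real_deriv ('i%C *: delta_mx 0 a) U z) / 2.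

Definition FS_potential (R : realType) (n : nat) (z : 'rV[R[i]]_n) : R[i] :=
  (ln (1 + \sum_(k < n) cmod (z 0 k) ^+ 2))%:C.

(* Coefficient of dz_a /\ dzbar_b in omega_FS, in an affine chart. *)
Definition FS_coef (R : realType) (n : nat) (a b : 'I_n) (z : 'rV[R[i]]_n) :
    R[i] :=
  'i%C / (2 * pi)%:C * dee a (deebar b (@FS_potential R n)) z.

(* Some chart around p. The form omega_FS has the same expression in all the
   charts: on overlaps the potentials differ by a pluriharmonic function
   log |v_j / v_k|^2. *)
Definition chart_at (R : realType) (n : nat) (p : CP R n) : 'I_n.+1 :=
  odflt ord0 [pick j | hcoord p 0 j != 0].

(* The function D such that h^* omega_FS = D dx /\ dy. If (f_1, ..., f_n) is h
   in a chart, h^*(dz_a /\ dzbar_b) = f_a' conj(f_b') dz /\ dzbar, and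
   dz /\ dzbar = - 2 i dx /\ dy. *)
Definition FS_pullback (R : realType) (n : nat) (h : Cplx R -> CP R n)
    (z : Cplx R) : R :=
  let j := chart_at (h z) in
  let df (a : 'I_n) : R[i] :=
    derive1 (fun w : Cplx R => chart j (h w) 0 a : Cplx R) z in
  complex.Re (\sum_(a < n) \sum_(b < n)
    FS_coef a b (chart j (h z)) * df a * conjc (df b) * (- 2 * 'i%C)).

Definition nevanlinna (R : realType) (n : nat) (h : Cplx R -> CP R n) (r : R) :
    \bar R :=
  (\int[@lebesgue_measure R]_(t in `[1%R, r])
    ((t^-1)%:E *
     \int[(@lebesgue_measure R \x @lebesgue_measure R)%E]_(z in
         [set z : R * R | (z.1 ^+ 2 + z.2 ^+ 2 < t ^+ 2)%R])
       (FS_pullback h (z.1 +i* z.2))%:E))%E.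

(* Main.v *)
Require Import Defs.
From mathcomp Require Import all_boot all_order all_algebra.
From mathcomp Require Import all_classical all_reals all_analysis.
From mathcomp Require Import measurable_realfun.
From mathcomp Require Import ring lra.
Import Order.TTheory GRing.Theory Num.Theory.
Import numFieldNormedType.Exports.
Local Open Scope classical_set_scope.
Local Open Scope ring_scope.

(** The curve is a limit of polynomial curves, in the spirit of Birkhoff's
    universal entire functions but with products instead of sums.  Let
    [p_0, p_1, ...] run through a countable family of tuples of n + 1 monic
    polynomials of equal degree without common zero ([dense_family]).  A tuple
    [F] being constructed, the next one has the coordinates
    F_j(z) * p_j(z - a) / (-a)^d, with [a] real and huge ([glue]).  On a fixed
    disc the second factor is close to 1 in all the coordinates
    ([unit_shift_near1]), so F is hardly modified.  Near [a] the roles are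
    exchanged: the F_j have the same degree D and the same leading coefficient
    lam, hence F_j(z + a) is close to lam a^D whatever j is, and the curve
    translated by [a] looks like [p] ([state_step]).  The tuples converge
    locally uniformly together with their derivatives ([entire_limit]), and
    the limit curve approaches every [p_N] on a large disc.

    Universality then is a density statement.  An entire curve is given chart by
    chart, but on a square it has holomorphic homogeneous coordinates without
    common zero ([lift_square]): one coordinate that is not identically zero
    has finitely many zeros in the square ([finite_zeros]); divide by it, and
    multiply by a polynomial with these zeros.  The coordinates are
    approximated by Taylor polynomials ([taylor]), which are perturbed into
    monic polynomials of equal degree with Gaussian rational coefficients and
    without common zero ([dense_monic]).

    For the growth, the pullback of the Fubini-Study form by the curve of
    homogeneous coordinates F has a density at most |F /\ F'|^2 / |F|^4
    ([FS_pullback_le], [pullback_dens]).  If the coordinates are polynomials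
    with the same leading term, the leading terms cancel in F /\ F', and the
    density at x + iy is at most B / ((1 + x^2) (1 + y^2)), which has a finite
    integral ([dens_kern]).  The density of a glued tuple is at most a constant
    times the sum of the densities of F and of the translate of [p], and this
    constant does not depend on [a] ([glue_dens]): at each point, the
    coordinates of one of the factors have comparable moduli.  Therefore the
    area C' of the next curve is controlled before [a] is chosen.  First choose
    a radius S beyond which phi exceeds the bound given by C', then [a] so
    large that the curve is essentially unmodified on the disc of radius S.
    The area of the limit curve over the disc of radius r is then at most
    phi(r) for all r >= 1, and integration against dt / t gives the bound on
    the characteristic function ([nevanlinna_le]).

    The function theory of one variable (Goursat's theorem, Cauchy's formula
    and Taylor expansions on a square) is derived from the bisection of
    rectangles ([quartering]). *)

(** * The modulus *)

Section Cmod.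
Set Implicit Arguments.
Unset Strict Implicit.
Unset Printing Implicit Defensive.
Local Open Scope complex_scope.
Variable R : realType.
Implicit Types z w : R[i].

Lemma normcE_cmod z : `|z| = (cmod z)%:C.
Proof. by rewrite /cmod RRe_real // ger0_real. Qed.

Lemma cmodE z : cmod z = Num.sqrt (complex.Re z ^+ 2 + complex.Im z ^+ 2).
Proof. by rewrite /cmod normc_def. Qed.

Lemma cmod_ge0 z : 0 <= cmod z.
Proof. by rewrite cmodE sqrtr_ge0. Qed.

Lemma cmod0 : cmod (0 : R[i]) = 0.
Proof. by rewrite /cmod normr0. Qed.

Lemma cmod1 : cmod (1 : R[i]) = 1.
Proof. by rewrite /cmod normr1. Qed.

Lemma cmodM z w : cmod (z * w) = cmod z * cmod w.
Proof. by apply: complexI; rewrite rmorphM /= -!normcE_cmod normrM. Qed.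

Lemma cmodV z : cmod (z^-1) = (cmod z)^-1.
Proof. by apply: complexI; rewrite fmorphV /= -!normcE_cmod normfV. Qed.

Lemma cmodf z w : cmod (z / w) = cmod z / cmod w.
Proof. by rewrite cmodM cmodV. Qed.

Lemma cmodX z k : cmod (z ^+ k) = cmod z ^+ k.
Proof. by apply: complexI; rewrite rmorphXn /= -!normcE_cmod normrX. Qed.

Lemma cmodN z : cmod (- z) = cmod z.
Proof. by rewrite /cmod normrN. Qed.

Lemma cmodC z w : cmod (z - w) = cmod (w - z).
Proof. by rewrite /cmod distrC. Qed.

Lemma cmod_conj z : cmod (conjc z) = cmod z.
Proof. by rewrite /cmod normcJ. Qed.

Lemma cmodD z w : cmod (z + w) <= cmod z + cmod w.
Proof. by rewrite -lecR rmorphD /= -!normcE_cmod ler_normD. Qed.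

Lemma cmodB z w : cmod (z - w) <= cmod z + cmod w.
Proof. by rewrite -(cmodN w) cmodD. Qed.

Lemma cmod_lower z w : cmod z - cmod w <= cmod (z + w).
Proof. by have := cmodB (z + w) w; rewrite addrK; lra. Qed.

Lemma cmod_eq0 z : (cmod z == 0) = (z == 0).
Proof. by rewrite -(inj_eq (@complexI R)) -normcE_cmod normr_eq0. Qed.

Lemma cmod_gt0 z : (0 < cmod z) = (z != 0).
Proof. by rewrite lt0r cmod_ge0 andbT cmod_eq0. Qed.

Lemma cmod_real (x : R) : cmod x%:C = `|x|.
Proof. by rewrite cmodE /= expr0n /= addr0 sqrtr_sqr. Qed.

Lemma cmod_i : cmod ('i%C : R[i]) = 1.
Proof. by rewrite cmodE /= expr0n expr1n /= add0r sqrtr1. Qed.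

Lemma cmod_nat k : cmod (k%:R : R[i]) = k%:R.
Proof. by rewrite -(rmorph_nat (real_complex R)) cmod_real ger0_norm // ler0n. Qed.

Lemma cmod_Re z : `|complex.Re z| <= cmod z.
Proof. by rewrite cmodE -sqrtr_sqr ler_wsqrtr // lerDl sqr_ge0. Qed.

Lemma cmod_Im z : `|complex.Im z| <= cmod z.
Proof. by rewrite cmodE -sqrtr_sqr ler_wsqrtr // lerDr sqr_ge0. Qed.

Lemma cmod_sqr z : cmod z ^+ 2 = complex.Re z ^+ 2 + complex.Im z ^+ 2.
Proof. by rewrite cmodE sqr_sqrtr // addr_ge0 // sqr_ge0. Qed.

Lemma cmod_le_ReIm z : cmod z <= `|complex.Re z| + `|complex.Im z|.
Proof.
rewrite -(@ler_pXn2r _ 2%N) ?nnegrE ?cmod_ge0 ?addr_ge0 //.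
rewrite cmod_sqr sqrrD !real_normK ?num_real // addrAC.
by rewrite lerDl mulrn_wge0 // mulr_ge0.
Qed.

Lemma cmod_sum (I : Type) (r : seq I) (P : pred I) (F : I -> R[i]) :
  cmod (\sum_(i <- r | P i) F i) <= \sum_(i <- r | P i) cmod (F i).
Proof.
elim/big_rec2: _ => [|i x y _ H]; first by rewrite cmod0.
by apply: le_trans (cmodD _ _) _; rewrite lerD2l.
Qed.

(** Translates the neighbourhoods of the normed space [R[i]^o], whose radii
    are complex numbers, into discs with real radii. *)
Lemma near_cmod (z : Cplx R) (P : Cplx R -> Prop) :
  (\forall w \near z, P w) <->
  (exists2 d : R, 0 < d & forall w : R[i], cmod (w - z) < d -> P w).
Proof.
split.
  move/nbhs_normP => [e /= e0 H].
  have e0' : 0 < complex.Re e by move: e0; rewrite ltcE => /andP[].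
  exists (complex.Re e) => // w wd; apply: H => /=.
  rewrite distrC; have -> : e = (complex.Re e)%:C.
    by rewrite RRe_real // gtr0_real.
  by rewrite [`|_|](normcE_cmod (w - z)) ltcR.
move=> [d d0 H]; apply/nbhs_normP; exists d%:C => /=; first by rewrite ltcR.
by move=> w /= wd; apply: H; rewrite -ltcR -normcE_cmod distrC.
Qed.

End Cmod.

(** * Complex derivatives *)

Section Cdiff.
Set Implicit Arguments.
Unset Strict Implicit.
Unset Printing Implicit Defensive.
Local Open Scope complex_scope.
Variable R : realType.
Implicit Types (f g : R[i] -> R[i]) (z w d : R[i]).

Definition ccont f z := forall e : R, 0 < e ->
  exists2 r : R, 0 < r & forall h, cmod h < r -> cmod (f (z + h) - f z) <= e.

(** Complex differentiability with the increment estimate that the proofs use;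
    [cdiff_is_derive] and [derivable_cdiff] relate it to [derivable]. *)
Definition cdiff f z d := forall e : R, 0 < e ->
  exists2 r : R, 0 < r &
    forall h, cmod h < r -> cmod (f (z + h) - f z - d * h) <= e * cmod h.

Lemma cdiff_cont f z d : cdiff f z d -> ccont f z.
Proof.
move=> H e e0; have [r r0 {}H] := H 1 ltr01.
have c0 := cmod_ge0 d.
exists (Num.min r (e / (cmod d + 1))).
  by rewrite lt_min r0 divr_gt0 //; lra.
move=> h; rewrite lt_min => /andP[hr]; rewrite ltr_pdivlMr; last lra.
move=> he.
have := H _ hr; have := cmodD (f (z + h) - f z - d * h) (d * h).
rewrite subrK cmodM; have := cmod_ge0 h; nra.
Qed.

(** Differentiability is a local property; most functions below are
    differentiated after a rewriting that holds only near the point. *)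
Lemma cdiff_near f g z d :
  (exists2 r, 0 < r & forall h, cmod h < r -> f (z + h) = g (z + h)) ->
  cdiff f z d -> cdiff g z d.
Proof.
move=> [r r0 E] H e e0; have [r' r'0 {}H] := H e e0.
exists (Num.min r r'); first by rewrite lt_min r0.
move=> h; rewrite lt_min => /andP[h1 h2]; rewrite -E //.
have <- : f z = g z by have := E 0; rewrite cmod0 addr0; exact.
exact: H.
Qed.

Lemma cdiff_ext f g z d : f =1 g -> cdiff f z d -> cdiff g z d.
Proof. by move=> E; apply: cdiff_near; exists 1. Qed.

Lemma cdiff_cst c z : cdiff (fun=> c) z 0.
Proof.
move=> e e0; exists 1 => // h _; rewrite subrr mul0r subrr cmod0.
by rewrite mulr_ge0 ?cmod_ge0 // ltW.
Qed.

Lemma cdiff_id z : cdiff (fun x => x) z 1.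
Proof.
move=> e e0; exists 1 => // h _; have -> : z + h - z - 1 * h = 0 by ring.
rewrite cmod0.
by rewrite mulr_ge0 ?cmod_ge0 // ltW.
Qed.

Lemma cdiffD f g z d d' : cdiff f z d -> cdiff g z d' ->
  cdiff (fun x => f x + g x) z (d + d').
Proof.
move=> F G e e0; have e20 : 0 < e / 2 by lra.
have [r r0 {}F] := F _ e20; have [s s0 {}G] := G _ e20.
exists (Num.min r s); first by rewrite lt_min r0.
move=> h; rewrite lt_min => /andP[/F h1 /G h2].
have -> : f (z + h) + g (z + h) - (f z + g z) - (d + d') * h =
  (f (z + h) - f z - d * h) + (g (z + h) - g z - d' * h) by ring.
by have := cmodD (f (z + h) - f z - d * h) (g (z + h) - g z - d' * h); lra.
Qed.

Lemma cdiffM f g z d d' : cdiff f z d -> cdiff g z d' ->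
  cdiff (fun x => f x * g x) z (d * g z + f z * d').
Proof.
move=> F G e e0.
pose A := cmod (f z) + cmod (g z) + cmod d + 1.
have [f0 g0 d0] := And3 (cmod_ge0 (f z)) (cmod_ge0 (g z)) (cmod_ge0 d).
have A0 : 0 < A by rewrite /A; lra.
pose e' := Num.min 1 (e / (3 * A)).
have e'0 : 0 < e' by rewrite lt_min ltr01 divr_gt0 // mulr_gt0.
have e'1 : e' <= 1 by rewrite ge_min lexx.
have e'A : e' * (3 * A) <= e by rewrite -ler_pdivlMr ?mulr_gt0 // ge_min lexx orbT.
have [t t0 Gc] := cdiff_cont G e'0.
have [r r0 {}F] := F _ e'0; have [s s0 {}G] := G _ e'0.
exists (Num.min (Num.min r s) t); first by rewrite !lt_min r0 s0.
move=> h; rewrite !lt_min => /andP[/andP[/F h1 /G h2] /Gc h3].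
have -> : f (z + h) * g (z + h) - f z * g z - (d * g z + f z * d') * h =
  (f (z + h) - f z - d * h) * (g z + (g (z + h) - g z)) +
  (f z * (g (z + h) - g z - d' * h) + d * h * (g (z + h) - g z)) by ring.
apply: le_trans (cmodD _ _) _; apply: le_trans (lerD (lexx _) (cmodD _ _)) _.
rewrite !cmodM.
have H0 := cmod_ge0 h.
have B1 := cmod_ge0 (f (z + h) - f z - d * h).
have B2 := cmod_ge0 (g (z + h) - g z - d' * h).
have B3 := cmod_ge0 (g (z + h) - g z).
have B4 := cmodD (g z) (g (z + h) - g z).
have I1 : cmod (f (z + h) - f z - d * h) * cmod (g z + (g (z + h) - g z)) <=
  e' * cmod h * A.
  apply: ler_pM => //; rewrite ?cmod_ge0 //.
  by apply: le_trans B4 _; rewrite /A; lra.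
have I2 : cmod (f z) * cmod (g (z + h) - g z - d' * h) <= A * (e' * cmod h).
  by apply: ler_pM => //; rewrite /A; lra.
have I3 : cmod d * cmod h * cmod (g (z + h) - g z) <= A * cmod h * e'.
  apply: ler_pM => //; first by rewrite mulr_ge0.
  by apply: ler_wpM2r => //; rewrite /A; lra.
have : e' * (3 * A) * cmod h <= e * cmod h by apply: ler_wpM2r.
lra.
Qed.

Lemma cdiffN f z d : cdiff f z d -> cdiff (fun x => - f x) z (- d).
Proof.
move=> F; have := cdiffM (cdiff_cst (-1) z) F; rewrite mul0r add0r mulN1r.
by apply: cdiff_ext => x; rewrite mulN1r.
Qed.

Lemma cdiffB f g z d d' : cdiff f z d -> cdiff g z d' ->
  cdiff (fun x => f x - g x) z (d - d').
Proof. by move=> F G; apply: cdiffD => //; apply: cdiffN. Qed.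

Lemma cdiff_shift f z a d : cdiff f (z + a) d -> cdiff (fun x => f (x + a)) z d.
Proof.
by move=> F e /F[r r0 H]; exists r => // h /H; rewrite (addrAC z h a).
Qed.

Lemma cdiff_inv z : z != 0 -> cdiff (fun x => x^-1) z (- z^-1 ^+ 2).
Proof.
move=> z0 e e0; have Z0 : 0 < cmod z by rewrite cmod_gt0.
exists (Num.min (cmod z / 2) (e * cmod z ^+ 3 / 2)).
  by rewrite lt_min !divr_gt0 ?mulr_gt0 ?exprn_gt0.
move=> h; rewrite lt_min => /andP[h1 h2].
have H := cmod_lower z h.
have N0 : 0 < cmod (z + h) by lra.
have zh0 : z + h != 0 by rewrite -cmod_gt0.
have -> : (z + h)^-1 - z^-1 - - z^-1 ^+ 2 * h = h ^+ 2 / (z ^+ 2 * (z + h)).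
  by field; rewrite z0 zh0.
rewrite cmodf cmodX cmodM cmodX ler_pdivrMr ?mulr_gt0 ?exprn_gt0 //.
have H0 := cmod_ge0 h.
have : cmod h * cmod h <= cmod h * (e * cmod z ^+ 3 / 2) by apply: ler_wpM2l => //; lra.
have : e * cmod h * (cmod z ^+ 2 * (cmod z / 2)) <= e * cmod h * (cmod z ^+ 2 * cmod (z + h)).
  apply: ler_wpM2l; first by rewrite mulr_ge0 // ltW.
  by apply: ler_wpM2l; [rewrite exprn_ge0 // ltW | lra].
rewrite !expr2 !exprS expr0; lra.
Qed.

Lemma cdiff_comp f g z d d' : cdiff f z d -> cdiff g (f z) d' ->
  cdiff (fun x => g (f x)) z (d' * d).
Proof.
move=> F G e e0; have D0 := cmod_ge0 d; have D0' := cmod_ge0 d'.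
pose e1 := Num.min 1 (e / (2 * (cmod d' + 1))).
have e10 : 0 < e1 by rewrite lt_min ltr01 divr_gt0 //; lra.
have e11 : e1 <= 1 by rewrite ge_min lexx.
have e12 : e1 * (2 * (cmod d' + 1)) <= e by rewrite -ler_pdivlMr ?ge_min ?lexx ?orbT //; lra.
pose e2 := e / (2 * (cmod d + 1)).
have e20 : 0 < e2 by rewrite divr_gt0 //; lra.
have e22 : e2 * (2 * (cmod d + 1)) = e by rewrite /e2 divfK // gt_eqF //; lra.
have [s s0 {}G] := G _ e20.
have s20 : 0 < s / 2 by lra.
have [t t0 Fc] := cdiff_cont F s20.
have [r r0 {}F] := F _ e10.
exists (Num.min r t); first by rewrite lt_min r0.
move=> h; rewrite lt_min => /andP[/F h1 /Fc h2].
set k := f (z + h) - f z in h1 h2.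
have ks : cmod k < s by lra.
have := G k ks; have -> : f z + k = f (z + h) by rewrite /k addrC subrK.
move=> h3.
have -> : g (f (z + h)) - g (f z) - d' * d * h =
  (g (f (z + h)) - g (f z) - d' * k) + d' * (k - d * h) by ring.
apply: le_trans (cmodD _ _) _; rewrite cmodM.
have H0 := cmod_ge0 h.
have k1 : cmod k <= (cmod d + 1) * cmod h.
  have := cmodD (k - d * h) (d * h); rewrite subrK cmodM.
  have : e1 * cmod h <= 1 * cmod h by apply: ler_wpM2r.
  lra.
have I1 : e2 * cmod k <= e2 * ((cmod d + 1) * cmod h) by apply: ler_wpM2l => //; lra.
have I2 : cmod d' * cmod (k - d * h) <= cmod d' * (e1 * cmod h) by apply: ler_wpM2l.
have I3 : e1 * (2 * (cmod d' + 1)) * cmod h <= e * cmod h by apply: ler_wpM2r.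
have I4 : e2 * (2 * (cmod d + 1)) * cmod h = e * cmod h by rewrite e22.
have I5 : 0 <= e1 * cmod h by rewrite mulr_ge0 // ltW.
lra.
Qed.

Lemma cdiffV f z d : f z != 0 -> cdiff f z d ->
  cdiff (fun x => (f x)^-1) z (- (f z)^-1 ^+ 2 * d).
Proof. by move=> z0 F; apply: (cdiff_comp F); apply: cdiff_inv. Qed.

Lemma cdiff_horner (p : {poly R[i]}) z : cdiff (fun x => p.[x]) z p^`().[z].
Proof.
elim/poly_ind: p => [|p c IH].
  by rewrite deriv0 horner0; apply: (cdiff_ext _ (cdiff_cst 0 z)) => x; rewrite horner0.
have -> : (p * 'X + c%:P)^`().[z] = p^`().[z] * z + p.[z] * 1 + 0.
  by rewrite derivD derivM derivX derivC !addr0 !mulr1 hornerD hornerM hornerX.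
have := cdiffD (cdiffM IH (cdiff_id z)) (cdiff_cst c z).
by apply: cdiff_ext => x; rewrite hornerMXaddC.
Qed.

Lemma cdiff_is_derive (f : Cplx R -> Cplx R) (z : Cplx R) d :
  cdiff f z d -> is_derive z 1 f (d : Cplx R).
Proof.
move=> F.
suff H : h^-1 *: (f (h *: (1 : Cplx R) + z) - f z) @[h --> (0 : Cplx R)^'] --> (d : Cplx R).
  by apply: DeriveDef; [apply/cvg_ex; exists d | apply: cvg_lim].
apply/cvgrPdist_le => e; rewrite ltcE /= => /andP[/eqP e1 e0].
have [r r0 {}F] := F _ e0.
apply: (proj2 (@near_cmod R 0 _)); exists r => // h; rewrite subr0 => hr hn0.
have {}hn0 : h != 0 := hn0.
have -> : e = (complex.Re e)%:C by case: (e) e1 => a b /= ->.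
rewrite [`|_|]normcE_cmod lecR.
have -> : d - h^-1 *: (f (h *: (1 : Cplx R) + z) - f z) = - ((f (z + h) - f z - d * h) / h).
  rewrite {1}/GRing.scale /= [h *: _]mulr1 (addrC h z); field.
  exact: hn0.
rewrite cmodN cmodf ler_pdivrMr ?cmod_gt0 //; exact: F.
Qed.

Lemma derivable_cdiff (f : Cplx R -> Cplx R) (z : Cplx R) :
  derivable f z 1 -> exists d, cdiff f z d.
Proof.
move/cvg_ex => [d] /cvgrPdist_le H; exists d => e e0.
have := H e%:C; rewrite ltcR => /(_ e0) /(proj1 (@near_cmod R 0 _)) [r r0 {}H].
exists r => // h hr; have [->|h0] := eqVneq h 0.
  by rewrite addr0 mulr0 subrr subr0 cmod0 mulr0.
have := H h; rewrite subr0 => /(_ hr h0).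
rewrite [`|_|]normcE_cmod lecR.
have -> : d - h^-1 *: (f (h *: (1 : Cplx R) + z) - f z) = - ((f (z + h) - f z - d * h) / h).
  rewrite {1}/GRing.scale /= [h *: _]mulr1 (addrC h z); field.
  exact: h0.
by rewrite cmodN cmodf ler_pdivrMr ?cmod_gt0.
Qed.

Lemma cdiff_derivable (f : Cplx R -> Cplx R) (z : Cplx R) d :
  cdiff f z d -> derivable f z 1.
Proof. by move/cdiff_is_derive => []. Qed.

Lemma cdiff_derive1 (f : Cplx R -> Cplx R) (z : Cplx R) d :
  cdiff f z d -> derive1 f z = d.
Proof. by move/cdiff_is_derive => [_ <-]; rewrite derive1E. Qed.

End Cdiff.

(** * Integrals of paths *)

Section PathIntegral.
Set Implicit Arguments.
Unset Strict Implicit.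
Unset Printing Implicit Defensive.
Local Open Scope complex_scope.
Variable R : realType.
Local Notation mu := (@lebesgue_measure R).

Definition rint (a b : R) (f : R -> R) : R := \int[mu]_(t in `[a, b]) f t.

Definition rcont (f : R -> R) (t : R) := forall e : R, 0 < e ->
  exists2 r : R, 0 < r & forall s, `|s| < r -> `|f (t + s) - f t| <= e.

Lemma rcont_within f a b : (forall t, a <= t <= b -> rcont f t) ->
  {within `[a, b], continuous f}.
Proof.
move=> H; apply: continuous_in_subspaceT => t; rewrite inE /= in_itv /= => /H {}H.
apply/cvgrPdist_le => e e0; have [r r0 {}H] := H _ e0.
apply/nbhs_normP; exists r => // s /=; rewrite (distrC t) => /H.
by rewrite subrKC distrC.
Qed.

Lemma rcont_integrable f a b : (forall t, a <= t <= b -> rcont f t) ->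
  mu.-integrable `[a, b] (EFin \o f).
Proof.
move=> /rcont_within H; apply: continuous_compact_integrable => //.
exact: segment_compact.
Qed.

Lemma rintD f g a b : (forall t, a <= t <= b -> rcont f t) ->
  (forall t, a <= t <= b -> rcont g t) ->
  rint a b (fun t => f t + g t) = rint a b f + rint a b g.
Proof. by move=> F G; rewrite /rint RintegralD //; exact: rcont_integrable. Qed.

Lemma rintZ c f a b : (forall t, a <= t <= b -> rcont f t) ->
  rint a b (fun t => c * f t) = c * rint a b f.
Proof. by move=> F; rewrite /rint RintegralZl //; exact: rcont_integrable. Qed.

Lemma eq_rint f g a b : (forall t, a <= t <= b -> f t = g t) ->
  rint a b f = rint a b g.
Proof.
move=> H; apply: eq_Rintegral => t; rewrite inE /= in_itv /=; exact: H.
Qed.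

Lemma rint_split f a m b : a <= m -> m <= b ->
  (forall t, a <= t <= b -> rcont f t) ->
  rint a b f = rint a m f + rint m b f.
Proof.
move=> am mb F; rewrite /rint.
have I1 : mu.-integrable `[m, b] (EFin \o f).
  apply: rcont_integrable => t /andP[h1 h2]; apply: F; rewrite h2 andbT.
  exact: le_trans h1.
have := @Rintegral_itvB R f (BLeft a) (BRight b) m (rcont_integrable F).
rewrite !bnd_simp => /(_ am mb) H.
apply/eqP; rewrite addrC -subr_eq; apply/eqP; rewrite H.
apply: Rintegral_itv_obnd_cbnd.
by apply: integrableS I1 => //; apply: subset_itv_oc_cc.
Qed.

Lemma rint_cst c a b : a <= b -> rint a b (fun=> c) = c * (b - a).
Proof.
move=> ab; rewrite /rint Rintegral_cst //= lebesgue_measure_itv /= lte_fin.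
by move: ab; rewrite le_eqVlt => /orP[/eqP ->|->] //; rewrite ltxx subrr.
Qed.

Lemma rcont_cst c t : rcont (fun=> c) t.
Proof. by move=> e /ltW e0; exists 1 => // s _; rewrite subrr normr0. Qed.

Lemma rint_le f g a b : (forall t, a <= t <= b -> rcont f t) ->
  (forall t, a <= t <= b -> rcont g t) ->
  (forall t, a <= t <= b -> f t <= g t) -> rint a b f <= rint a b g.
Proof.
by move=> F G H; apply: le_Rintegral => //; exact: rcont_integrable.
Qed.

Lemma rint_bound f a b M : a <= b -> (forall t, a <= t <= b -> rcont f t) ->
  (forall t, a <= t <= b -> `|f t| <= M) -> `|rint a b f| <= M * (b - a).
Proof.
move=> ab F H.
have Hc c t : a <= t <= b -> rcont (fun=> c) t by move=> _; exact: rcont_cst.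
have Hl t : a <= t <= b -> - M <= f t by move=> /H; rewrite ler_norml => /andP[].
have Hr t : a <= t <= b -> f t <= M by move=> /H; rewrite ler_norml => /andP[].
rewrite ler_norml -mulNr -!(rint_cst _ ab).
by rewrite (rint_le (Hc _) F Hl) (rint_le F (Hc _) Hr).
Qed.

Definition rdiff (f : R -> R) t d := forall e : R, 0 < e ->
  exists2 r : R, 0 < r & forall s, `|s| < r -> `|f (t + s) - f t - d * s| <= e * `|s|.

Lemma rdiff_is_derive f t d : rdiff f t d -> is_derive t (1 : R) f d.
Proof.
move=> F.
suff H : h^-1 *: (f (h *: (1 : R) + t) - f t) @[h --> (0 : R)^'] --> d.
  by apply: DeriveDef; [apply/cvg_ex; exists d | apply: cvg_lim].
apply/cvgrPdist_le => e e0.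
have [r r0 {}F] := F _ e0.
apply/nbhs_normP; exists r => // h /=; rewrite sub0r normrN => hr h0.
have -> : d - h^-1 *: (f (h *: (1 : R) + t) - f t) = - ((f (t + h) - f t - d * h) / h).
  by rewrite /GRing.scale /= mulr1 (addrC h t); field.
rewrite normrN normrM normfV ler_pdivrMr ?normr_gt0 //; exact: F.
Qed.

Lemma rint_FTC f F a b : a < b -> (forall t, a <= t <= b -> rcont f t) ->
  (forall t, a <= t <= b -> rdiff F t (f t)) -> rint a b f = F b - F a.
Proof.
move=> ab cf dF.
have D t : a <= t <= b -> derivable F t 1 by move=> /dF /rdiff_is_derive [].
have Cn t : a <= t <= b -> F x @[x --> t] --> F t.
  by move=> /D /derivable1_diffP /differentiable_continuous.
have ab' := ltW ab.
rewrite /rint /Rintegral (@continuous_FTC2 R f F a b ab) //.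
- exact: rcont_within.
- split => [t||].
  + rewrite in_itv /= => /andP[h1 h2]; apply: D; lra.
  + by apply: cvg_at_right_filter; apply: Cn; rewrite lexx.
  + by apply: cvg_at_left_filter; apply: Cn; rewrite lexx andbT.
- move=> t; rewrite in_itv /= => /andP[h1 h2].
  have tab : a <= t <= b by lra.
  by have [_] := rdiff_is_derive (dF _ tab); rewrite derive1E.
Qed.

Definition pcont (f : R -> R[i]) (t : R) := forall e : R, 0 < e ->
  exists2 r : R, 0 < r & forall s, `|s| < r -> cmod (f (t + s) - f t) <= e.

Definition pdiff (f : R -> R[i]) t d := forall e : R, 0 < e ->
  exists2 r : R, 0 < r & forall s, `|s| < r -> cmod (f (t + s) - f t - d * s%:C) <= e * `|s|.

Definition pint (a b : R) (f : R -> R[i]) : R[i] :=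
  rint a b (fun t => complex.Re (f t)) +i* rint a b (fun t => complex.Im (f t)).

Lemma ReB (x y : R[i]) : complex.Re (x - y) = complex.Re x - complex.Re y.
Proof. by case: x; case: y. Qed.
Lemma ImB (x y : R[i]) : complex.Im (x - y) = complex.Im x - complex.Im y.
Proof. by case: x; case: y. Qed.
Lemma ReM_real (x : R[i]) (s : R) : complex.Re (x * s%:C) = complex.Re x * s.
Proof. by case: x => a b /=; rewrite mulr0 subr0. Qed.
Lemma ImM_real (x : R[i]) (s : R) : complex.Im (x * s%:C) = complex.Im x * s.
Proof. by case: x => a b /=; rewrite mulr0 add0r. Qed.

Lemma pcont_Re f t : pcont f t -> rcont (fun t => complex.Re (f t)) t.
Proof.
move=> F e /F[r r0 H]; exists r => // s /H; apply: le_trans.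
by rewrite -ReB cmod_Re.
Qed.

Lemma pcont_Im f t : pcont f t -> rcont (fun t => complex.Im (f t)) t.
Proof.
move=> F e /F[r r0 H]; exists r => // s /H; apply: le_trans.
by rewrite -ImB cmod_Im.
Qed.

Lemma pdiff_Re f t d : pdiff f t d ->
  rdiff (fun t => complex.Re (f t)) t (complex.Re d).
Proof.
move=> F e /F[r r0 H]; exists r => // s /H; apply: le_trans.
by rewrite -ReM_real -!ReB cmod_Re.
Qed.

Lemma pdiff_Im f t d : pdiff f t d ->
  rdiff (fun t => complex.Im (f t)) t (complex.Im d).
Proof.
move=> F e /F[r r0 H]; exists r => // s /H; apply: le_trans.
by rewrite -ImM_real -!ImB cmod_Im.
Qed.

Lemma rcontZ c f t : rcont f t -> rcont (fun t => c * f t) t.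
Proof.
move=> F e e0; have c0 := normr_ge0 c.
have e1 : 0 < e / (`|c| + 1) by rewrite divr_gt0 //; lra.
have [r r0 H] := F _ e1; exists r => // s /H.
rewrite ler_pdivlMr; last lra.
rewrite -mulrBr normrM; have := normr_ge0 (f (t + s) - f t); nra.
Qed.

Lemma eq_pint f g a b : (forall t, a <= t <= b -> f t = g t) ->
  pint a b f = pint a b g.
Proof.
by move=> H; congr (_ +i* _); apply: eq_rint => t /H ->.
Qed.

Lemma pintD f g a b : (forall t, a <= t <= b -> pcont f t) ->
  (forall t, a <= t <= b -> pcont g t) ->
  pint a b (fun t => f t + g t) = pint a b f + pint a b g.
Proof.
move=> F G; rewrite /pint.
have -> : (rint a b (fun t => complex.Re (f t + g t))) =
  rint a b (fun t => complex.Re (f t)) + rint a b (fun t => complex.Re (g t)).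
  rewrite -rintD; first by apply: eq_rint => t _; case: (f t); case: (g t).
  - by move=> t /F /pcont_Re.
  - by move=> t /G /pcont_Re.
have -> // : (rint a b (fun t => complex.Im (f t + g t))) =
  rint a b (fun t => complex.Im (f t)) + rint a b (fun t => complex.Im (g t)).
rewrite -rintD; first by apply: eq_rint => t _; case: (f t); case: (g t).
- by move=> t /F /pcont_Im.
- by move=> t /G /pcont_Im.
Qed.

Lemma pintZ c f a b : (forall t, a <= t <= b -> pcont f t) ->
  pint a b (fun t => c * f t) = c * pint a b f.
Proof.
move=> F; rewrite /pint; case: c => c1 c2.
have Fr t : a <= t <= b -> rcont (fun t => complex.Re (f t)) t by move=> /F /pcont_Re.
have Fi t : a <= t <= b -> rcont (fun t => complex.Im (f t)) t by move=> /F /pcont_Im.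
rewrite [RHS]/GRing.mul /=; congr (_ +i* _).
- rewrite -mulNr -!rintZ // -rintD.
  + by apply: eq_rint => t _; case: (f t) => x y /=; rewrite mulNr.
  + by move=> t /Fr; apply: rcontZ.
  + by move=> t /Fi; apply: rcontZ.
- rewrite -!rintZ // -rintD.
  + by apply: eq_rint => t _; case: (f t) => x y /=.
  + by move=> t /Fi; apply: rcontZ.
  + by move=> t /Fr; apply: rcontZ.
Qed.

Lemma pint_split f a m b : a <= m -> m <= b ->
  (forall t, a <= t <= b -> pcont f t) ->
  pint a b f = pint a m f + pint m b f.
Proof.
move=> am mb F; rewrite /pint (rint_split am mb) ?[in X in _ +i* X](rint_split am mb) //.
- by move=> t /F /pcont_Im.
- by move=> t /F /pcont_Re.
Qed.

(** The factor 2 comes from bounding the integrals of the real and of the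
    imaginary part separately. *)
Lemma pint_bound f a b M : a <= b -> (forall t, a <= t <= b -> pcont f t) ->
  (forall t, a <= t <= b -> cmod (f t) <= M) ->
  cmod (pint a b f) <= 2 * M * (b - a).
Proof.
move=> ab F H; apply: le_trans (cmod_le_ReIm _) _ => /=.
have := @rint_bound (fun t => complex.Re (f t)) a b M ab.
have := @rint_bound (fun t => complex.Im (f t)) a b M ab.
move=> H1 H2.
have : `|rint a b (fun t => complex.Re (f t))| <= M * (b - a).
  apply: H2 => t /[dup] h1 /H; first by move: h1 => /F /pcont_Re.
  by apply: le_trans; apply: cmod_Re.
have : `|rint a b (fun t => complex.Im (f t))| <= M * (b - a).
  apply: H1 => t /[dup] h1 /H; first by move: h1 => /F /pcont_Im.
  by apply: le_trans; apply: cmod_Im.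
lra.
Qed.

Lemma pint_FTC f F a b : a < b -> (forall t, a <= t <= b -> pcont f t) ->
  (forall t, a <= t <= b -> pdiff F t (f t)) -> pint a b f = F b - F a.
Proof.
move=> ab cf dF; rewrite /pint.
rewrite (@rint_FTC _ (fun t => complex.Re (F t)) a b ab).
- rewrite (@rint_FTC _ (fun t => complex.Im (F t)) a b ab).
  + by rewrite -ReB -ImB; case: (_ - _).
  + by move=> t /cf /pcont_Im.
  + by move=> t /dF /pdiff_Im.
- by move=> t /cf /pcont_Re.
- by move=> t /dF /pdiff_Re.
Qed.

End PathIntegral.

(** * Bisection of rectangles *)

Section Quartering.
Set Implicit Arguments.
Unset Strict Implicit.
Unset Printing Implicit Defensive.
Local Open Scope complex_scope.
Variable R : realType.

Lemma half_small (W r : R) : 0 <= W -> 0 < r -> exists n : nat, W / 2 ^+ n < r.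
Proof.
move=> W0 r0; exists (Num.bound (W / r)).
have H : W / r < (Num.bound (W / r))%:R by apply: archi_boundP; rewrite divr_ge0 // ltW.
rewrite ltr_pdivrMr ?exprn_gt0 // -ltr_pdivrMl // mulrC; apply: lt_le_trans H _.
by rewrite -natrX ler_nat ltnW // ltn_expl.
Qed.

Record rect := Rect { rx1 : R; rx2 : R; ry1 : R; ry2 : R }.

(** Compactness of a closed rectangle, in a form suited to induction: if
    [P] fails on a rectangle, it fails on one of its quarters, and the nested
    sequence of failing rectangles shrinks to a point, near which [P] holds.
    It yields Goursat's theorem, the bounds of continuous functions, and the
    finiteness of zeros. *)
Lemma quartering (P : R -> R -> R -> R -> Prop) a b c d :
  a < b -> c < d ->
  (forall x1 x2 y1 y2, a <= x1 -> x1 < x2 -> x2 <= b ->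
     c <= y1 -> y1 < y2 -> y2 <= d ->
     let mx := (x1 + x2) / 2 in let my := (y1 + y2) / 2 in
     P x1 mx y1 my -> P mx x2 y1 my -> P x1 mx my y2 -> P mx x2 my y2 ->
     P x1 x2 y1 y2) ->
  (forall p q, a <= p <= b -> c <= q <= d ->
     exists2 r, 0 < r & forall x1 x2 y1 y2,
       a <= x1 -> x1 <= p -> p <= x2 -> x2 <= b ->
       c <= y1 -> y1 <= q -> q <= y2 -> y2 <= d ->
       x1 < x2 -> y1 < y2 -> x2 - x1 < r -> y2 - y1 < r -> P x1 x2 y1 y2) ->
  P a b c d.
Proof.
move=> ab cd Hsub Hloc; apply: contrapT => nP.
pose bad q := [/\ a <= rx1 q, rx1 q < rx2 q, rx2 q <= b &
  [/\ c <= ry1 q, ry1 q < ry2 q, ry2 q <= d & ~ P (rx1 q) (rx2 q) (ry1 q) (ry2 q)]].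
pose half q q' := [/\ rx1 q <= rx1 q', rx2 q' <= rx2 q,
  rx2 q' - rx1 q' = (rx2 q - rx1 q) / 2 &
  [/\ ry1 q <= ry1 q', ry2 q' <= ry2 q & ry2 q' - ry1 q' = (ry2 q - ry1 q) / 2]].
have step (q : {q | bad q}) : {q' : {q | bad q} | half (sval q) (sval q')}.
  apply: cid; case: q => -[x1 x2 y1 y2] [/= h1 h2 h3 [h4 h5 h6 h7]].
  set mx := (x1 + x2) / 2; set my := (y1 + y2) / 2.
  have mxE : mx = (x1 + x2) / 2 by []. have myE : my = (y1 + y2) / 2 by [].
  have [P1|n1] := pselect (P x1 mx y1 my); last first.
    have B : bad (Rect x1 mx y1 my) by split => //=; [lra|lra|split => //; lra].
    by exists (exist _ _ B); split => /=; [lra|lra|lra|split; lra].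
  have [P2|n2] := pselect (P mx x2 y1 my); last first.
    have B : bad (Rect mx x2 y1 my) by split => //=; [lra|lra|split => //; lra].
    by exists (exist _ _ B); split => /=; [lra|lra|lra|split; lra].
  have [P3|n3] := pselect (P x1 mx my y2); last first.
    have B : bad (Rect x1 mx my y2) by split => //=; [lra|lra|split => //; lra].
    by exists (exist _ _ B); split => /=; [lra|lra|lra|split; lra].
  have [P4|n4] := pselect (P mx x2 my y2); last first.
    have B : bad (Rect mx x2 my y2) by split => //=; [lra|lra|split => //; lra].
    by exists (exist _ _ B); split => /=; [lra|lra|lra|split; lra].
  by case: h7; apply: Hsub.
have B0 : bad (Rect a b c d) by split => //=; split.
pose s n := iter n (fun q => sval (step q)) (exist _ _ B0).
pose S n := sval (s n).
have SB n : bad (S n) by exact: (svalP (s n)).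
have SH n : half (S n) (S n.+1) by exact: (svalP (step (s n))).
have mono1 m n : (m <= n)%N -> rx1 (S m) <= rx1 (S n) /\ rx2 (S n) <= rx2 (S m).
  move/subnK <-; elim: (n - m)%N => [//|k [i1 i2]].
  by case: (SH (k + m)%N) => j1 j2 _ _; rewrite addSn; lra.
have mono2 m n : (m <= n)%N -> ry1 (S m) <= ry1 (S n) /\ ry2 (S n) <= ry2 (S m).
  move/subnK <-; elim: (n - m)%N => [//|k [i1 i2]].
  by case: (SH (k + m)%N) => _ _ _ [j1 j2 _]; rewrite addSn; lra.
have wid n : rx2 (S n) - rx1 (S n) = (b - a) / 2 ^+ n /\
             ry2 (S n) - ry1 (S n) = (d - c) / 2 ^+ n.
  elim: n => [|n [i1 i2]]; first by rewrite expr0 !divr1.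
  case: (SH n) => _ _ -> [_ _ ->]; rewrite i1 i2 exprS.
  by split; field; rewrite expf_neq0.
have cross1 m n : rx1 (S m) <= rx2 (S n).
  have [_ sm _ _] := SB m; have [_ sn _ _] := SB n.
  by case: (leqP m n) => [/mono1|/ltnW/mono1] [i1 i2]; lra.
have cross2 m n : ry1 (S m) <= ry2 (S n).
  have [_ _ _ [_ sm _ _]] := SB m; have [_ _ _ [_ sn _ _]] := SB n.
  by case: (leqP m n) => [/mono2|/ltnW/mono2] [i1 i2]; lra.
pose X := range (fun n => rx1 (S n)); pose Y := range (fun n => ry1 (S n)).
have Xs n : rx1 (S n) <= sup X <= rx2 (S n).
  apply/andP; split.
    by apply: ub_le_sup; [exists (rx2 (S 0)) => _ [m _ <-] | exists n].
  by apply: ge_sup; [exists (rx1 (S 0)); exists 0%N | move=> _ [m _ <-]].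
have Ys n : ry1 (S n) <= sup Y <= ry2 (S n).
  apply/andP; split.
    by apply: ub_le_sup; [exists (ry2 (S 0)) => _ [m _ <-] | exists n].
  by apply: ge_sup; [exists (ry1 (S 0)); exists 0%N | move=> _ [m _ <-]].
have [r r0 Hr] := Hloc (sup X) (sup Y) (Xs 0%N) (Ys 0%N).
have [n1 N1] := @half_small (b - a) r ltac:(lra) r0.
have [n2 N2] := @half_small (d - c) r ltac:(lra) r0.
set n := maxn n1 n2.
have shr (W : R) k : 0 <= W -> (k <= n)%N -> W / 2 ^+ n <= W / 2 ^+ k.
  move=> W0 kn; apply: ler_wpM2l => //; rewrite lef_pV2 ?posrE ?exprn_gt0 //.
  by rewrite ler_eXn2l // ltr1n.
have [w1 w2] := wid n.
have /andP[X1 X2] := Xs n; have /andP[Y1 Y2] := Ys n.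
have [s1 s2 s3 [s4 s5 s6 s7]] := SB n.
apply: s7; apply: Hr => //.
  rewrite w1; apply: le_lt_trans N1; apply: shr; [lra | exact: leq_maxl].
rewrite w2; apply: le_lt_trans N2; apply: shr; [lra | exact: leq_maxr].
Qed.

End Quartering.

(** * Integrals over the boundary of a rectangle *)

Section RectInt.
Set Implicit Arguments.
Unset Strict Implicit.
Unset Printing Implicit Defensive.
Local Open Scope complex_scope.
Variable R : realType.
Implicit Types (f g : R[i] -> R[i]) (w z : R[i]).

Definition in_rect x1 x2 y1 y2 w : Prop :=
  (x1 <= complex.Re w <= x2) /\ (y1 <= complex.Im w <= y2).

Definition rect_bd x1 x2 y1 y2 w : Prop :=
  in_rect x1 x2 y1 y2 w /\ (complex.Re w = x1 \/ complex.Re w = x2 \/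
                        complex.Im w = y1 \/ complex.Im w = y2).

Definition hseg f x1 x2 y := pint x1 x2 (fun t => f (t +i* y)).
Definition vseg f x y1 y2 := pint y1 y2 (fun t => f (x +i* t)).

(** Counterclockwise: the upper and the left edges are traversed backwards,
    whence the minus signs. *)
Definition rectint f x1 x2 y1 y2 :=
  (hseg f x1 x2 y1 - hseg f x1 x2 y2) +
  'i%C * (vseg f x2 y1 y2 - vseg f x1 y1 y2).

Lemma hshift (x s y : R) : ((x + s) +i* y) = (x +i* y) + s%:C :> R[i].
Proof. by apply/eqP; rewrite eq_complex /= addr0 !eqxx. Qed.

Lemma vshift (x s y : R) : (x +i* (y + s)) = (x +i* y) + 'i%C * s%:C :> R[i].
Proof. by apply/eqP; rewrite eq_complex /= !mul0r !mul1r subr0 addr0 add0r !eqxx. Qed.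

Lemma cmod_is (s : R) : cmod ('i%C * s%:C) = `|s|.
Proof. by rewrite cmodM cmod_i mul1r cmod_real. Qed.

Lemma ccont_h f x y : ccont f (x +i* y) -> pcont (fun t => f (t +i* y)) x.
Proof.
move=> F e /F[r r0 H]; exists r => // s sr; rewrite hshift; apply: H.
by rewrite cmod_real.
Qed.

Lemma ccont_v f x y : ccont f (x +i* y) -> pcont (fun t => f (x +i* t)) y.
Proof.
move=> F e /F[r r0 H]; exists r => // s sr; rewrite vshift; apply: H.
by rewrite cmod_is.
Qed.

Lemma cdiff_h f x y d : cdiff f (x +i* y) d -> pdiff (fun t => f (t +i* y)) x d.
Proof.
move=> F e /F[r r0 H]; exists r => // s sr; rewrite hshift.
by have := H s%:C; rewrite cmod_real; apply.
Qed.

Lemma cdiff_v f x y d : cdiff f (x +i* y) d ->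
  pdiff (fun t => f (x +i* t)) y (d * 'i%C).
Proof.
move=> F e /F[r r0 H]; exists r => // s sr; rewrite vshift -mulrA.
by have := H ('i%C * s%:C); rewrite cmod_is; apply.
Qed.

Section Edges.
Variables (x1 x2 y1 y2 : R).
Hypotheses (xx : x1 <= x2) (yy : y1 <= y2).
Local Notation B := (rect_bd x1 x2 y1 y2).

Lemma bd_b t : x1 <= t <= x2 -> B (t +i* y1).
Proof. by move=> H; split; [split; rewrite //= lexx | right; right; left]. Qed.
Lemma bd_t t : x1 <= t <= x2 -> B (t +i* y2).
Proof. by move=> H; split; [split; rewrite //= lexx andbT | right; right; right]. Qed.
Lemma bd_l t : y1 <= t <= y2 -> B (x1 +i* t).
Proof. by move=> H; split; [split; rewrite //= lexx | left]. Qed.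
Lemma bd_r t : y1 <= t <= y2 -> B (x2 +i* t).
Proof. by move=> H; split; [split; rewrite //= lexx andbT | right; left]. Qed.

Lemma eq_rectint f g : (forall w, B w -> f w = g w) ->
  rectint f x1 x2 y1 y2 = rectint g x1 x2 y1 y2.
Proof.
move=> H; rewrite /rectint /hseg /vseg.
by congr (_ - _ + _ * (_ - _)); apply: eq_pint => t tt; apply: H;
  [apply: bd_b|apply: bd_t|apply: bd_r|apply: bd_l].
Qed.

Lemma edge_pcont f : (forall w, B w -> ccont f w) ->
  [/\ forall t, x1 <= t <= x2 -> pcont (fun t => f (t +i* y1)) t,
      forall t, x1 <= t <= x2 -> pcont (fun t => f (t +i* y2)) t,
      forall t, y1 <= t <= y2 -> pcont (fun t => f (x1 +i* t)) t &
      forall t, y1 <= t <= y2 -> pcont (fun t => f (x2 +i* t)) t].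
Proof.
move=> H; split => t tt.
- by apply: ccont_h; apply: H; apply: bd_b.
- by apply: ccont_h; apply: H; apply: bd_t.
- by apply: ccont_v; apply: H; apply: bd_l.
- by apply: ccont_v; apply: H; apply: bd_r.
Qed.

Lemma rectintD f g : (forall w, B w -> ccont f w) -> (forall w, B w -> ccont g w) ->
  rectint (fun w => f w + g w) x1 x2 y1 y2 =
  rectint f x1 x2 y1 y2 + rectint g x1 x2 y1 y2.
Proof.
move=> /edge_pcont[f1 f2 f3 f4] /edge_pcont[g1 g2 g3 g4].
by rewrite /rectint /hseg /vseg !pintD //; ring.
Qed.

Lemma rectintZ c f : (forall w, B w -> ccont f w) ->
  rectint (fun w => c * f w) x1 x2 y1 y2 = c * rectint f x1 x2 y1 y2.
Proof.
move=> /edge_pcont[f1 f2 f3 f4].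
by rewrite /rectint /hseg /vseg !pintZ //; ring.
Qed.

(** The constant is 4 and not 2 because of [pint_bound]. *)
Lemma rectint_bound f M : (forall w, B w -> ccont f w) ->
  (forall w, B w -> cmod (f w) <= M) ->
  cmod (rectint f x1 x2 y1 y2) <= 4 * M * ((x2 - x1) + (y2 - y1)).
Proof.
move=> /edge_pcont[f1 f2 f3 f4] H; rewrite /rectint.
have H1 : cmod (hseg f x1 x2 y1) <= 2 * M * (x2 - x1).
  by apply: pint_bound => // t /bd_b/H.
have H2 : cmod (hseg f x1 x2 y2) <= 2 * M * (x2 - x1).
  by apply: pint_bound => // t /bd_t/H.
have H3 : cmod (vseg f x1 y1 y2) <= 2 * M * (y2 - y1).
  by apply: pint_bound => // t /bd_l/H.
have H4 : cmod (vseg f x2 y1 y2) <= 2 * M * (y2 - y1).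
  by apply: pint_bound => // t /bd_r/H.
apply: le_trans (cmodD _ _) _; rewrite cmodM cmod_i mul1r.
have := cmodB (hseg f x1 x2 y1) (hseg f x1 x2 y2).
have := cmodB (vseg f x2 y1 y2) (vseg f x1 y1 y2).
lra.
Qed.

End Edges.

Lemma rectint_splitx f x1 m x2 y1 y2 : x1 <= m -> m <= x2 -> y1 <= y2 ->
  (forall w, in_rect x1 x2 y1 y2 w -> ccont f w) ->
  rectint f x1 x2 y1 y2 = rectint f x1 m y1 y2 + rectint f m x2 y1 y2.
Proof.
move=> xm mx yy F; rewrite /rectint.
have S y : y1 <= y <= y2 -> hseg f x1 x2 y = hseg f x1 m y + hseg f m x2 y.
  by move=> hy; apply: pint_split => // t tt; apply: ccont_h; apply: F.
by rewrite !S ?lexx ?yy //; ring.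
Qed.

Lemma rectint_splity f x1 x2 y1 m y2 : y1 <= m -> m <= y2 -> x1 <= x2 ->
  (forall w, in_rect x1 x2 y1 y2 w -> ccont f w) ->
  rectint f x1 x2 y1 y2 = rectint f x1 x2 y1 m + rectint f x1 x2 m y2.
Proof.
move=> ym my xx F; rewrite /rectint.
have S x : x1 <= x <= x2 -> vseg f x y1 y2 = vseg f x y1 m + vseg f x m y2.
  by move=> hy; apply: pint_split => // t tt; apply: ccont_v; apply: F.
by rewrite !S ?lexx ?xx //; ring.
Qed.

Lemma pcont_mulr c (f : R -> R[i]) t : pcont f t -> pcont (fun t => f t * c) t.
Proof.
move=> F e e0; have c0 := cmod_ge0 c.
have e1 : 0 < e / (cmod c + 1) by rewrite divr_gt0 //; lra.
have [r r0 H] := F _ e1; exists r => // s /H.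
rewrite ler_pdivlMr; last lra.
rewrite -mulrBl cmodM; have := cmod_ge0 (f (t + s) - f t); nra.
Qed.

(** The integral over each edge is the difference of the values of the
    primitive at the ends, and these cancel around the boundary. *)
Lemma rectint_prim f F x1 x2 y1 y2 : x1 < x2 -> y1 < y2 ->
  (forall w, rect_bd x1 x2 y1 y2 w -> ccont f w) ->
  (forall w, rect_bd x1 x2 y1 y2 w -> cdiff F w (f w)) ->
  rectint f x1 x2 y1 y2 = 0.
Proof.
move=> xx yy cf dF; have lx := ltW xx; have ly := ltW yy.
have [f1 f2 f3 f4] := edge_pcont lx ly cf.
rewrite /rectint /hseg.
rewrite (pint_FTC (F := fun t => F (t +i* y1)) xx f1); last first.
  by move=> t tt; apply: cdiff_h; apply: dF; apply: bd_b.
rewrite (pint_FTC (F := fun t => F (t +i* y2)) xx f2); last first.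
  by move=> t tt; apply: cdiff_h; apply: dF; apply: bd_t.
have V x : (forall t, y1 <= t <= y2 -> pcont (fun t => f (x +i* t)) t) ->
    (forall t, y1 <= t <= y2 -> cdiff F (x +i* t) (f (x +i* t))) ->
    'i%C * vseg f x y1 y2 = F (x +i* y2) - F (x +i* y1).
  move=> h1 h2; rewrite /vseg -pintZ //.
  rewrite -(pint_FTC (f := fun t => f (x +i* t) * 'i%C) (F := fun t => F (x +i* t)) yy).
  - by apply: eq_pint => t _; rewrite mulrC.
  - by move=> t /h1; apply: pcont_mulr.
  - by move=> t /h2; apply: cdiff_v.
rewrite mulrBr !V //; first by ring.
- by move=> t tt; apply: dF; apply: bd_l.
- by move=> t tt; apply: dF; apply: bd_r.
Qed.

Definition hol f z := exists d, cdiff f z d.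

Lemma hol_cont f z : hol f z -> ccont f z.
Proof. by move=> [d /cdiff_cont]. Qed.

Lemma rectint_poly (p : {poly R[i]}) x1 x2 y1 y2 : x1 < x2 -> y1 < y2 ->
  forall q, p = q^`() -> rectint (fun w => p.[w]) x1 x2 y1 y2 = 0.
Proof.
move=> xx yy q ->; apply: (rectint_prim (F := fun w => q.[w])) => // w _.
  exact: cdiff_cont (cdiff_horner _ _).
exact: cdiff_horner.
Qed.

Lemma cmod_in x1 x2 y1 y2 z w : in_rect x1 x2 y1 y2 z -> in_rect x1 x2 y1 y2 w ->
  cmod (w - z) <= (x2 - x1) + (y2 - y1).
Proof.
move=> [/andP[a1 a2] /andP[a3 a4]] [/andP[b1 b2] /andP[b3 b4]].
apply: le_trans (cmod_le_ReIm _) _; rewrite ReB ImB.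
by apply: lerD; rewrite ler_norml; apply/andP; split; lra.
Qed.

(** The bound on the integral is proportional to the square of the
    perimeter, hence additive over the four quarters; and it holds for small
    rectangles because the affine part of [f] has a primitive. *)
Lemma goursat f x1 x2 y1 y2 : x1 < x2 -> y1 < y2 ->
  (forall w, in_rect x1 x2 y1 y2 w -> hol f w) ->
  rectint f x1 x2 y1 y2 = 0.
Proof.
move=> xx yy F.
suff H e : 0 < e -> cmod (rectint f x1 x2 y1 y2) <= e * ((x2 - x1) + (y2 - y1)) ^+ 2.
  apply/eqP; rewrite -cmod_eq0 eq_le cmod_ge0 andbT.
  apply/ler_addgt0Pl => e e0; rewrite addr0.
  set W := _ + _ in H; have W0 : 0 < W by rewrite /W; lra.
  have := H (e / W ^+ 2); rewrite divfK ?gt_eqF ?exprn_gt0 //.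
  by apply; rewrite divr_gt0 ?exprn_gt0.
move=> e0.
pose P a b c d := cmod (rectint f a b c d) <= e * ((b - a) + (d - c)) ^+ 2.
apply: (@quartering R P) => //.
- move=> a b c d h1 h2 h3 h4 h5 h6 mx my.
  have mxE : mx = (a + b) / 2 by []. have myE : my = (c + d) / 2 by [].
  have am : a <= mx by rewrite mxE; lra.
  have mb : mx <= b by rewrite mxE; lra.
  have cm : c <= my by rewrite myE; lra.
  have md : my <= d by rewrite myE; lra.
  have cf a' b' w : a <= a' -> b' <= b -> in_rect a' b' c d w -> ccont f w.
    clear -F h1 h3 h4 h6 => i1 i2 [/andP[j1 j2] /andP[j3 j4]].
    by apply/hol_cont/F; split; apply/andP; split; lra.
  rewrite /P => P1 P2 P3 P4.
  rewrite (rectint_splitx am mb (le_trans cm md)); last first.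
    by move=> w; apply: cf.
  rewrite (rectint_splity cm md am); last by move=> w; apply: cf.
  rewrite (rectint_splity cm md mb); last by move=> w; apply: cf.
  clear cf.
  set I1 := rectint _ _ _ _ _ in P1 *; set I2 := rectint f _ _ _ _ in P2 *.
  set I3 := rectint f _ _ _ _ in P3 *; set I4 := rectint f _ _ _ _ in P4 *.
  have := cmodD (I1 + I3) (I2 + I4); have := cmodD I1 I3; have := cmodD I2 I4.
  have E : e * (b - a + (d - c)) ^+ 2 = 4 * (e * ((b - a) / 2 + (d - c) / 2) ^+ 2).
    by field.
  move: P1 P2 P3 P4.
  have -> : mx - a = (b - a) / 2 by rewrite mxE; field.
  have -> : b - mx = (b - a) / 2 by rewrite mxE; field.
  have -> : my - c = (d - c) / 2 by rewrite myE; field.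
  have -> : d - my = (d - c) / 2 by rewrite myE; field.
  rewrite E; move: (e * _) => X; clear; lra.
- move=> p q hp hq; have pin : in_rect x1 x2 y1 y2 (p +i* q) by split.
  have [D dF] := F _ pin.
  have e4 : 0 < e / 4 by lra.
  have [r r0 H] := dF _ e4.
  exists (r / 2); first by lra.
  move=> a b c d h1 h2 h3 h4 h5 h6 h7 h8 ab cd w1 w2; rewrite /P.
  set z := p +i* q in pin dF H *.
  have zin : in_rect a b c d z by split => /=; lra.
  (* The affine part of f at z has a primitive, so only f - T contributes. *)
  pose T : {poly R[i]} := D *: 'X + (f z - D * z)%:P.
  have TE w : T.[w] = f z + D * (w - z).
    by rewrite /T hornerD hornerZ hornerX hornerC; ring.
  have lab := ltW ab; have lcd := ltW cd.
  have inS w : rect_bd a b c d w -> in_rect x1 x2 y1 y2 w.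
    by move=> [[/andP[i1 i2] /andP[i3 i4]] _]; split; lra.
  have cT w : ccont (fun w => T.[w]) w by exact: cdiff_cont (cdiff_horner _ _).
  have cg w : rect_bd a b c d w -> ccont (fun w => f w - T.[w]) w.
    move=> /inS /F [d' fd]; apply: cdiff_cont.
    by apply: cdiffB fd _; apply: cdiff_horner.
  have -> : rectint f a b c d = rectint (fun w => f w - T.[w]) a b c d.
    transitivity (rectint (fun w => (f w - T.[w]) + T.[w]) a b c d).
      by apply: eq_rectint => // w _; rewrite subrK.
    rewrite rectintD // (@rectint_poly T _ _ _ _ ab cd
      ((D / 2) *: 'X^2 + (f z - D * z) *: 'X)) ?addr0 //.
    rewrite derivD !derivZ derivXn derivX /T; congr (_ + _).
      by rewrite expr1 -scalerMnr scalerMnl -mulr_natr divfK // pnatr_eq0.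
    by rewrite alg_polyC.
  have -> : e * (b - a + (d - c)) ^+ 2 =
    4 * (e / 4 * (b - a + (d - c))) * (b - a + (d - c)) by field.
  apply: rectint_bound => // w [win _].
  have dw := cmod_in zin win.
  have := H (w - z); rewrite (addrC z) subrK TE opprD addrA => H'.
  apply: le_trans (H' _) _; first lra.
  by apply: ler_wpM2l => //; lra.
Qed.

End RectInt.

(** * Removable points and the Cauchy kernel *)

Section Cauchy.
Set Implicit Arguments.
Unset Strict Implicit.
Unset Printing Implicit Defensive.
Local Open Scope complex_scope.
Variable R : realType.
Implicit Types (f g : R[i] -> R[i]) (w z : R[i]).

(** A small square around the exceptional point contributes little, since
    [g] is bounded near that point.  This is what the quotient
    (f(w) - f(z)) / (w - z) of Cauchy's formula needs. *)
Lemma goursat_point g z (x1 x2 y1 y2 : R) :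
  x1 < complex.Re z < x2 -> y1 < complex.Im z < y2 ->
  (forall w, in_rect x1 x2 y1 y2 w -> ccont g w) ->
  (forall w, in_rect x1 x2 y1 y2 w -> w != z -> hol g w) ->
  rectint g x1 x2 y1 y2 = 0.
Proof.
case: z => p q /= /andP[xp px] /andP[yq qy] cg hg.
set z := p +i* q in hg.
have [r1 r10 H1] := cg z ltac:(by split => /=; lra) 1 ltr01.
set M := cmod (g z) + 1.
have M0 : 0 < M by rewrite /M; have := cmod_ge0 (g z); lra.
(* 16 * M * e bounds the contribution of the square of side 2 e around z:
   the four other rectangles of the subdivision avoid z. *)
suff K e : 0 < e -> e < p - x1 -> e < x2 - p -> e < q - y1 -> e < y2 - q ->
    4 * e < r1 -> cmod (rectint g x1 x2 y1 y2) <= 16 * M * e.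
  apply/eqP; rewrite -cmod_eq0 eq_le cmod_ge0 andbT.
  apply/ler_addgt0Pl => e e0; rewrite addr0.
  pose m := Num.min (Num.min (Num.min (p - x1) (x2 - p)) (Num.min (q - y1) (y2 - q)))
    (Num.min (r1 / 4) (e / (16 * M))).
  have m0 : 0 < m by rewrite !lt_min; do ! (apply/andP; split); rewrite ?subr_gt0 ?divr_gt0 ?mulr_gt0.
  have : m <= m by [].
  rewrite {2}/m !le_min => /andP[/andP[/andP[a1 a2] /andP[a3 a4]] /andP[a5 a6]].
  have a6' : m * (16 * M) <= e by rewrite -ler_pdivlMr ?mulr_gt0.
  have := K (m / 2); have -> : 16 * M * (m / 2) = m * (16 * M) / 2 by field.
  move=> H; apply: le_trans (H _ _ _ _ _ _) _; lra.
move=> e0 e1 e2 e3 e4 e5.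
have sub (a b c d : R) : x1 <= a -> b <= x2 -> y1 <= c -> d <= y2 ->
    forall w, in_rect a b c d w -> ccont g w.
  clear -cg; move=> h1 h2 h3 h4 w [/andP[k1 k2] /andP[k3 k4]].
  by apply: cg; split; apply/andP; split; lra.
have zero (a b c d : R) : x1 <= a -> b <= x2 -> y1 <= c -> d <= y2 -> a < b -> c < d ->
    (forall w, in_rect a b c d w -> w != z) -> rectint g a b c d = 0.
  clear -hg; move=> h1 h2 h3 h4 ab cd h5; apply: goursat => // w wi.
  apply: hg; last exact: h5.
  case: wi => /andP[k1 k2] /andP[k3 k4].
  by split; apply/andP; split; lra.
have [b1 b2 b3 b4] : [/\ x1 <= p - e, p + e <= x2, y1 <= q - e & q + e <= y2].
  by split; lra.
have [c1 c2 c3 c4] : [/\ x1 < p - e, p + e < x2, y1 < q - e & q + e < y2].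
  by split; lra.
have pe : p - e < p + e by lra.
have qe : q - e < q + e by lra.
have pel := ltW pe; have qel := ltW qe.
have xy : y1 <= y2 by lra.
rewrite (rectint_splitx b1 (le_trans pel b2) xy cg).
rewrite (rectint_splitx pel b2 xy (sub _ _ _ _ b1 (lexx _) (lexx _) (lexx _))).
rewrite (rectint_splity b3 (le_trans qel b4) pel (sub _ _ _ _ b1 b2 (lexx _) (lexx _))).
rewrite (rectint_splity qel b4 pel (sub _ _ _ _ b1 b2 b3 (lexx _))).
have ni (a b c d : R) : (b < p) || (p < a) || (d < q) || (q < c) ->
    forall w, in_rect a b c d w -> w != z.
  clear; move=> h w [/andP[k1 k2] /andP[k3 k4]]; apply/negP => /eqP E.
  move: k1 k2 k3 k4; rewrite E /=; move: h => /orP[/orP[/orP[]|]|]; lra.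
rewrite (zero x1 (p - e)) ?(zero (p + e) x2) ?(zero _ _ y1 (q - e)) ?(zero _ _ (q + e) y2) //;
  try lra; try (apply: ni; lra).
rewrite !(add0r, addr0).
have -> : 16 * M * e = 4 * M * ((p + e - (p - e)) + (q + e - (q - e))) by ring.
apply: rectint_bound => // w [win _]; first exact: (sub _ _ _ _ b1 b2 b3 b4).
have zin : in_rect (p - e) (p + e) (q - e) (q + e) z by split => /=; lra.
have dw := cmod_in zin win.
have := H1 (w - z); rewrite (addrC z) subrK => H2.
have H3 : cmod (g w - g z) <= 1 by apply: H2; lra.
have := cmodD (g w - g z) (g z); rewrite subrK /M; lra.
Qed.

Lemma cont_bounded f (x1 x2 y1 y2 : R) : x1 < x2 -> y1 < y2 ->
  (forall w, in_rect x1 x2 y1 y2 w -> ccont f w) ->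
  exists2 M, 0 < M & forall w, in_rect x1 x2 y1 y2 w -> cmod (f w) <= M.
Proof.
move=> xx yy cf.
pose P a b c d := exists2 M, 0 < M & forall w, in_rect a b c d w -> cmod (f w) <= M.
apply: (@quartering R P) => //.
- move=> a b c d h1 h2 h3 h4 h5 h6 mx my [M1 p1 q1] [M2 p2 q2] [M3 p3 q3] [M4 p4 q4].
  exists (M1 + M2 + M3 + M4); first by rewrite !addr_gt0.
  move=> w [/andP[k1 k2] /andP[k3 k4]].
  have [l1|l1] := leP (complex.Re w) mx; have [l2|l2] := leP (complex.Im w) my.
  + have := q1 w; rewrite /in_rect k1 k3 l1 l2 => /(_ (conj isT isT)); lra.
  + have := q3 w; rewrite /in_rect k1 k4 l1 (ltW l2) => /(_ (conj isT isT)); lra.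
  + have := q2 w; rewrite /in_rect k2 k3 (ltW l1) l2 => /(_ (conj isT isT)); lra.
  + have := q4 w; rewrite /in_rect k2 k4 (ltW l1) (ltW l2) => /(_ (conj isT isT)); lra.
- move=> p q hp hq.
  have [r r0 H] := cf (p +i* q) (conj hp hq) 1 ltr01.
  exists (r / 2); first by lra.
  move=> a b c d h1 h2 h3 h4 h5 h6 h7 h8 ab cd w1 w2.
  exists (cmod (f (p +i* q)) + 1); first by have := cmod_ge0 (f (p +i* q)); lra.
  move=> w win.
  have zin : in_rect a b c d (p +i* q) by split; apply/andP.
  have dw := cmod_in zin win.
  have := H (w - (p +i* q)); rewrite (addrC (p +i* q)) subrK => H2.
  have H3 : cmod (f w - f (p +i* q)) <= 1 by apply: H2; lra.
  have := cmodD (f w - f (p +i* q)) (f (p +i* q)); rewrite subrK; lra.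
Qed.

Lemma holD f g z : hol f z -> hol g z -> hol (fun w => f w + g w) z.
Proof. by move=> [d F] [e G]; eexists; apply: cdiffD F G. Qed.
Lemma holB f g z : hol f z -> hol g z -> hol (fun w => f w - g w) z.
Proof. by move=> [d F] [e G]; eexists; apply: cdiffB F G. Qed.
Lemma holM f g z : hol f z -> hol g z -> hol (fun w => f w * g w) z.
Proof. by move=> [d F] [e G]; eexists; apply: cdiffM F G. Qed.
Lemma holV f z : f z != 0 -> hol f z -> hol (fun w => (f w)^-1) z.
Proof. by move=> h [d F]; eexists; apply: cdiffV F. Qed.
Lemma hol_cst c z : hol (fun=> c) z.
Proof. by exists 0; exact: cdiff_cst. Qed.
Lemma hol_id z : hol (fun w => w) z.
Proof. by exists 1; exact: cdiff_id. Qed.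
Lemma holX f n z : hol f z -> hol (fun w => f w ^+ n) z.
Proof.
move=> F; elim: n => [|n [d G]]; first by exists 0; apply: cdiff_cst.
by move: F => [e F]; eexists; apply: cdiff_ext (cdiffM F G) => w; rewrite exprS.
Qed.
Lemma hol_near f g z : (exists2 r, 0 < r & forall h, cmod h < r -> f (z + h) = g (z + h)) ->
  hol f z -> hol g z.
Proof. by move=> H [d F]; exists d; apply: cdiff_near H F. Qed.

Lemma geom_small (q e : R) : 0 <= q -> q < 1 -> 0 < e -> exists N : nat, q ^+ N < e.
Proof.
move=> q0 q1 e0.
have : q ^+ n @[n --> \oo] --> 0 by apply: cvg_expr; rewrite ger0_norm.
move=> /cvgrPdist_lt /(_ e e0) [N _ H]; exists N.
by have := H N (leqnn N); rewrite /= sub0r normrN ger0_norm ?exprn_ge0.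
Qed.

Section Square.
Variable S : R.
Hypothesis S0 : 0 < S.
Local Notation I := (fun f => rectint f (-S) S (-S) S).
Local Notation B := (rect_bd (-S) S (-S) S).
Let SS : -S < S. Proof. by rewrite -subr_gt0 opprK addr_gt0. Qed.
Let SSl : -S <= S. Proof. exact: ltW. Qed.

Lemma bd_cmod w : B w -> S <= cmod w.
Proof.
move=> [_ H].
have nS : `|S| = S by rewrite gtr0_norm.
suff [h|h] : `|complex.Re w| = S \/ `|complex.Im w| = S.
- by rewrite -h cmod_Re.
- by rewrite -h cmod_Im.
by case: H => [->|[->|[->|->]]]; rewrite ?normrN nS; [left|left|right|right].
Qed.

Lemma bd_neq z w : cmod z < S -> B w -> w - z != 0.
Proof.
move=> zS /bd_cmod wS; rewrite subr_eq0; apply/negP => /eqP E; move: wS zS.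
by rewrite E; lra.
Qed.

Lemma bd_neq0 w : B w -> w != 0.
Proof. by move=> /bd_cmod wS; rewrite -cmod_gt0; apply: lt_le_trans wS. Qed.

Lemma hol_pow k w : w != 0 -> hol (fun w => (w ^+ k)^-1) w.
Proof.
move=> w0; apply: holV; first by rewrite expf_neq0.
exact: holX (hol_id _).
Qed.

Lemma hol_ker z w : w - z != 0 -> hol (fun w => (w - z)^-1) w.
Proof. by move=> w0; apply: holV => //; apply: holB; [exact: hol_id|exact: hol_cst]. Qed.

(** The integrand has a primitive; only the exponent -1 has a nonzero
    integral. *)
Lemma int_pow n : I (fun w => (w ^+ n.+2)^-1) = 0.
Proof.
apply: (@rectint_prim R _ (fun w => - (n.+1%:R)^-1 * (w ^+ n.+1)^-1)) => // w Bw.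
  by apply: hol_cont; apply: hol_pow; apply: bd_neq0 Bw.
have w0 := bd_neq0 Bw.
have := cdiff_horner 'X^(n.+1) w; rewrite derivXn => D.
have e1 : ('X^(n.+1) : {poly R[i]}).[w] = w ^+ n.+1 by rewrite hornerXn.
have := cdiffM (cdiff_cst (- (n.+1%:R)^-1) w) (cdiffV (f := fun w => ('X^(n.+1)).[w]) _ D).
rewrite e1 expf_neq0 // => /(_ isT).
rewrite mul0r add0r hornerMn hornerXn -pred_Sn.
have -> : - n.+1%:R^-1 * (- (w ^+ n.+1)^-1 ^+ 2 * (w ^+ n *+ n.+1)) = (w ^+ n.+2)^-1.
  rewrite -[w ^+ n *+ _]mulr_natr !exprS; field.
  by rewrite w0 expf_neq0 // -[1](mulr1n) -natrD pnatr_eq0.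
by apply: cdiff_ext => x; rewrite hornerXn.
Qed.

Lemma int_sum (F : nat -> R[i] -> R[i]) n :
  (forall k w, B w -> hol (F k) w) ->
  I (fun w => \sum_(k < n) F k w) = \sum_(k < n) I (F k) /\
  forall w, B w -> hol (fun w => \sum_(k < n) F k w) w.
Proof.
move=> H; elim: n => [|n [IH1 IH2]].
  split; last first.
    move=> w _; apply: (@hol_near (fun=> 0)); last exact: hol_cst.
    by exists 1 => // h _; rewrite big_ord0.
  rewrite big_ord0 -[RHS](mul0r (I (fun=> 0))) -rectintZ //.
  - by apply: eq_rectint => // w _; rewrite big_ord0 mul0r.
  - by move=> w _; apply: hol_cont; apply: hol_cst.
have E : forall w, \sum_(k < n.+1) F k w = \sum_(k < n) F k w + F n w.
  by move=> w; rewrite big_ord_recr.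
split.
  rewrite big_ord_recr /= -IH1 -rectintD //.
  - by apply: eq_rectint => // w _; rewrite E.
  - by move=> w /IH2; apply: hol_cont.
  - by move=> w /(H n); apply: hol_cont.
move=> w Bw; apply: (hol_near (f := fun w => \sum_(k < n) F k w + F n w)).
  by exists 1 => // h _; rewrite E.
by apply: holD; [exact: IH2 | exact: H].
Qed.

Lemma geom_ker z w N : w != 0 -> w - z != 0 ->
  (w - z)^-1 = \sum_(k < N) z ^+ k * (w ^+ k.+1)^-1 +
               z ^+ N * ((w ^+ N)^-1 * (w - z)^-1).
Proof.
move=> w0 wz; elim: N => [|N IH].
  by rewrite big_ord0 !expr0 invr1 !mul1r add0r.
rewrite big_ord_recr /= {1}IH -addrA; congr (_ + _).
by rewrite !exprS; field; rewrite w0 wz expf_neq0.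
Qed.

(** Expands the Cauchy kernel in a finite geometric sum, keeping the
    remainder; no convergence of series is involved. *)
Lemma int_expand f M z : cmod z < S -> (forall w, B w -> hol f w) ->
  (forall w, B w -> cmod (f w) <= M) -> 0 <= M ->
  forall N, cmod (I (fun w => f w * (w - z)^-1) -
    \sum_(k < N) z ^+ k * I (fun w => f w * (w ^+ k.+1)^-1)) <=
    16 * S * M / (S - cmod z) * (cmod z / S) ^+ N.
Proof.
move=> zS hf fM M0 N.
pose G k w := z ^+ k * (f w * (w ^+ k.+1)^-1).
have hfk k w : B w -> hol (fun w => f w * (w ^+ k)^-1) w.
  by move=> Bw; apply: holM; [exact: hf | apply: hol_pow; exact: bd_neq0 Bw].
have hG k w : B w -> hol (G k) w.
  by move=> Bw; apply: holM; [exact: hol_cst | exact: hfk].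
pose T w := z ^+ N * (f w * (w ^+ N)^-1 * (w - z)^-1).
have hT w : B w -> hol T w.
  move=> Bw; apply: holM; first exact: hol_cst.
  by apply: holM; [exact: hfk | apply: hol_ker; exact: bd_neq Bw].
have [G1 G2] := int_sum N hG.
have -> : I (fun w => f w * (w - z)^-1) = I (fun w => \sum_(k < N) G k w + T w).
  apply: eq_rectint => // w Bw.
  rewrite {1}(geom_ker N (bd_neq0 Bw) (bd_neq zS Bw)) mulrDr mulr_sumr.
  congr (_ + _); last by rewrite /T; ring.
  by apply: eq_bigr => k _; rewrite /G; ring.
rewrite rectintD //; last first.
- by move=> w /hT; apply: hol_cont.
- by move=> w /G2; apply: hol_cont.
rewrite G1.
have -> : \sum_(k < N) I (G k) = \sum_(k < N) z ^+ k * I (fun w => f w * (w ^+ k.+1)^-1).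
  by apply: eq_bigr => k _; rewrite /G rectintZ // => w /(hfk k.+1); apply: hol_cont.
rewrite addrC addKr.
have zS' : 0 < S - cmod z by rewrite subr_gt0.
have -> : 16 * S * M / (S - cmod z) * (cmod z / S) ^+ N =
  4 * (cmod z ^+ N * (M / S ^+ N / (S - cmod z))) * ((S - - S) + (S - - S)).
  by rewrite expr_div_n; field; rewrite expf_neq0 ?gt_eqF.
apply: rectint_bound => // w Bw; first by apply: hol_cont; exact: hT.
have wS := bd_cmod Bw.
have w1 : 0 < cmod w := lt_le_trans S0 wS.
rewrite /T !cmodM !cmodV !cmodX; apply: ler_wpM2l; first by rewrite exprn_ge0 ?cmod_ge0.
apply: ler_pM; rewrite ?mulr_ge0 ?invr_ge0 ?exprn_ge0 ?cmod_ge0 //.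
  apply: ler_pM; rewrite ?invr_ge0 ?exprn_ge0 ?cmod_ge0 //; first exact: fM.
  by rewrite lef_pV2 ?posrE ?exprn_gt0 // lerXn2r ?nnegrE // ltW.
have := cmod_lower (w - z) z; rewrite subrK => h.
have h2 : S - cmod z <= cmod (w - z).
  by have := cmodD (w - z) z; rewrite subrK; lra.
by rewrite lef_pV2 ?posrE //; lra.
Qed.

End Square.
End Cauchy.

(** * Cauchy's formula and Taylor expansions *)

Section Taylor.
Set Implicit Arguments.
Unset Strict Implicit.
Unset Printing Implicit Defensive.
Local Open Scope complex_scope.
Variable R : realType.
Implicit Types (f g : R[i] -> R[i]) (w z : R[i]).
Variable S : R.
Hypothesis S0 : 0 < S.
Local Notation I := (fun f => rectint f (-S) S (-S) S).
Local Notation B := (rect_bd (-S) S (-S) S).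
Let SS : -S < S. Proof. by rewrite -subr_gt0 opprK addr_gt0. Qed.
Let SSl : -S <= S. Proof. exact: ltW. Qed.
Let c0 := I (fun w => w^-1).

Lemma Re_inv w : complex.Re (w^-1) = complex.Re w / cmod w ^+ 2.
Proof. by rewrite cmod_sqr; case: w. Qed.
Lemma Im_inv w : complex.Im (w^-1) = - (complex.Im w / cmod w ^+ 2).
Proof. by rewrite cmod_sqr; case: w. Qed.

Lemma Re_pint a b (p : R -> R[i]) :
  complex.Re (pint a b p) = rint a b (fun t => complex.Re (p t)).
Proof. by []. Qed.
Lemma Im_pint a b (p : R -> R[i]) :
  complex.Im (pint a b p) = rint a b (fun t => complex.Im (p t)).
Proof. by []. Qed.

Lemma bd_sqr w : B w -> cmod w ^+ 2 <= 2 * S ^+ 2.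
Proof.
move=> [[/andP[a1 a2] /andP[a3 a4]] _]; rewrite cmod_sqr.
have h1 : complex.Re w ^+ 2 <= S ^+ 2 by nra.
have h2 : complex.Im w ^+ 2 <= S ^+ 2 by nra.
lra.
Qed.

Lemma bd_inv w : B w -> 1 / (2 * S) <= S / cmod w ^+ 2.
Proof.
move=> Bw; have h := bd_sqr Bw; have h2 := bd_cmod S0 Bw.
have c1 : 0 < cmod w by exact: lt_le_trans h2.
rewrite ler_pdivlMr ?exprn_gt0 // mul1r mulrC ler_pdivrMr ?mulr_gt0 //.
by apply: le_trans h _; rewrite le_eqVlt; apply/orP; left; apply/eqP; ring.
Qed.

(** The value is 2 pi i, but nonvanishing is all that Cauchy's formula
    needs: each of the four edges contributes at least 1 to the imaginary
    part. *)
Lemma kernel_neq0 : c0 != 0.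
Proof.
have s0 := S0.
suff : 4 <= complex.Im c0.
  by move=> h; apply/negP => /eqP E; move: h; rewrite E /=; lra.
have cf : forall w, B w -> ccont (fun w => w^-1) w.
  by move=> w Bw; apply: hol_cont; apply: holV; [exact: bd_neq0 Bw | exact: hol_id].
have [f1 f2 f3 f4] := edge_pcont SSl SSl cf.
have one : 1 = 1 / (2 * S) * (S - - S) by field; rewrite gt_eqF.
have one' : -1 = - (1 / (2 * S)) * (S - - S) by field; rewrite gt_eqF.
have cst c t : -S <= t <= S -> rcont (fun=> c) t by move=> _; exact: rcont_cst.
have e1 : 1 <= complex.Im (hseg (fun w => w^-1) (-S) S (-S)).
  rewrite {1}one -rint_cst // /hseg Im_pint; apply: rint_le; [exact: cst| |].
    by move=> t /f1 /pcont_Im.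
  move=> t /(bd_b SSl) Bt; rewrite Im_inv /= mulNr opprK.
  exact: bd_inv Bt.
have e2 : complex.Im (hseg (fun w => w^-1) (-S) S S) <= -1.
  rewrite {1}one' -rint_cst // /hseg Im_pint; apply: rint_le; [|exact: cst|].
    by move=> t /f2 /pcont_Im.
  move=> t /(bd_t SSl) Bt; rewrite Im_inv /= lerN2.
  exact: bd_inv Bt.
have e3 : 1 <= complex.Re (vseg (fun w => w^-1) S (-S) S).
  rewrite {1}one -rint_cst // /vseg Re_pint; apply: rint_le; [exact: cst| |].
    by move=> t /f4 /pcont_Re.
  move=> t /(bd_r SSl) Bt; rewrite Re_inv /=.
  exact: bd_inv Bt.
have e4 : complex.Re (vseg (fun w => w^-1) (-S) (-S) S) <= -1.
  rewrite {1}one' -rint_cst // /vseg Re_pint; apply: rint_le; [|exact: cst|].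
    by move=> t /f3 /pcont_Re.
  move=> t /(bd_l SSl) Bt; rewrite Re_inv /= mulNr lerN2.
  exact: bd_inv Bt.
move: e1 e2 e3 e4; rewrite /c0 /rectint.
case: (hseg _ _ _ _) => a1 b1; case: (hseg _ _ _ _) => a2 b2.
case: (vseg _ _ _ _) => a3 b3; case: (vseg _ _ _ _) => a4 b4 /=.
clear; lra.
Qed.

(** In the expansion of 1 / (w - z) in powers of 1 / w, only the first term
    has a nonzero integral, and the remainder tends to 0. *)
Lemma kernel_const z : cmod z < S -> I (fun w => (w - z)^-1) = c0.
Proof.
move=> zS; have s0 := S0.
have M1 w : B w -> cmod ((fun=> 1 : R[i]) w) <= 1 by rewrite cmod1.
have H := int_expand S0 zS (fun w _ => hol_cst 1 w) M1 ler01.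
set X := rectint _ _ _ _ _ in H; have -> : I (fun w => (w - z)^-1) = X.
  by apply: eq_rectint => // w _; rewrite mul1r.
apply/eqP; rewrite -subr_eq0 -cmod_eq0 eq_le cmod_ge0 andbT.
apply/ler_addgt0Pl => e e0; rewrite addr0.
have z0 := cmod_ge0 z.
set K := 16 * S * 1 / _ in H.
have K0 : 0 < K by rewrite divr_gt0 ?mulr_gt0 // subr_gt0.
have [N hN] := @geom_small R (cmod z / S) (e / K) ltac:(by rewrite divr_ge0 // ltW)
  ltac:(by rewrite ltr_pdivrMr // mul1r) ltac:(by rewrite divr_gt0).
have := H N.+1; rewrite big_ord_recl /= big1; last first.
  move=> k _; rewrite -[RHS](mulr0 (z ^+ k.+1)) /bump /=; congr (_ * _).
  rewrite -[RHS](int_pow S0 k); apply: eq_rectint => // w _.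
  by rewrite mul1r.
rewrite addr0 expr0 mul1r.
have -> : rectint (fun w => 1 * (w ^+ 1)^-1) (- S) S (- S) S = c0.
  by apply: eq_rectint => // w _; rewrite mul1r expr1.
move=> h; apply: le_trans h _; rewrite exprS.
rewrite ltr_pdivlMr // in hN.
have q1 : cmod z / S <= 1 by rewrite ler_pdivrMr // mul1r ltW.
have q0 : 0 <= cmod z / S by rewrite divr_ge0 // ltW.
have p0 : 0 <= (cmod z / S) ^+ N by rewrite exprn_ge0.
have p1 : K * (cmod z / S * (cmod z / S) ^+ N) <= K * (1 * (cmod z / S) ^+ N).
  by apply: ler_wpM2l; [exact: ltW | apply: ler_wpM2r].
apply: le_trans p1 _; rewrite mul1r mulrC; exact: ltW.
Qed.

Variable f : R[i] -> R[i].
Hypothesis hf : forall w, in_rect (-S) S (-S) S w -> hol f w.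

Lemma inside z : cmod z < S -> in_rect (-S) S (-S) S z.
Proof.
move=> zS; have := cmod_Re z; have := cmod_Im z; rewrite !ler_norml.
by move=> /andP[h1 h2] /andP[h3 h4]; split; apply/andP; split; lra.
Qed.

(** The integral of the difference quotient at [z] vanishes by
    [goursat_point]; separating its two terms gives the formula, with [c0] in
    place of 2 pi i. *)
Lemma cauchy z : cmod z < S -> I (fun w => f w * (w - z)^-1) = f z * c0.
Proof.
move=> zS; have zi := inside zS.
have [d dz] := hf zi.
(* The difference quotient, continued by the derivative at z. *)
pose g w := if w == z then d else (f w - f z) * (w - z)^-1.
have gh w : in_rect (-S) S (-S) S w -> w != z -> hol g w.
  move=> wi wz; have wz0 : 0 < cmod (w - z) by rewrite cmod_gt0 subr_eq0.
  apply: (hol_near (f := fun w => (f w - f z) * (w - z)^-1)).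
    exists (cmod (w - z)) => // h hh; rewrite /g; case: eqP => // E.
    by move: hh; rewrite -E opprD addrA subrr sub0r cmodN ltxx.
  apply: holM; first by apply: holB; [exact: hf | exact: hol_cst].
  by apply: hol_ker; rewrite subr_eq0.
have gc w : in_rect (-S) S (-S) S w -> ccont g w.
  move=> wi; have [->|/gh] := eqVneq w z; last by move=> /(_ wi); exact: hol_cont.
  move=> e e0; have [r r0 H] := dz _ e0; exists r => // h hr.
  rewrite {2}/g eqxx /g; case: eqP => [_|/eqP zh].
    by rewrite subrr cmod0 ltW.
  have h0 : h != 0 by move: zh; apply: contra => /eqP ->; rewrite addr0.
  have -> : z + h - z = h by rewrite addrC addKr.
  have -> : (f (z + h) - f z) * h^-1 - d = (f (z + h) - f z - d * h) / h by field.
  by rewrite cmodf ler_pdivrMr ?cmod_gt0 //; apply: H.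
have G0 : I g = 0.
  have := cmod_Re z; have := cmod_Im z; rewrite !ler_norml.
  move=> /andP[h1 h2] /andP[h3 h4].
  by apply: (@goursat_point R g z) => //; apply/andP; split; lra.
have hk w : B w -> hol (fun w => (w - z)^-1) w.
  by move=> Bw; apply: hol_ker; exact: bd_neq Bw.
have h1 w : B w -> ccont (fun w => f w * (w - z)^-1) w.
  by move=> Bw; apply: hol_cont; apply: holM; [apply: hf; case: Bw|exact: hk].
have h2 w : B w -> ccont (fun w => (- f z) * (w - z)^-1) w.
  by move=> Bw; apply: hol_cont; apply: holM; [exact: hol_cst|exact: hk].
have : I g = I (fun w => f w * (w - z)^-1 + (- f z) * (w - z)^-1).
  apply: eq_rectint => // w Bw; have := bd_neq S0 zS Bw.
  by rewrite subr_eq0 /g => /negbTE ->; rewrite -mulrDl.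
rewrite G0 rectintD // rectintZ //; last by move=> w /hk; apply: hol_cont.
rewrite kernel_const // mulNr => /esym /eqP; rewrite subr_eq0 => /eqP //.
Qed.

(** The coefficients do not depend on the order of the expansion, and the
    constant [M] depends only on [rho]: this gives both the polynomial
    approximation and the order of a zero. *)
Theorem taylor : exists a : nat -> R[i], forall rho, rho < S ->
  exists2 M : R, 0 <= M & forall N z, cmod z <= rho ->
    cmod (f z - \sum_(k < N) a k * z ^+ k) <= M * (cmod z / S) ^+ N.
Proof.
exists (fun k => I (fun w => f w * (w ^+ k.+1)^-1) / c0) => rho rS.
have cf w : in_rect (-S) S (-S) S w -> ccont f w by move=> /hf; exact: hol_cont.
have [M M0 fM] := cont_bounded SS SS cf.
have c0p : 0 < cmod c0 by rewrite cmod_gt0 kernel_neq0.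
have s0 := S0.
exists (16 * S * M / (S - rho) / cmod c0).
  by rewrite !divr_ge0 ?mulr_ge0 ?subr_ge0 // ltW.
move=> N z zr; have zS : cmod z < S by exact: le_lt_trans rS.
have BfM w : B w -> cmod (f w) <= M by move=> [/fM].
have Bh w : B w -> hol f w by move=> [/hf].
have := int_expand S0 zS Bh BfM (ltW M0) N; rewrite cauchy //.
set X := \sum_(k < N) _ => H.
have -> : \sum_(k < N) I (fun w => f w * (w ^+ k.+1)^-1) / c0 * z ^+ k = X / c0.
  by rewrite /X mulr_suml; apply: eq_bigr => k _; ring.
have -> : f z - X / c0 = (f z * c0 - X) / c0.
  by rewrite mulrBl mulfK // kernel_neq0.
rewrite cmodf ler_pdivrMr //; apply: le_trans H _.
have -> : 16 * S * M / (S - rho) / cmod c0 * (cmod z / S) ^+ N * cmod c0 =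
  16 * S * M / (S - rho) * (cmod z / S) ^+ N by field; rewrite !gt_eqF //; lra.
apply: ler_wpM2r; first by rewrite exprn_ge0 // divr_ge0 ?cmod_ge0 // ltW.
apply: ler_wpM2l; first by rewrite !mulr_ge0 // ltW.
by rewrite lef_pV2 ?posrE; lra.
Qed.

End Taylor.

(** * Polynomial approximation and orders of zeros *)

Section Zeros.
Set Implicit Arguments.
Unset Strict Implicit.
Unset Printing Implicit Defensive.
Local Open Scope complex_scope.
Variable R : realType.
Implicit Types (f g : R[i] -> R[i]) (w z : R[i]).

Lemma inj_not_in_seq (T : eqType) (phi : nat -> T) (s : seq T) :
  injective phi -> exists k, phi k \notin s.
Proof.
move=> inj; apply: contrapT => H.
have sub : {subset map phi (iota 0 (size s).+1) <= s}.
  move=> x /mapP[k _ ->]; apply/negPn/negP => h; apply: H; by exists k.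
have := uniq_leq_size (s1 := map phi (iota 0 (size s).+1)) _ sub.
by rewrite map_inj_uniq // iota_uniq size_map size_iota ltnn => /(_ isT).
Qed.

Lemma poly_approx f S rho e : 0 < S -> rho < S -> 0 <= rho -> 0 < e ->
  (forall w, in_rect (-S) S (-S) S w -> hol f w) ->
  exists p : {poly R[i]}, forall z, cmod z <= rho -> cmod (f z - p.[z]) <= e.
Proof.
move=> S0 rS r0 e0 hf; have [a Ha] := taylor S0 hf.
have [M M0 H] := Ha _ rS.
have [N hN] := @geom_small R (rho / S) (e / (M + 1)) ltac:(by rewrite divr_ge0 // ltW)
  ltac:(by rewrite ltr_pdivrMr // mul1r) ltac:(by rewrite divr_gt0 //; lra).
exists (\poly_(k < N) a k) => z zr; rewrite horner_poly.
apply: le_trans (H N z zr) _.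
have h : (cmod z / S) ^+ N <= (rho / S) ^+ N.
  apply: lerXn2r; rewrite ?nnegrE ?divr_ge0 ?cmod_ge0 ?(ltW S0) //.
  by apply: ler_wpM2r => //; rewrite invr_ge0 ltW.
have p0 : 0 <= (cmod z / S) ^+ N by rewrite exprn_ge0 // divr_ge0 ?cmod_ge0 // ltW.
rewrite ltr_pdivlMr in hN; last lra.
have : M * (cmod z / S) ^+ N <= (M + 1) * (rho / S) ^+ N.
  by apply: ler_pM => //; lra.
lra.
Qed.

(** Either all Taylor coefficients vanish, and then f vanishes near z0, or
    the first nonzero one gives the order and the cofactor [u]. *)
Lemma zero_order f z0 r : 0 < r -> (forall w, cmod (w - z0) < r -> hol f w) ->
  (exists2 s, 0 < s & forall h, cmod h < s -> f (z0 + h) = 0) \/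
  (exists m u, [/\ hol u z0, u z0 != 0 & exists2 s, 0 < s &
     forall h, cmod h < s -> f (z0 + h) = h ^+ m * u (z0 + h) /\ u (z0 + h) != 0]).
Proof.
move=> r0 hf; pose S := r / 4; have S0 : 0 < S by rewrite /S; lra.
pose F w := f (w + z0).
have hF w : in_rect (-S) S (-S) S w -> hol F w.
  move=> [/andP[a1 a2] /andP[a3 a4]].
  have wS : cmod w < r.
    apply: le_lt_trans (cmod_le_ReIm w) _.
    have : `|complex.Re w| <= S by rewrite ler_norml a1.
    have : `|complex.Im w| <= S by rewrite ler_norml a3.
    by rewrite /S; lra.
  have [d D] : hol f (w + z0) by apply: hf; rewrite addrK.
  by exists d; apply: cdiff_shift.
have [a Ha] := taylor S0 hF.
pose rho := S / 2; have rS : rho < S by rewrite /rho; lra.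
have rho0 : 0 < rho by rewrite /rho; lra.
have [M M0 H] := Ha _ rS.
have [a0|/existsNP [k /eqP ak]] := pselect (forall k, a k = 0).
  left; exists rho => // h hr.
  have q1 : cmod h / S < 1 by rewrite ltr_pdivrMr // mul1r; lra.
  have q0 : 0 <= cmod h / S by rewrite divr_ge0 ?cmod_ge0 // ltW.
  rewrite addrC -/(F h); apply/eqP; rewrite -cmod_eq0 eq_le cmod_ge0 andbT.
  apply/ler_addgt0Pl => e e0; rewrite addr0.
  have [N hN] := @geom_small R _ (e / (M + 1)) q0 q1 ltac:(by rewrite divr_gt0 //; lra).
  have := H N h (ltW hr); rewrite big1 ?subr0; last by move=> i _; rewrite a0 mul0r.
  move=> H'; apply: le_trans H' _.
  have p0 : 0 <= (cmod h / S) ^+ N by rewrite exprn_ge0.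
  rewrite ltr_pdivlMr in hN; last lra.
  lra.
right.
have ex : exists k, a k != 0 by exists k.
have := @ex_minnP _ ex; case=> m am mmin.
(* The Taylor expansion of order m + 2 shows that u is differentiable at
   z0, with derivative a m.+1. *)
pose u w := if w == z0 then a m else f w / (w - z0) ^+ m.
have E h : cmod h <= rho -> cmod (F h - (a m * h ^+ m + a m.+1 * h ^+ m.+1)) <=
    M / S ^+ m.+2 * cmod h ^+ m.+2.
  move=> /(H m.+2); rewrite !big_ord_recr /= big1; last first.
    move=> i _; have [->|/mmin] := eqVneq (a i) 0; first by rewrite mul0r.
    by rewrite leqNgt ltn_ord.
  by rewrite add0r expr_div_n => h1; apply: le_trans h1 _; rewrite mulrA mulrAC.
set K := M / S ^+ m.+2 in E.
have K0 : 0 <= K by rewrite divr_ge0 // exprn_ge0 // ltW.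
have uE h : h != 0 -> u (z0 + h) = F h / h ^+ m.
  move=> h0; rewrite /u; case: eqP => [E0|_].
    by move: h0; rewrite -(addKr z0 h) E0 addNr eqxx.
  by rewrite /F (addrC z0) addrK.
have u0 : u z0 = a m by rewrite /u eqxx.
have du : cdiff u z0 (a m.+1).
  move=> e e0; exists (Num.min rho (e / (K + 1))).
    by rewrite lt_min rho0 divr_gt0 //; lra.
  move=> h; rewrite lt_min => /andP[h1]; rewrite ltr_pdivlMr; last lra.
  move=> h2; rewrite u0; have [->|h0] := eqVneq h 0.
    by rewrite addr0 u0 mulr0 subrr subr0 cmod0 mulr0.
  have ch0 : 0 < cmod h by rewrite cmod_gt0.
  rewrite uE //; have hm : h ^+ m != 0 by rewrite expf_neq0.
  have -> : F h / h ^+ m - a m - a m.+1 * h =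
    (F h - (a m * h ^+ m + a m.+1 * h ^+ m.+1)) / h ^+ m by rewrite exprS; field.
  rewrite cmodf cmodX ler_pdivrMr ?exprn_gt0 //.
  apply: le_trans (E _ (ltW h1)) _; rewrite !exprS !mulrA.
  apply: ler_wpM2r; first by rewrite exprn_ge0 // ltW.
  apply: ler_wpM2r; first exact: ltW.
  lra.
have am0 : 0 < cmod (a m) / 2 by rewrite divr_gt0 // cmod_gt0.
have [t t0 ct] := cdiff_cont du am0.
exists m, u; split; [by exists (a m.+1) | by rewrite u0 | exists (Num.min rho t)].
  by rewrite lt_min rho0.
move=> h; rewrite lt_min => /andP[h1 h2]; split.
  have [->|h0] := eqVneq h 0; last first.
    by rewrite uE // mulrC divfK ?expf_neq0 // /F addrC.
  rewrite addr0 u0; have := E 0; rewrite cmod0 (ltW rho0) => /(_ isT).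
  rewrite !exprS !mul0r !mulr0 addr0 => h3.
  have /eqP : cmod (F 0 - a m * 0 ^+ m) = 0 by apply/eqP; rewrite eq_le h3 cmod_ge0.
  by rewrite cmod_eq0 subr_eq0 /F add0r mulrC => /eqP.
rewrite -cmod_gt0; have := ct _ h2; rewrite u0 => h3.
have := cmodD (u (z0 + h)) (- (u (z0 + h) - a m)).
rewrite cmodN opprB addrCA subrr addr0; lra.
Qed.

End Zeros.

(** * Homogeneous coordinates of an entire curve *)

Section Lift.
Set Implicit Arguments.
Unset Strict Implicit.
Unset Printing Implicit Defensive.
Local Open Scope complex_scope.
Variable R : realType.
Variable n : nat.
Implicit Types (w z : R[i]).

Lemma hcoord_neq0 (p : CP R n) : hcoord p != 0.
Proof.
rewrite /hcoord vpick0; apply/negP => /eqP E; have := valP p.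
by rewrite E dimv0.
Qed.

Lemma hcoord_nz (p : CP R n) : exists j, hcoord p 0 j != 0.
Proof. by have /rV0Pn := hcoord_neq0 p. Qed.

Variable g : Cplx R -> CP R n.
Hypothesis hg : entire_curve g.
Local Notation v := (fun j z => hcoord (g z) 0 j).

(** The definition of an entire curve omits the coordinate i of the chart
    i; here all the ratios of coordinates are included. *)
Lemma chart_hol z i : v i z != 0 -> exists2 r, 0 < r &
  forall w, cmod (w - z) < r -> v i w != 0 /\
    forall j, hol (fun x => v j x / v i x) w.
Proof.
move=> vz; have := @hg z i vz => /(proj1 (near_cmod _ _)) [r r0 H].
exists r => // w wr; have [h1 h2] := H w wr; split => // j.
case: (unliftP i j) => [a ->|->].
  have [d D] := derivable_cdiff (h2 a); exists d.
  by apply: cdiff_ext D => x; rewrite mxE.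
apply: (hol_near (f := fun=> 1)); last exact: hol_cst.
exists (r - cmod (w - z)); first by rewrite subr_gt0.
move=> h hr; rewrite divff //.
have [] := H (w + h) => //.
rewrite addrAC; apply: le_lt_trans (cmodD _ _) _; lra.
Qed.

(** The coordinates are defined only up to a factor which need not be
    continuous in z, so the order of a zero is read on the ratio with a
    coordinate that does not vanish at [z]. *)
Lemma coord_dichotomy z j0 :
  (exists2 s, 0 < s & forall h, cmod h < s -> v j0 (z + h) = 0) \/
  (exists i m u, [/\ v i z != 0, hol u z, u z != 0 & exists2 s, 0 < s &
     forall h, cmod h < s -> [/\ v i (z + h) != 0, u (z + h) != 0 &
       v j0 (z + h) = h ^+ m * u (z + h) * v i (z + h)]]).
Proof.
have [i vi] := hcoord_nz (g z).
have [r r0 H] := chart_hol vi.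
have Hv h : cmod h < r -> v i (z + h) != 0.
  by move=> hr; have [] := H (z + h) => //; rewrite addrAC subrr add0r.
have := @zero_order R (fun x => v j0 x / v i x) z r r0 (fun w wr => (H w wr).2 j0).
move=> [[s s0 Hs]|[m [u [hu u0 [s s0 Hs]]]]].
  left; exists (Num.min r s); first by rewrite lt_min r0.
  move=> h; rewrite lt_min => /andP[h1 h2].
  have := Hs h h2 => /eqP; rewrite mulf_eq0 invr_eq0 (negbTE (Hv h h1)) orbF.
  by move/eqP.
right; exists i, m, u; split => //; exists (Num.min r s); first by rewrite lt_min r0.
move=> h; rewrite lt_min => /andP[h1 h2]; have [e1 e2] := Hs h h2.
by split => //; [exact: Hv | rewrite -e1 divfK // Hv].
Qed.

Lemma nat_small_inj (c : R[i]) : c != 0 -> injective (fun k : nat => c / (k.+1%:R)).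
Proof.
move=> c0 k l /(mulfI c0) /invr_inj /eqP; rewrite eqr_nat => /eqP [->] //.
Qed.

(** Two rectangles that share a segment share infinitely many points,
    hence a zero set cannot be finite in one and everything in the other. *)
Lemma edge_infinite z c (s : seq R[i]) : c != 0 ->
  exists t : R, 0 <= t <= 1 /\ z + c * t%:C \notin s.
Proof.
move=> c0; have inj : injective (fun k : nat => z + c * ((k.+1%:R : R)^-1)%:C).
  move=> k l /addrI; rewrite fmorphV fmorphV !rmorph_nat.
  exact: nat_small_inj.
have [k hk] := inj_not_in_seq s inj; exists (k.+1%:R^-1); split => //.
by rewrite invr_ge0 ler0n /= invf_le1 ?ltr0n // ler1n.
Qed.

(** An identity theorem: by [coord_dichotomy] both alternatives hold
    locally, and adjacent rectangles must satisfy the same one because they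
    share a nondegenerate edge. *)
Lemma finite_zeros (x1 x2 y1 y2 : R) j0 : x1 < x2 -> y1 < y2 ->
  (exists s : seq R[i], forall w, in_rect x1 x2 y1 y2 w -> v j0 w = 0 -> w \in s) \/
  (forall w, in_rect x1 x2 y1 y2 w -> v j0 w = 0).
Proof.
move=> xx yy.
pose fin a b c d := exists s : seq R[i], forall w, in_rect a b c d w -> v j0 w = 0 -> w \in s.
pose zer a b c d := forall w, in_rect a b c d w -> v j0 w = 0.
pose P a b c d := fin a b c d \/ zer a b c d.
(* An infinity of common points on the segment from z to z + e propagates
   the vanishing. *)
have share z e a b c d a' b' c' d' : e != 0 ->
    (forall t : R, 0 <= t <= 1 -> in_rect a b c d (z + e * t%:C) /\ in_rect a' b' c' d' (z + e * t%:C)) ->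
    P a b c d -> zer a' b' c' d' -> zer a b c d.
  move=> e0 He [[s Hs]|//] Hz.
  have [t [t01 ts]] := edge_infinite z s e0.
  have [i1 i2] := He t t01; move: ts; rewrite Hs //; exact: Hz.
apply: (@quartering R P) => //.
- move=> a b c d h1 h2 h3 h4 h5 h6 mx my.
  have am : a < mx by rewrite /mx; lra.
  have mb : mx < b by rewrite /mx; lra.
  have cm : c < my by rewrite /my; lra.
  have md : my < d by rewrite /my; lra.
  move: mx my am mb cm md => mx my am mb cm md P1 P2 P3 P4.
  have cover w : in_rect a b c d w -> [\/ in_rect a mx c my w, in_rect mx b c my w, in_rect a mx my d w | in_rect mx b my d w].
    move=> [/andP[k1 k2] /andP[k3 k4]].
    have [l1|/ltW l1] := leP (complex.Re w) mx; have [l2|/ltW l2] := leP (complex.Im w) my.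
    + by apply: Or41; split; apply/andP.
    + by apply: Or43; split; apply/andP.
    + by apply: Or42; split; apply/andP.
    + by apply: Or44; split; apply/andP.
  have vert (lo hi : R) : lo < hi -> forall t : R, 0 <= t <= 1 ->
      forall x, in_rect x x lo hi ((x +i* lo) + ((0 : R) +i* (hi - lo)) * t%:C).
    move=> lh t t01 x; rewrite /in_rect /= !mul0r !mulr0 subr0 !addr0 add0r lexx; split => //.
    by clear -lh t01; nra.
  have hori (lo hi : R) : lo < hi -> forall t : R, 0 <= t <= 1 ->
      forall y, in_rect lo hi y y ((lo +i* y) + (hi - lo)%:C * t%:C).
    move=> lh t t01 x; rewrite /in_rect /= !mul0r !mulr0 subr0 !addr0 lexx; split => //.
    by clear -lh t01; nra.
  have vn (lo hi : R) : lo < hi -> ((0 : R) +i* (hi - lo)) != 0.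
    by move=> lh; rewrite eq_complex /= eqxx subr_eq0 gt_eqF.
  have hn (lo hi : R) : lo < hi -> (hi - lo)%:C != 0 :> R[i].
    by move=> lh; rewrite eq_complex /= subr_eq0 gt_eqF.
  have wid a' b' c' d' (x y x' y' : R) w : in_rect x x' y y' w -> a' <= x -> x' <= b' -> c' <= y -> y' <= d' ->
      in_rect a' b' c' d' w.
    by clear; move=> [/andP[k1 k2] /andP[k3 k4]] l1 l2 l3 l4; split; apply/andP; split; lra.
  have [lam lmb lcm lmd] := And4 (ltW am) (ltW mb) (ltW cm) (ltW md).
  have z12 : zer mx b c my -> zer a mx c my.
    apply: (share (mx +i* c) ((0 : R) +i* (my - c))) => //; first exact: vn.
    by move=> t t01; have h := vert _ _ cm t t01 mx; split; apply: (wid _ _ _ _ _ _ _ _ _ h).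
  have z21 : zer a mx c my -> zer mx b c my.
    apply: (share (mx +i* c) ((0 : R) +i* (my - c))) => //; first exact: vn.
    by move=> t t01; have h := vert _ _ cm t t01 mx; split; apply: (wid _ _ _ _ _ _ _ _ _ h).
  have z34 : zer mx b my d -> zer a mx my d.
    apply: (share (mx +i* my) ((0 : R) +i* (d - my))) => //; first exact: vn.
    by move=> t t01; have h := vert _ _ md t t01 mx; split; apply: (wid _ _ _ _ _ _ _ _ _ h).
  have z43 : zer a mx my d -> zer mx b my d.
    apply: (share (mx +i* my) ((0 : R) +i* (d - my))) => //; first exact: vn.
    by move=> t t01; have h := vert _ _ md t t01 mx; split; apply: (wid _ _ _ _ _ _ _ _ _ h).
  have z13 : zer a mx my d -> zer a mx c my.
    apply: (share (a +i* my) ((mx - a)%:C)) => //; first exact: hn.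
    by move=> t t01; have h := hori _ _ am t t01 my; split; apply: (wid _ _ _ _ _ _ _ _ _ h).
  have z31 : zer a mx c my -> zer a mx my d.
    apply: (share (a +i* my) ((mx - a)%:C)) => //; first exact: hn.
    by move=> t t01; have h := hori _ _ am t t01 my; split; apply: (wid _ _ _ _ _ _ _ _ _ h).
  have all0 : zer a mx c my -> P a b c d.
    move=> Z1; right => w /cover [Z|Z|Z|Z].
    + exact: Z1.
    + exact: (z21 Z1).
    + exact: (z31 Z1).
    + exact: (z43 (z31 Z1)).
  case: P1 => [[s1 f1]|/all0//].
  case: P2 => [[s2 f2]|/z12/all0//].
  case: P3 => [[s3 f3]|/z13/all0//].
  case: P4 => [[s4 f4]|/z34/z13/all0//].
  left; exists (s1 ++ s2 ++ s3 ++ s4) => w /cover[Z|Z|Z|Z] w0; rewrite !mem_cat.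
  + by rewrite f1.
  + by rewrite f2 ?orbT.
  + by rewrite f3 ?orbT.
  + by rewrite f4 ?orbT.
- move=> p q hp hq.
  case: (coord_dichotomy (p +i* q) j0) => [[s s0 Hs]|[i [m [u [_ _ _ [s s0 Hs]]]]]].
    exists (s / 2); first by lra.
    move=> a b c d h1 h2 h3 h4 h5 h6 h7 h8 ab cd w1 w2; right => w win.
    have zin : in_rect a b c d (p +i* q) by split; apply/andP.
    have dw := cmod_in zin win.
    have := Hs (w - (p +i* q)); rewrite (addrC (p +i* q)) subrK; apply; lra.
  exists (s / 2); first by lra.
  move=> a b c d h1 h2 h3 h4 h5 h6 h7 h8 ab cd w1 w2; left; exists [:: p +i* q] => w win.
  have zin : in_rect a b c d (p +i* q) by split; apply/andP.
  have dw := cmod_in zin win.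
  have := Hs (w - (p +i* q)); rewrite (addrC (p +i* q)) subrK.
  move=> /(_ ltac:(lra)) [n1 n2 -> /eqP]; rewrite !mulf_eq0 (negbTE n1) (negbTE n2) !orbF.
  by rewrite expf_eq0 subr_eq0 mem_seq1 => /andP[].
Qed.

(** The ratios to one coordinate j0 have poles at the zeros of this
    coordinate; there are finitely many of them, and multiplication by a
    polynomial with the same zeros, counted with multiplicity, removes
    them. *)
Theorem lift_square S : 0 < S -> exists G : 'I_n.+1 -> R[i] -> R[i],
  forall z, in_rect (-S) S (-S) S z -> (forall j, hol (G j) z) /\
    exists2 c, c != 0 & forall j, G j z = c * v j z.
Proof.
move=> S0.
have [j0 vj0] := hcoord_nz (g 0).
(* The zeros are finite in number on a larger square, so that those on the
   boundary of the square are isolated too. *)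
have S2 : -(2 * S) < 2 * S by lra.
case: (@finite_zeros _ _ _ _ j0 S2 S2); last first.
  move=> /(_ 0) H; move: vj0; rewrite H ?eqxx //; split => /=; lra.
move=> [s0 Hs0].
pose s := undup [seq w <- s0 | `[< in_rect (-S) S (-S) S w >] && (v j0 w == 0)].
have us : uniq s by exact: undup_uniq.
have memS w : w \in s -> in_rect (-S) S (-S) S w /\ v j0 w = 0.
  by rewrite mem_undup mem_filter => /andP[/andP[/asboolP h /eqP]].
have Smem w : in_rect (-S) S (-S) S w -> v j0 w = 0 -> w \in s.
  move=> wi w0; rewrite mem_undup mem_filter w0 eqxx andbT.
  apply/andP; split; first by apply/asboolP.
  apply: Hs0 => //; case: wi => /andP[k1 k2] /andP[k3 k4].
  by clear -S0 k1 k2 k3 k4; split; apply/andP; split; lra.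
pose D z (x : 'I_n.+1 * nat * (R[i] -> R[i])) := z \in s ->
  [/\ v x.1.1 z != 0, hol x.2 z, x.2 z != 0 & exists2 s, 0 < s &
     forall h, cmod h < s -> [/\ v x.1.1 (z + h) != 0, x.2 (z + h) != 0 &
       v j0 (z + h) = h ^+ x.1.2 * x.2 (z + h) * v x.1.1 (z + h)]].
have : forall z, exists x, D z x.
  move=> z; case: (pselect (z \in s)) => [zs|nz]; last by exists (j0, 0%N, id) => /nz.
  (* v j0 cannot vanish on a neighbourhood of a point of the square: the
     larger square would contain infinitely many zeros. *)
  case: (coord_dichotomy z j0) => [[r r0 Hr]|[i [m [u H]]]]; last by exists (i, m, u).
  exfalso; have [/andP[k1 k2] /andP[k3 k4]] := (memS z zs).1.
  pose c : R := Num.min (r / 2) S.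
  have c0 : 0 < c by rewrite lt_min S0 andbT; lra.
  have cr : c <= r / 2 by rewrite ge_min lexx.
  have cS : c <= S by rewrite ge_min lexx orbT.
  have cc0 : c%:C != 0 :> R[i] by rewrite eq_complex /= gt_eqF.
  have [t [/andP[t0 t1] /negP]] := edge_infinite z s0 cc0; apply.
  have tc : 0 <= c * t <= c by rewrite mulr_ge0 ?(ltW c0) //= ler_piMr // ltW.
  apply: Hs0.
    rewrite /in_rect -rmorphM /=; case: (z) k1 k2 k3 k4 => x y /= k1 k2 k3 k4.
    by clear -S0 k1 k2 k3 k4 tc cS; rewrite addr0; split; lra.
  apply: Hr; rewrite -rmorphM cmod_real ger0_norm; last by case/andP: tc.
  by clear -tc cr r0; lra.
move=> /choice [x Hx].
pose iz z := (x z).1.1; pose mz z := (x z).1.2; pose uz z := (x z).2.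
pose q : {poly R[i]} := \prod_(p <- s) ('X - p%:P) ^+ mz p.
pose qh z : {poly R[i]} := \prod_(p <- s | p != z) ('X - p%:P) ^+ mz p.
have q0 z : z \notin s -> q.[z] != 0.
  move=> zs; rewrite horner_prod prodf_seq_neq0; apply/allP => p ps /=.
  rewrite horner_exp hornerXsubC expf_neq0 // subr_eq0.
  by apply: contra zs => /eqP ->.
have qh0 z : (qh z).[z] != 0.
  rewrite horner_prod prodf_seq_neq0; apply/allP => p ps /=; apply/implyP => pz.
  by rewrite horner_exp hornerXsubC expf_neq0 // subr_eq0 eq_sym.
have qE z w : z \in s -> q.[w] = (w - z) ^+ mz z * (qh z).[w].
  by move=> zs; rewrite /q (bigD1_seq z) //= hornerM horner_exp hornerXsubC.
(* At a zero z of v j0, the value is the limit of the generic formula, by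
   coord_dichotomy. *)
pose G j z := if z \in s then (qh z).[z] / uz z z * (v j z / v (iz z) z)
              else q.[z] * (v j z / v j0 z).
have away z : exists2 r, 0 < r & forall h, cmod h < r -> h != 0 -> z + h \notin s.
  elim: (s) => [|p l [r r0 IH]]; first by exists 1.
  have [pz|pz] := eqVneq p z.
    exists r => // h hr h0; rewrite inE negb_or IH // andbT pz.
    by apply: contra h0 => /eqP E; rewrite -(addKr z h) E addNr.
  have d0 : 0 < cmod (p - z) by rewrite cmod_gt0 subr_eq0.
  exists (Num.min r (cmod (p - z))); first by rewrite lt_min r0.
  move=> h; rewrite lt_min => /andP[h1 h2] h0; rewrite inE negb_or IH // andbT.
  by apply: contraTneq h2 => <-; rewrite addrAC subrr add0r ltxx.
exists G => z zi; split.
  move=> j; have [zs|zs] := boolP (z \in s).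
    have [/= vi hu u0 [r r0 Hr]] := Hx z zs.
    have [r1 r10 Hr1] := away z.
    have [r2 r20 Hr2] := chart_hol vi.
    apply: (hol_near (f := fun w => (qh z).[w] * (uz z w)^-1 * (v j w / v (iz z) w))).
      exists (Num.min r r1); first by rewrite lt_min r0.
      move=> h; rewrite lt_min => /andP[h1 h2].
      have [->|h0] := eqVneq h 0; first by rewrite addr0 /G zs.
      rewrite /G (negbTE (Hr1 h h2 h0)) (qE z) //.
      have [n1 n2 ->] := Hr h h1.
      rewrite addrAC subrr add0r -/(iz z) -/(mz z) -/(uz z).
      rewrite -/(iz z) -/(uz z) in n1 n2.
      by field; rewrite expf_neq0 // andbT; apply/andP; split; [exact: n1|exact: n2].
    apply: holM; first apply: holM.
    - by eexists; exact: cdiff_horner.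
    - by apply: holV.
    - by have [] := Hr2 z; rewrite ?subrr ?cmod0.
  have vz : v j0 z != 0 by apply/negP => /eqP /(Smem z zi); rewrite (negbTE zs).
  have [r1 r10 Hr1] := away z.
  have [r2 r20 Hr2] := chart_hol vz.
  apply: (hol_near (f := fun w => q.[w] * (v j w / v j0 w))).
    exists r1 => // h h1; have [->|h0] := eqVneq h 0.
      by rewrite addr0 /G (negbTE zs).
    by rewrite /G (negbTE (Hr1 h h1 h0)).
  apply: holM; first by eexists; exact: cdiff_horner.
  by have [] := Hr2 z; rewrite ?subrr ?cmod0.
have [zs|zs] := boolP (z \in s).
  have [/= vi hu u0 _] := Hx z zs.
  exists ((qh z).[z] / uz z z / v (iz z) z).
    by rewrite !mulf_neq0 ?invr_eq0 ?qh0.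
  by move=> j; rewrite /G zs; ring.
have vz : v j0 z != 0 by apply/negP => /eqP /(Smem z zi); rewrite (negbTE zs).
exists (q.[z] / v j0 z); first by rewrite mulf_neq0 ?invr_eq0 ?q0.
by move=> j; rewrite /G (negbTE zs); ring.
Qed.

End Lift.

(** * A dense countable family of polynomial curves *)

Section Density.
Set Implicit Arguments.
Unset Strict Implicit.
Unset Printing Implicit Defensive.
Local Open Scope complex_scope.
Variable R : realType.
Variable n : nat.
Implicit Types (w z : R[i]).

Definition cplxrat (q : rat * rat) : R[i] := ratr q.1 +i* ratr q.2.

Definition monpoly (d : nat) (s : seq (rat * rat)) : {poly R[i]} :=
  'X^d + \poly_(i < d) cplxrat (nth (0%R, 0%R) s i).

(** The polynomials have no common zero, so that they are the homogeneous
    coordinates of a curve. *)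
Definition cofree (p : 'I_n.+1 -> {poly R[i]}) := forall z, exists j, (p j).[z] != 0.

Lemma monpolyP d s : monpoly d s \is monic /\ size (monpoly d s) = d.+1.
Proof.
have sz : (size (\poly_(i < d) cplxrat (nth (0%R, 0%R) s i)) < size ('X^d : {poly R[i]}))%N.
  by rewrite size_polyXn ltnS size_poly.
split; last by rewrite /monpoly size_polyDl // size_polyXn.
by rewrite monicE /monpoly lead_coefDl // lead_coefXn.
Qed.

Lemma cplxrat_approx z (e : R) : 0 < e -> exists q, cmod (cplxrat q - z) <= e.
Proof.
move=> e0; case: z => x y.
have [q1] := @rat_in_itvoo R (x - e / 2) (x + e / 2) ltac:(lra).
have [q2] := @rat_in_itvoo R (y - e / 2) (y + e / 2) ltac:(lra).
rewrite !in_itv /= => /andP[a1 a2] /andP[a3 a4]; exists (q1, q2).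
apply: le_trans (cmod_le_ReIm _) _; rewrite ReB ImB /=.
have : `|ratr q1 - x| <= e / 2 by rewrite ler_norml; apply/andP; split; lra.
have : `|ratr q2 - y| <= e / 2 by rewrite ler_norml; apply/andP; split; lra.
lra.
Qed.

(** A sequence of distinct Gaussian rationals tends to [z], and the points
    of [s] can exclude only finitely many of its terms. *)
Lemma cplxrat_avoid z (e : R) (s : seq R[i]) : 0 < e ->
  exists q, cmod (cplxrat q - z) <= e /\ cplxrat q \notin s.
Proof.
move=> e0; have e20 : 0 < e / 2 by lra.
have [q Hq] := cplxrat_approx z e20.
pose K := Num.bound (e / 2)^-1.
have K0 : (e / 2)^-1 < K%:R by apply: archi_boundP; rewrite invr_ge0 ltW.
have Kp : 0 < (K%:R : R) by apply: lt_trans K0; rewrite invr_gt0.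
pose phi (k : nat) := cplxrat (q.1 + (K%:R * k.+1%:R)^-1, q.2).
have phiE k : phi k = cplxrat q + ((K%:R * k.+1%:R : R)^-1)%:C.
  rewrite /phi /cplxrat /= rmorphD fmorphV rmorphM /= !ratr_nat.
  by apply/eqP; rewrite eq_complex /= addr0 !eqxx.
have inj : injective phi.
  move=> k l; rewrite !phiE => /addrI /complexI /invr_inj /mulfI.
  by rewrite gt_eqF // => /(_ isT) /eqP; rewrite eqr_nat => /eqP [].
have [k hk] := inj_not_in_seq s inj.
exists (q.1 + (K%:R * k.+1%:R)^-1, q.2); split => //.
rewrite -/(phi k) phiE addrAC; apply: le_trans (cmodD _ _) _.
have : cmod ((K%:R * k.+1%:R : R)^-1)%:C <= e / 2.
  rewrite cmod_real ger0_norm ?invr_ge0 ?mulr_ge0 ?ler0n // -[leRHS]invrK.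
  rewrite lef_pV2 ?posrE ?mulr_gt0 ?invr_gt0 ?ltr0n //.
  apply: le_trans (ltW K0) _; rewrite ler_peMr ?ler1n // ltW //.
lra.
Qed.

(** Adding a small multiple e X^d to Taylor polynomials of lower degree
    makes them monic after division by e.  Common zeros are excluded by the
    choice of a single constant term, since the last polynomial has finitely
    many zeros.  The hypothesis that n is positive provides two distinct
    coordinates. *)
Lemma dense_monic (G : 'I_n.+1 -> R[i] -> R[i]) S rho eta : (1 <= n)%N ->
  0 < S -> 0 <= rho -> rho < S -> 0 < eta ->
  (forall z, in_rect (-S) S (-S) S z -> forall j, hol (G j) z) ->
  exists d (s : {ffun 'I_n.+1 -> seq (rat * rat)}) (e : R),
    [/\ cofree (fun j => monpoly d (s j)), 0 < e, e <= 1 &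
     forall z, cmod z <= rho -> forall j,
       cmod (e%:C * (monpoly d (s j)).[z] - G j z) <= eta].
Proof.
move=> n1 S0 rho0 rS eta0 hG.
have eta4 : 0 < eta / 4 by lra.
have : forall j, exists p : {poly R[i]}, forall z, cmod z <= rho ->
    cmod (G j z - p.[z]) <= eta / 4.
  by move=> j; apply: (poly_approx S0 rS rho0 eta4) => w /hG.
move=> /choice [P HP].
pose d := (\max_j size (P j)).+1.
have dP j : (size (P j) <= d)%N by apply: leqW; exact: (leq_bigmax j).
pose r1 := Num.max rho 1.
have r11 : 1 <= r1 by rewrite le_max lexx orbT.
have r1r : rho <= r1 by rewrite le_max lexx.
have r10 : 0 < r1 by apply: lt_le_trans r11.
have rd0 : 0 < r1 ^+ d by rewrite exprn_gt0.
(* On the disc, the added term e X^d is at most eta / 4. *)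
pose e := Num.min 1 (eta / 4 / r1 ^+ d).
have e0 : 0 < e by rewrite lt_min ltr01 divr_gt0.
have e1 : e <= 1 by rewrite ge_min lexx.
have ed : e * r1 ^+ d <= eta / 4 by rewrite -ler_pdivlMr // ge_min lexx orbT.
have eC : e%:C != 0 :> R[i] by rewrite eq_complex /= gt_eqF.
pose delta := eta / 4 / r1 ^+ d / d%:R.
have dl0 : 0 < delta by rewrite !divr_gt0 ?ltr0n.
have /choice [A HA] : forall z, exists q, cmod (cplxrat q - z) <= delta.
  by move=> z; exact: cplxrat_approx.
pose j1 : 'I_n.+1 := ord_max.
have j10 : j1 != ord0 by apply/negP => /eqP /(congr1 val) /= h; move: n1; rewrite h.
pose cf0 j i := A ((P j)`_i / e%:C).
pose s1 := mkseq (cf0 j1) d.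
have [zs Hzs] := closed_field_poly_normal (monpoly d s1).
have inzs z : (monpoly d s1).[z] = 0 -> z \in zs.
  move/eqP; rewrite -/(root _ z) Hzs rootZ ?root_prod_XsubC //.
  by have [/monicP -> _] := monpolyP d s1; rewrite oner_neq0.
(* With the constant term q, the polynomial of index 0 takes the value
   W z + q at z, so q must avoid the values - W z at the zeros z of the last
   polynomial. *)
pose W z := z ^+ d + \sum_(i < d.-1) cplxrat (cf0 ord0 i.+1) * z ^+ i.+1.
have [q0 [Hq0 nq0]] := @cplxrat_avoid ((P ord0)`_0 / e%:C) delta [seq - W z | z <- zs] dl0.
pose cf (j : 'I_n.+1) i := if (j == ord0) && (i == 0%N) then q0 else cf0 j i.
have cfP j i : cmod (cplxrat (cf j i) - (P j)`_i / e%:C) <= delta.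
  by rewrite /cf; case: ifP => [/andP[/eqP -> /eqP ->]|_] //; exact: HA.
pose s := [ffun j : 'I_n.+1 => mkseq (cf j) d].
have horn j z : (monpoly d (s j)).[z] = z ^+ d + \sum_(i < d) cplxrat (cf j i) * z ^+ i.
  rewrite /monpoly hornerD hornerXn horner_poly ffunE; congr (_ + _).
  by apply: eq_bigr => i _; rewrite nth_mkseq.
exists d, s, e; split => //.
  move=> z; have [z1|z1] := eqVneq (monpoly d (s j1)).[z] 0; last by exists j1.
  exists ord0; have zzs : z \in zs.
    apply: inzs; move: z1; rewrite /s ffunE /s1 => <-; congr (monpoly d _).[z].
    by apply: eq_mkseq => i; rewrite /cf (negbTE j10).
  rewrite horn big_ord_recl /= {1}/cf eqxx /= expr0 mulr1.
  rewrite addrCA; apply: contra nq0; rewrite addr_eq0 => /eqP ->.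
  apply/mapP; exists z => //; congr (- (_ + _)).
move=> z zr j; have z0 := cmod_ge0 z.
have zi i : (i <= d)%N -> cmod z ^+ i <= r1 ^+ d.
  move=> id; apply: le_trans (_ : r1 ^+ i <= _).
    by apply: lerXn2r; rewrite ?nnegrE //; lra.
  by apply: ler_weXn2l.
have -> : e%:C * (monpoly d (s j)).[z] - G j z = e%:C * z ^+ d +
   ((\sum_(i < d) e%:C * ((cplxrat (cf j i) - (P j)`_i / e%:C) * z ^+ i)) - (G j z - (P j).[z])).
  rewrite horn (horner_coef_wide _ (dP j)).
  have -> : \sum_(i < d) e%:C * ((cplxrat (cf j i) - (P j)`_i / e%:C) * z ^+ i) =
    e%:C * (\sum_(i < d) cplxrat (cf j i) * z ^+ i) - \sum_(i < d) (P j)`_i * z ^+ i.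
    rewrite mulr_sumr -sumrB; apply: eq_bigr => i _; field; exact: eC.
  by ring.
apply: le_trans (cmodD _ _) _; apply: le_trans (lerD (lexx _) (cmodB _ _)) _.
have h1 : cmod (e%:C * z ^+ d) <= eta / 4.
  rewrite cmodM cmodX cmod_real gtr0_norm //; apply: le_trans ed.
  by apply: ler_wpM2l; [exact: ltW | exact: zi].
have h2 := HP j z zr.
have h3 : cmod (\sum_(i < d) e%:C * ((cplxrat (cf j i) - (P j)`_i / e%:C) * z ^+ i)) <= eta / 4.
  apply: le_trans (cmod_sum _ _ _) _.
  apply: le_trans (_ : \sum_(i < d) delta * r1 ^+ d <= _).
    apply: ler_sum => i _; rewrite !cmodM cmodX cmod_real gtr0_norm //.
    rewrite -[leRHS]mul1r; apply: ler_pM; rewrite ?mulr_ge0 ?exprn_ge0 ?cmod_ge0 ?(ltW e0) //.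
    by apply: ler_pM; rewrite ?exprn_ge0 ?cmod_ge0 ?cfP // zi // ltnW.
  rewrite sumr_const card_ord -mulr_natr /delta.
  by rewrite le_eqVlt; apply/orP; left; apply/eqP; field; rewrite ?pnatr_eq0 ?gt_eqF.
lra.
Qed.

(** The degree, the lower coefficients, and a label: each tuple occurs with
    infinitely many labels, so that it can be approximated to any precision
    even though each index is used only once in the construction. *)
Definition family_code : Type := (nat * {ffun 'I_n.+1 -> seq (rat * rat)} * nat)%type.

(** The curve under construction will approximate [p N] up to
    1 / (m N + 1) on a translate of the disc of radius m N + 1; hence the
    condition [M <= m N] imposes any given radius and precision. *)
Theorem dense_family : (1 <= n)%N ->
  exists (p : nat -> 'I_n.+1 -> {poly R[i]}) (m : nat -> nat),
    (forall N, cofree (p N) /\ exists d, forall j, p N j \is monic /\ size (p N j) = d.+1) /\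
    forall (G : 'I_n.+1 -> R[i] -> R[i]) S rho eta M, 0 < S -> 0 <= rho -> rho < S -> 0 < eta ->
     (forall z, in_rect (-S) S (-S) S z -> forall j, hol (G j) z) ->
     exists N (e : R), [/\ (M <= m N)%N, 0 < e, e <= 1 & forall z, cmod z <= rho -> forall j,
       cmod (e%:C * (p N j).[z] - G j z) <= eta].
Proof.
move=> n1.
pose good (c : family_code) := `[< cofree (fun j => monpoly c.1.1 (c.1.2 j)) >].
pose fam N : family_code := if (unpickle N : option (nat * {ffun 'I_n.+1 -> seq (rat * rat)} * nat)%type)
  is Some c then if good c then c else (0%N, [ffun=> [::]], 0%N) else (0%N, [ffun=> [::]], 0%N).
exists (fun N j => monpoly (fam N).1.1 ((fam N).1.2 j)), (fun N => (fam N).2); split.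
  move=> N; split; last by exists (fam N).1.1 => j; exact: monpolyP.
  have dflt : cofree (fun j => monpoly 0 (([ffun=> [::]] : {ffun 'I_n.+1 -> seq (rat * rat)}) j)).
    move=> z; exists ord0; rewrite /monpoly hornerD hornerXn horner_poly big_ord0 expr0 addr0.
    exact: oner_neq0.
  by rewrite /fam; case: unpickle => [c|//]; case: ifP => [/asboolP|].
move=> G S rho eta M S0 rho0 rS eta0 hG.
have [d [s [e [h1 h2 h3 h4]]]] := dense_monic n1 S0 rho0 rS eta0 hG.
exists (pickle (d, s, M)), e; rewrite /fam pickleK.
have -> : good (d, s, M) by apply/asboolP.
by split.
Qed.

End Density.

(** * Lagrange's identity and the Fubini-Study distance *)

Section Lagrange.
Set Implicit Arguments.
Unset Strict Implicit.
Unset Printing Implicit Defensive.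
Local Open Scope complex_scope.
Variable R : realType.

Lemma cmod_sqrC (z : R[i]) : (cmod z ^+ 2)%:C = z * conjc z.
Proof. by rewrite rmorphXn /= -normcE_cmod sqr_normc. Qed.

(** The complex form of Lagrange's identity.  It gives the Cauchy-Schwarz
    inequality, and it turns the Fubini-Study form into a sum of squares. *)
Lemma lagrange (I : finType) (x y : I -> R[i]) :
  \sum_i \sum_j cmod (x i * y j - x j * y i) ^+ 2 =
  2 * ((\sum_i cmod (x i) ^+ 2) * (\sum_j cmod (y j) ^+ 2)) -
  2 * cmod (\sum_i x i * conjc (y i)) ^+ 2.
Proof.
have e2 (c : R) : (2 * c)%:C = 2 * c%:C :> R[i] by rewrite rmorphM rmorph_nat.
apply: complexI; rewrite rmorphB /= !e2 cmod_sqrC.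
rewrite [X in 2 * X - _]rmorphM /= !rmorph_sum /=.
have -> : \sum_i (cmod (x i) ^+ 2)%:C = \sum_i x i * conjc (x i).
  by apply: eq_bigr => i _; exact: cmod_sqrC.
have -> : \sum_i (cmod (y i) ^+ 2)%:C = \sum_i y i * conjc (y i).
  by apply: eq_bigr => i _; exact: cmod_sqrC.
have -> : \sum_i conjc (x i * conjc (y i)) = \sum_i conjc (x i) * y i.
  by apply: eq_bigr => i _; rewrite rmorphM /= conjcK.
set A := \sum_i x i * _; set B := \sum_i y i * _.
set D := \sum_i x i * _; set D' := \sum_i _ * y i.
have -> : 2 * (A * B) - 2 * (D * D') = A * B + B * A - (D * D' + D' * D) by ring.
rewrite !big_distrlr /= -!big_split -sumrB /=; apply: eq_bigr => i _.
rewrite rmorph_sum -!big_split -sumrB /=; apply: eq_bigr => j _.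
by rewrite cmod_sqrC rmorphB !rmorphM /=; ring.
Qed.

Lemma cauchy_schwarz (I : finType) (x y : I -> R[i]) :
  cmod (\sum_i x i * conjc (y i)) ^+ 2 <=
  (\sum_i cmod (x i) ^+ 2) * (\sum_j cmod (y j) ^+ 2).
Proof.
have := lagrange x y.
have : 0 <= \sum_i \sum_j cmod (x i * y j - x j * y i) ^+ 2.
  by apply: sumr_ge0 => i _; apply: sumr_ge0 => j _; rewrite sqr_ge0.
lra.
Qed.

Lemma hnorm_ge0 m (v : 'rV[R[i]]_m) : 0 <= hnorm v.
Proof. exact: sqrtr_ge0. Qed.

Lemma hnorm_sqr m (v : 'rV[R[i]]_m) : hnorm v ^+ 2 = \sum_k cmod (v 0 k) ^+ 2.
Proof. by rewrite sqr_sqrtr // sumr_ge0 // => i _; rewrite sqr_ge0. Qed.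

Lemma hdot_le m (v w : 'rV[R[i]]_m) : cmod (hdot v w) <= hnorm v * hnorm w.
Proof.
rewrite -(@ler_pXn2r _ 2%N) ?nnegrE ?cmod_ge0 ?mulr_ge0 ?hnorm_ge0 //.
by rewrite exprMn !hnorm_sqr; exact: cauchy_schwarz.
Qed.

Lemma hnorm_coord m (v : 'rV[R[i]]_m) k : cmod (v 0 k) <= hnorm v.
Proof.
rewrite -(@ler_pXn2r _ 2%N) ?nnegrE ?cmod_ge0 ?hnorm_ge0 // hnorm_sqr.
by rewrite (bigD1 k) //= lerDl sumr_ge0 // => i _; rewrite sqr_ge0.
Qed.

Lemma hnorm_gt0 m (v : 'rV[R[i]]_m) k : v 0 k != 0 -> 0 < hnorm v.
Proof. by rewrite -cmod_gt0 => h; apply: lt_le_trans h (hnorm_coord v k). Qed.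

Lemma hnormZ m (c : R[i]) (v : 'rV[R[i]]_m) : hnorm (c *: v) = cmod c * hnorm v.
Proof.
apply/eqP; rewrite -(@eqrXn2 _ 2%N) ?mulr_ge0 ?cmod_ge0 ?hnorm_ge0 //.
rewrite exprMn !hnorm_sqr mulr_sumr; apply/eqP; apply: eq_bigr => k _.
by rewrite mxE cmodM exprMn.
Qed.

Lemma hdotZ m (a b : R[i]) (v w : 'rV[R[i]]_m) :
  hdot (a *: v) (b *: w) = a * conjc b * hdot v w.
Proof.
rewrite /hdot mulr_sumr; apply: eq_bigr => k _; rewrite !mxE rmorphM /=; ring.
Qed.

(** The cosine of the Fubini-Study distance between the lines spanned by [v]
    and [w]. *)
Definition fcos m (v w : 'rV[R[i]]_m) := cmod (hdot v w) / (hnorm v * hnorm w).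

Lemma fcosZ m (a b : R[i]) (v w : 'rV[R[i]]_m) : a != 0 -> b != 0 ->
  fcos (a *: v) (b *: w) = fcos v w.
Proof.
move=> a0 b0; rewrite /fcos hdotZ !hnormZ !cmodM cmod_conj.
have [h|h] := eqVneq (hnorm v * hnorm w) 0.
  by rewrite mulrACA h !(mulr0, invr0, mulr0).
field; move: h; rewrite mulf_eq0 negb_or => /andP[-> ->].
by rewrite !cmod_eq0 a0 b0.
Qed.

(** A coordinatewise perturbation of relative size [t] moves the scalar
    product by at most m t |v|^2, and the norm of [u] is at most
    (1 + 3 m t) |v|. *)
Lemma fcos_close m (u v : 'rV[R[i]]_m) (t : R) : 0 < t -> t <= 1 ->
  (exists k, v 0 k != 0) ->
  (forall j, cmod (u 0 j - v 0 j) <= t * hnorm v) -> m%:R * t < 1 ->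
  (1 - m%:R * t) / (1 + 3 * m%:R * t) <= fcos u v.
Proof.
move=> t0 t1 [k vk] H mt1.
have V0 := hnorm_gt0 vk.
have m0 : 0 <= (m%:R : R) by rewrite ler0n.
have mt : 0 <= m%:R * t by rewrite mulr_ge0 // ltW.
have D : 0 < 1 + 3 * m%:R * t by lra.
have h1 : hnorm u <= (1 + 3 * m%:R * t) * hnorm v.
  rewrite -(@ler_pXn2r _ 2%N) ?nnegrE ?hnorm_ge0 ?mulr_ge0 ?hnorm_ge0 ?(ltW D) //.
  rewrite exprMn hnorm_sqr.
  apply: le_trans (_ : hnorm v ^+ 2 + m%:R * (3 * t * hnorm v ^+ 2) <= _); last first.
    have q : 0 <= hnorm v ^+ 2 by rewrite sqr_ge0.
    have -> : (1 + 3 * m%:R * t) ^+ 2 * hnorm v ^+ 2 =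
      hnorm v ^+ 2 + m%:R * (3 * t * hnorm v ^+ 2) +
      (3 * (m%:R * t) + 9 * (m%:R * t) ^+ 2) * hnorm v ^+ 2 by ring.
    rewrite lerDl; apply: mulr_ge0 => //; apply: addr_ge0; apply: mulr_ge0 => //.
    exact: sqr_ge0.
  rewrite [X in X + _]hnorm_sqr.
  have -> : m%:R * (3 * t * hnorm v ^+ 2) = \sum_(k < m) 3 * t * hnorm v ^+ 2.
    by rewrite sumr_const card_ord mulr_natl.
  rewrite -big_split /=; apply: ler_sum => j _.
  have := cmodD (u 0 j - v 0 j) (v 0 j); rewrite subrK => h2.
  have h3 := hnorm_coord v j; have h4 := H j.
  have h5 := cmod_ge0 (u 0 j); have h6 := cmod_ge0 (v 0 j).
  apply: le_trans (_ : (t * hnorm v + cmod (v 0 j)) ^+ 2 <= _).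
    by apply: lerXn2r; rewrite ?nnegrE ?addr_ge0 ?mulr_ge0 ?hnorm_ge0 ?(ltW t0) //; lra.
  rewrite !expr2.
  have : t * hnorm v * cmod (v 0 j) <= t * hnorm v * hnorm v.
    by apply: ler_wpM2l => //; rewrite mulr_ge0 ?hnorm_ge0 // ltW.
  have : t * (t * (hnorm v * hnorm v)) <= 1 * (t * (hnorm v * hnorm v)).
    by apply: ler_wpM2r => //; rewrite !mulr_ge0 ?hnorm_ge0 // ltW.
  lra.
have h2 : (1 - m%:R * t) * hnorm v ^+ 2 <= cmod (hdot u v).
  have E : hdot u v = hdot v v + \sum_j (u 0 j - v 0 j) * conjc (v 0 j).
    by rewrite /hdot -big_split /=; apply: eq_bigr => j _; ring.
  have E2 : cmod (hdot v v) = hnorm v ^+ 2.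
    have -> : hdot v v = (hnorm v ^+ 2)%:C.
      by rewrite hnorm_sqr rmorph_sum /hdot; apply: eq_bigr => j _; rewrite /= cmod_sqrC.
    by rewrite cmod_real ger0_norm // sqr_ge0.
  have E3 : cmod (\sum_j (u 0 j - v 0 j) * conjc (v 0 j)) <= m%:R * t * hnorm v ^+ 2.
    apply: le_trans (cmod_sum _ _ _) _.
    have -> : m%:R * t * hnorm v ^+ 2 = \sum_(k < m) (t * hnorm v) * hnorm v.
      by rewrite sumr_const card_ord -mulr_natl; ring.
    apply: ler_sum => j _; rewrite cmodM cmod_conj.
    by apply: ler_pM; rewrite ?cmod_ge0 // hnorm_coord.
  rewrite E; have := cmod_lower (hdot v v) (\sum_j (u 0 j - v 0 j) * conjc (v 0 j)).
  rewrite E2; lra.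
have U0 : 0 < hnorm u.
  rewrite lt0r hnorm_ge0 andbT; apply/negP => /eqP E.
  have := hdot_le u v; rewrite E mul0r.
  have : 0 < (1 - m%:R * t) * hnorm v ^+ 2 by rewrite mulr_gt0 ?exprn_gt0 // subr_gt0.
  lra.
rewrite /fcos ler_pdivrMr // mulrAC ler_pdivlMr ?mulr_gt0 //.
apply: le_trans (_ : (1 - m%:R * t) * (((1 + 3 * m%:R * t) * hnorm v) * hnorm v) <= _).
  apply: ler_wpM2l; first by rewrite subr_ge0 ltW.
  by apply: ler_wpM2r => //; exact: ltW.
have -> : (1 - m%:R * t) * ((1 + 3 * m%:R * t) * hnorm v * hnorm v) =
  (1 - m%:R * t) * hnorm v ^+ 2 * (1 + 3 * m%:R * t) by ring.
by apply: ler_wpM2r => //; exact: ltW.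
Qed.

Lemma acos_small (e : R) : 0 < e -> exists2 c : R, c < 1 & forall t, c < t -> t <= 1 -> acos t < e.
Proof.
move=> e0; pose e' := Num.min e pi.
have e'0 : 0 < e' by rewrite lt_min e0 pi_gt0.
have e'p : e' <= pi by rewrite ge_min lexx orbT.
have e'e : e' <= e by rewrite ge_min lexx.
have e'i : e' \in `[0, pi] by rewrite in_itv /= e'p (ltW e'0).
exists (cos e').
  by rewrite -cos0 ltr_cos // in_itv /= lexx pi_ge0.
move=> t ct t1; have tm : -1 <= t <= 1.
  rewrite t1 andbT; apply: le_trans (ltW ct).
  by have := cos_geN1 e'.
apply: lt_le_trans e'e; rewrite -ltr_cos //; first by rewrite acosK ?in_itv.
by rewrite in_itv /= acos_ge0 // acos_lepi.
Qed.

Lemma fcos_le1 m (u v : 'rV[R[i]]_m) : fcos u v <= 1.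
Proof.
rewrite /fcos; have [h|h] := eqVneq (hnorm u * hnorm v) 0.
  by rewrite h invr0 mulr0.
have h0 : 0 < hnorm u * hnorm v by rewrite lt0r h mulr_ge0 ?hnorm_ge0.
by rewrite ler_pdivrMr // mul1r hdot_le.
Qed.

(** The factors [a] and [b] are there because [hcoord] chooses its
    representatives arbitrarily, whereas closeness is known for some
    multiples of them. *)
Lemma dist_FS_small n (e : R) : 0 < e -> exists2 t : R, 0 < t &
  forall (p q : CP R n) (a b : R[i]) (m : R), 0 < m -> b != 0 ->
    (exists k, m <= cmod (b * hcoord q 0 k)) ->
    (forall j, cmod (a * hcoord p 0 j - b * hcoord q 0 j) <= t * m) ->
    dist_FS p q < e.
Proof.
move=> /acos_small [c c1 Hc].
pose c' := Num.max c 0.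
have c'1 : c' < 1 by rewrite gt_max c1 ltr01.
have cc' : c <= c' by rewrite le_max lexx.
have c'0 : 0 <= c' by rewrite le_max lexx orbT.
have N0 : 0 < (n.+1%:R : R) by rewrite ltr0n.
have N1 : 1 <= (n.+1%:R : R) by rewrite ler1n.
(* For s = (n + 1) t = (1 - c') / 8, the bound (1 - s) / (1 + 3 s) of
   fcos_close is at least 1 - 4 s, hence exceeds c'. *)
pose t := (1 - c') / 8 / n.+1%:R.
have t0 : 0 < t by rewrite !divr_gt0 // subr_gt0.
have tN : n.+1%:R * t = (1 - c') / 8 by rewrite /t; field; rewrite addrC natr1 gt_eqF.
have t1 : t <= 1.
  have : 1 * t <= n.+1%:R * t by apply: ler_wpM2r => //; exact: ltW.
  rewrite tN; lra.
exists t => // p q a b m m0 b0 [k mk] H.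
have h0 : (b *: hcoord q) 0 k != 0 by rewrite mxE -cmod_gt0; apply: lt_le_trans mk.
have mV : m <= hnorm (b *: hcoord q).
  by apply: le_trans (hnorm_coord _ k); rewrite mxE.
have [a0|a0] := eqVneq a 0.
  have := H k; rewrite a0 mul0r sub0r cmodN.
  have : t * m <= (1 / 8) * m.
    apply: ler_wpM2r; first exact: ltW.
    have : 1 * t <= n.+1%:R * t by apply: ler_wpM2r => //; exact: ltW.
    rewrite tN; lra.
  lra.
apply: (Hc (fcos (hcoord p) (hcoord q))); last exact: fcos_le1.
rewrite -(fcosZ _ _ a0 b0); apply: lt_le_trans (_ : (1 - n.+1%:R * t) / (1 + 3 * n.+1%:R * t) <= _).
  rewrite -mulrA tN ltr_pdivlMr; last lra.
  nra.
apply: fcos_close => //; first by exists k.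
  move=> j; apply: le_trans (_ : t * m <= _); last by apply: ler_wpM2l => //; exact: ltW.
  by have := H j; rewrite !mxE.
rewrite tN; lra.
Qed.

End Lagrange.

(** * The Fubini-Study form and its pullback *)

Section FubiniStudy.
Set Implicit Arguments.
Unset Strict Implicit.
Unset Printing Implicit Defensive.
Local Open Scope complex_scope.
Variable R : realType.

Lemma is_derive_quad (S a : R) : is_derive (0 : R) (1 : R) (fun t => S + 2 * a * t + t ^+ 2) (2 * a).
Proof.
apply: rdiff_is_derive => e e0; exists e => // s se.
have -> : S + 2 * a * (0 + s) + (0 + s) ^+ 2 - (S + 2 * a * 0 + 0 ^+ 2) - 2 * a * s = s * s by ring.
by rewrite normrM; apply: ler_wpM2r => //; exact: ltW.
Qed.

(** Along a line, 1 + |z|^2 is a quadratic polynomial in t with leading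
    coefficient 1, which reduces the Wirtinger derivatives of the potential to
    this computation and the next one. *)
Lemma derive_ln_quad (S a : R) : 0 < S ->
  derive1 (fun t => ln (S + 2 * a * t + t ^+ 2)) 0 = 2 * a / S.
Proof.
move=> S0; have D := is_derive_quad S a.
have L : is_derive (S + 2 * a * 0 + 0 ^+ 2) (1 : R) (@ln R) (S^-1).
  have -> : S + 2 * a * 0 + 0 ^+ 2 = S by ring.
  exact: is_derive1_ln.
have [_ E] := @is_derive1_comp R (@ln R) (fun t => S + 2 * a * t + t ^+ 2) 0 _ _ L D.
by rewrite derive1E; apply: etrans E _; rewrite mulrC.
Qed.

Lemma derive_div_quad (S a x y : R) : 0 < S ->
  derive1 (fun t => (x + t * y) * (S + 2 * a * t + t ^+ 2)^-1) 0 = y / S - x * (2 * a / S ^+ 2).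
Proof.
move=> S0; have D := is_derive_quad S a.
have Q0 : S + 2 * a * 0 + 0 ^+ 2 = S by ring.
have n0 : (fun t => S + 2 * a * t + t ^+ 2) 0 != 0 by rewrite /= Q0 gt_eqF.
have V := @is_deriveV R (fun t => S + 2 * a * t + t ^+ 2) _ _ _ n0 D.
have L : is_derive (0 : R) (1 : R) (fun t => x + t * y) y.
  apply: rdiff_is_derive => e e0; exists 1 => // s _.
  have -> : x + (0 + s) * y - (x + 0 * y) - y * s = 0 by ring.
  by rewrite normr0 mulr_ge0 // ltW.
have [_ E] := is_deriveM L V.
rewrite derive1E; apply: etrans E _; rewrite /GRing.scale /= Q0.
by field; rewrite gt_eqF.
Qed.

Variable n : nat.
Implicit Types (z : 'rV[R[i]]_n).

Definition potS z : R := 1 + \sum_(k < n) cmod (z 0 k) ^+ 2.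

Lemma potS_gt0 z : 0 < potS z.
Proof.
by rewrite /potS ltr_pwDl // sumr_ge0 // => k _; rewrite sqr_ge0.
Qed.

(** The direction is c times a basis vector, with |c| = 1, to cover the real
    and the imaginary directions at once. *)
Lemma potS_line (c : R[i]) b z (t : R) : cmod c = 1 ->
  potS (z + t%:C *: (c *: delta_mx 0 b)) =
  potS z + 2 * complex.Re (z 0 b * conjc c) * t + t ^+ 2.
Proof.
move=> c1; rewrite /potS (bigD1 b) //= [in RHS](bigD1 b) //=.
have -> : \sum_(i < n | i != b) cmod ((z + t%:C *: (c *: delta_mx 0 b)) 0 i) ^+ 2 =
  \sum_(i < n | i != b) cmod (z 0 i) ^+ 2.
  by apply: eq_bigr => i ib; rewrite !mxE eqxx (negbTE ib) /= !mulr0 addr0.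
rewrite !mxE !eqxx /= mulr1.
have -> : cmod (z 0 b + t%:C * c) ^+ 2 =
  cmod (z 0 b) ^+ 2 + 2 * complex.Re (z 0 b * conjc c) * t + t ^+ 2 * cmod c ^+ 2.
  by rewrite !cmod_sqr; case: (z 0 b) => x y; case: (c) => u v /=; ring.
by rewrite c1; ring.
Qed.

Lemma real_deriv_pot (c : R[i]) b z : cmod c = 1 ->
  real_deriv (c *: delta_mx 0 b) (@FS_potential R n) z =
  (2 * complex.Re (z 0 b * conjc c) / potS z)%:C.
Proof.
move=> c1; rewrite /real_deriv.
have -> : (fun t : R => complex.Re (FS_potential (z + t%:C *: (c *: delta_mx 0 b)))) =
  (fun t => ln (potS z + 2 * complex.Re (z 0 b * conjc c) * t + t ^+ 2)).
  by apply/funext => t; rewrite -potS_line.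
have -> : (fun t : R => complex.Im (FS_potential (z + t%:C *: (c *: delta_mx 0 b)))) =
  (fun=> 0) by [].
rewrite derive_ln_quad ?potS_gt0 //.
have [_ E] := is_derive_cst (0 : R) (0 : R) (1 : R).
by congr (_ +i* _); rewrite derive1E; exact: E.
Qed.

Lemma deebar_pot b z : deebar b (@FS_potential R n) z = z 0 b * ((potS z)^-1)%:C.
Proof.
rewrite /deebar -{1}[delta_mx 0 b]scale1r !real_deriv_pot ?cmod1 ?cmod_i //.
case: (z 0 b) => x y; set s := potS z; have s0 := potS_gt0 z; rewrite -/s in s0.
have -> : (2 : R[i]) = (2 : R)%:C by rewrite rmorph_nat.
rewrite -fmorphV /=; apply/eqP; rewrite eq_complex /=.
by apply/andP; split; apply/eqP; field; rewrite gt_eqF.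
Qed.

Lemma real_deriv_quot (c : R[i]) a b z : cmod c = 1 ->
  real_deriv (c *: delta_mx 0 a) (fun z => z 0 b * ((potS z)^-1)%:C) z =
  (a == b)%:R * c * ((potS z)^-1)%:C -
  z 0 b * (2 * complex.Re (z 0 a * conjc c) / potS z ^+ 2)%:C.
Proof.
move=> c1; rewrite /real_deriv.
set A := complex.Re (z 0 a * conjc c).
pose d : R := (a == b)%:R.
have dE : (a == b)%:R = d%:C :> R[i] by rewrite rmorph_nat.
have coordE (t : R) : (z + t%:C *: (c *: delta_mx 0 a)) 0 b = z 0 b + t%:C * (d%:C * c).
  by rewrite !mxE eqxx /= -dE (eq_sym b) [c * _]mulrC.
have -> : (fun t : R => complex.Re ((z + t%:C *: (c *: delta_mx 0 a)) 0 b *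
    ((potS (z + t%:C *: (c *: delta_mx 0 a)))^-1)%:C)) =
  (fun t => (complex.Re (z 0 b) + t * (d * complex.Re c)) * (potS z + 2 * A * t + t ^+ 2)^-1).
  apply/funext => t; rewrite potS_line // coordE ReM_real; congr (_ * _).
  by case: (z 0 b) => x y; case: (c) => u v /=; ring.
have -> : (fun t : R => complex.Im ((z + t%:C *: (c *: delta_mx 0 a)) 0 b *
    ((potS (z + t%:C *: (c *: delta_mx 0 a)))^-1)%:C)) =
  (fun t => (complex.Im (z 0 b) + t * (d * complex.Im c)) * (potS z + 2 * A * t + t ^+ 2)^-1).
  apply/funext => t; rewrite potS_line // coordE ImM_real; congr (_ * _).
  by case: (z 0 b) => x y; case: (c) => u v /=; ring.
rewrite !derive_div_quad ?potS_gt0 // dE.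
case: (z 0 b) => x y; case: (c) => u v; apply/eqP; rewrite eq_complex /=.
by apply/andP; split; apply/eqP; ring.
Qed.

Lemma FS_coefE a b z : FS_coef a b z =
  'i%C / (2 * pi)%:C * ((a == b)%:R * ((potS z)^-1)%:C -
     conjc (z 0 a) * z 0 b * ((potS z)^-1 ^+ 2)%:C).
Proof.
rewrite /FS_coef; congr (_ * _).
have -> : deebar b (@FS_potential R n) = fun z => z 0 b * ((potS z)^-1)%:C.
  by apply/funext => w; exact: deebar_pot.
rewrite /dee -{1}[delta_mx 0 a]scale1r !real_deriv_quot ?cmod1 ?cmod_i //.
pose d : R := (a == b)%:R.
have -> : (a == b)%:R = d%:C :> R[i] by rewrite rmorph_nat.
have -> : (2 : R[i]) = (2 : R)%:C by rewrite rmorph_nat.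
rewrite -fmorphV /=.
case: (z 0 a) => p q; case: (z 0 b) => x y; set s := potS z.
have s0 := potS_gt0 z; rewrite -/s in s0.
by apply/eqP; rewrite eq_complex /=; apply/andP; split; apply/eqP; field; rewrite gt_eqF.
Qed.

End FubiniStudy.

Section Pullback.
Set Implicit Arguments.
Unset Strict Implicit.
Unset Printing Implicit Defensive.
Local Open Scope complex_scope.
Variables (R : realType) (n : nat).

(** A function on a finite type rather than a row vector, in order to be
    used for [n] affine and [n.+1] homogeneous coordinates alike. *)
Definition nsq (I : finType) (u : I -> R[i]) : R := \sum_j cmod (u j) ^+ 2.
(** Twice the squared norm of the exterior product of [u] and [v]. *)
Definition wedge (I : finType) (u v : I -> R[i]) : R :=
  \sum_a \sum_b cmod (u a * v b - u b * v a) ^+ 2.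

Lemma wedge_ge0 (I : finType) (u v : I -> R[i]) : 0 <= wedge u v.
Proof. by apply: sumr_ge0 => a _; apply: sumr_ge0 => b _; rewrite sqr_ge0. Qed.

Lemma nsq_ge0 (I : finType) (u : I -> R[i]) : 0 <= nsq u.
Proof. by apply: sumr_ge0 => a _; rewrite sqr_ge0. Qed.

(** By Lagrange's identity, the Hermitian form
    (1 + |x|^2) |y|^2 - |<y, x>|^2 equals |y|^2 plus half of the wedge of x
    and y. *)
Lemma FS_form (x y : 'rV[R[i]]_n) :
  complex.Re (\sum_(a < n) \sum_(b < n)
    FS_coef a b x * y 0 a * conjc (y 0 b) * (- 2 * 'i%C)) =
  (pi^-1) * ((nsq (y 0) + wedge (y 0) (x 0) / 2) / potS x ^+ 2).
Proof.
have s0 := potS_gt0 x; set s := potS x in s0 *.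
pose T := \sum_a y 0 a * conjc (x 0 a).
have pi0 := pi_gt0 R.
have -> : \sum_(a < n) \sum_(b < n) FS_coef a b x * y 0 a * conjc (y 0 b) * (- 2 * 'i%C) =
  ((pi^-1) * (s^-1 * nsq (y 0) - s^-1 ^+ 2 * cmod T ^+ 2))%:C.
  have -> : (pi^-1 * (s^-1 * nsq (y 0) - s^-1 ^+ 2 * cmod T ^+ 2))%:C =
    (pi^-1)%:C * (s^-1%:C * (nsq (y 0))%:C - (s^-1 ^+ 2)%:C * (T * conjc T)) :> R[i].
    by rewrite -cmod_sqrC -!rmorphM -rmorphB -rmorphM.
  have -> : conjc T = \sum_a conjc (y 0 a) * x 0 a.
    by rewrite rmorph_sum; apply: eq_bigr => a _; rewrite rmorphM /= conjcK.
  rewrite /T big_distrlr /= /nsq rmorph_sum /=.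
  rewrite mulrBr !mulr_sumr -sumrB; apply: eq_bigr => a _.
  rewrite cmod_sqrC.
  have -> : (pi^-1)%:C * (s^-1%:C * (y 0 a * conjc (y 0 a))) =
    \sum_(b < n) (pi^-1)%:C * (s^-1%:C * ((a == b)%:R * (y 0 a * conjc (y 0 b)))) :> R[i].
    rewrite (bigD1 a) //= eqxx mul1r big1 ?addr0 // => b ba.
    by rewrite eq_sym (negbTE ba) mul0r !mulr0.
  rewrite !mulr_sumr -sumrB; apply: eq_bigr => b _.
  rewrite FS_coefE -/s.
  have i2 : ('i%C : R[i]) * 'i%C = -1 by rewrite -expr2 sqr_i.
  have -> : (s^-1 ^+ 2)%:C = s^-1%:C * s^-1%:C :> R[i] by rewrite expr2 rmorphM.
  have -> : ((2 * pi)%:C)^-1 = (2^-1 : R[i]) * (pi^-1)%:C.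
    by rewrite rmorphM rmorph_nat invfM fmorphV.
  have two : (2 : R[i]) != 0 by rewrite pnatr_eq0.
  set P := (pi^-1)%:C; set s' := (s^-1)%:C.
  set D := (_ == _)%:R; set ya := y 0 a; set yb := conjc (y 0 b).
  set xa := conjc (x 0 a); set xb := x 0 b.
  transitivity ((- ('i%C * 'i%C)) * (2 / 2) * (P * (D * s' - xa * xb * (s' * s')) * ya * yb)); first by ring.
  by rewrite i2 divff // opprK; ring.
have L := lagrange (y 0) (x 0).
rewrite -/(wedge (y 0) (x 0)) -/(nsq (y 0)) -/T in L.
have sE : s = 1 + nsq (x 0) by [].
rewrite /= L -/(nsq (x 0)).
have -> : nsq (x 0) = s - 1 by rewrite sE; ring.
by congr (_ * _); field; rewrite gt_eqF.
Qed.

(** The wedge of the homogeneous coordinates with their derivatives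
    counts each pair of indices twice, and half of it is exactly the
    numerator of the pulled back form in the chart j.  The factor [c] varies
    with the point and need not be continuous. *)
Lemma FS_pullback_le (h : Cplx R -> CP R n) (F : 'I_n.+1 -> R[i] -> R[i])
    (F' : 'I_n.+1 -> R[i]) (z : R[i]) :
  (exists2 r, 0 < r & forall w, cmod w < r ->
     exists2 c, c != 0 & forall j, hcoord (h (z + w)) 0 j = c * F j (z + w)) ->
  (exists j, F j z != 0) ->
  (forall j, cdiff (F j) z (F' j)) ->
  FS_pullback h z <= pi^-1 * (wedge (F^~ z) F' / nsq (F^~ z) ^+ 2).
Proof.
move=> [r r0 H] [j1 Fj1] dF.
have [c c0 Hc] := H 0 ltac:(by rewrite cmod0).
rewrite addr0 in Hc.
set j := chart_at (h z).
have Fj : F j z != 0.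
  rewrite /j /chart_at; case: pickP => [i|/(_ j1)] /=; rewrite Hc mulf_eq0 negb_or.
    by case/andP.
  by rewrite c0 Fj1.
have chE w a : cmod w < r -> chart j (h (z + w)) 0 a = F (lift j a) (z + w) / F j (z + w).
  move=> /H [c' c'0 E]; rewrite mxE !E; have [->|Fn] := eqVneq (F j (z + w)) 0.
    by rewrite mulr0 invr0 !mulr0.
  by field; rewrite c'0 Fn.
pose x := chart j (h z).
have xE a : x 0 a = F (lift j a) z / F j z.
  by have := chE 0 a; rewrite addr0 cmod0; apply.
pose y : 'rV[R[i]]_n := \row_a ((F' (lift j a) * F j z - F (lift j a) z * F' j) / F j z ^+ 2).
have yv a : y 0 a = (F' (lift j a) * F j z - F (lift j a) z * F' j) / F j z ^+ 2 by rewrite mxE.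
have yE a : derive1 (fun w : Cplx R => chart j (h w) 0 a : Cplx R) z = y 0 a.
  apply: cdiff_derive1; apply: (cdiff_near (f := fun w => F (lift j a) w / F j w)).
    by exists r => // w wr; rewrite chE.
  have := cdiffM (dF (lift j a)) (cdiffV Fj (dF j)).
  rewrite mxE; congr (cdiff _ _ _); field; exact: Fj.
have -> : FS_pullback h z = complex.Re (\sum_(a < n) \sum_(b < n)
    FS_coef a b x * y 0 a * conjc (y 0 b) * (- 2 * 'i%C)).
  rewrite /FS_pullback -/j; congr (complex.Re _); apply: eq_bigr => a _.
  by apply: eq_bigr => b _; rewrite !yE.
rewrite FS_form; apply: ler_wpM2l; first by rewrite invr_ge0 pi_ge0.
have cn : cmod (F j z) != 0 by rewrite cmod_eq0.
pose q := cmod (F j z) ^+ 2.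
have q0 : 0 < q by rewrite exprn_gt0 // cmod_gt0.
have nE : nsq (F^~ z) = q * potS x.
  rewrite /nsq (bigD1_ord j) //= /potS mulrDr mulr1 mulr_sumr; congr (_ + _).
  apply: eq_bigr => a _; rewrite xE cmodf expr_div_n /q; field.
  exact: cn.
have s0 := potS_gt0 x.
have dq : q ^+ 2 * (nsq (y 0) + wedge (y 0) (x 0) / 2) <= wedge (F^~ z) F'.
  have cq : 0 < cmod (F j z) by rewrite cmod_gt0.
  have e1 : q ^+ 2 * nsq (y 0) = \sum_(a < n) cmod (F (lift j a) z * F' j - F j z * F' (lift j a)) ^+ 2.
    rewrite /nsq mulr_sumr; apply: eq_bigr => a _; rewrite mxE cmodf expr_div_n cmodX /q.
    rewrite cmodC [F' _ * _]mulrC; field; exact: cn.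
  have e2 : q ^+ 2 * wedge (y 0) (x 0) = \sum_(a < n) \sum_(b < n)
      cmod (F (lift j a) z * F' (lift j b) - F (lift j b) z * F' (lift j a)) ^+ 2.
    rewrite /wedge mulr_sumr; apply: eq_bigr => a _; rewrite mulr_sumr; apply: eq_bigr => b _.
    have -> : y 0 a * x 0 b - y 0 b * x 0 a =
      - ((F (lift j a) z * F' (lift j b) - F (lift j b) z * F' (lift j a)) / F j z ^+ 2).
      by rewrite !yv !xE; field; exact: Fj.
    rewrite cmodN cmodf expr_div_n cmodX /q; field; exact: cn.
  rewrite mulrDr mulrA e2 e1 /wedge (bigD1_ord j) //=.
  set A := \sum_(a < n) cmod _ ^+ 2; set B := \sum_(a < n) \sum_(b < n) _.
  have A0 : 0 <= A by apply: sumr_ge0 => a _; rewrite sqr_ge0.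
  have B0 : 0 <= B by apply: sumr_ge0 => a _; apply: sumr_ge0 => b _; rewrite sqr_ge0.
  have -> : \sum_(i < n) \sum_b cmod (F (lift j i) z * F' b - F b z * F' (lift j i)) ^+ 2 = A + B.
    rewrite /A /B -big_split /=; apply: eq_bigr => a _.
    by rewrite (bigD1_ord j).
  have C0 : 0 <= \sum_b cmod (F j z * F' b - F b z * F' j) ^+ 2.
    by apply: sumr_ge0 => a _; rewrite sqr_ge0.
  lra.
rewrite nE exprMn ler_pdivlMr; last by apply: mulr_gt0; apply: exprn_gt0.
apply: le_trans dq; rewrite le_eqVlt; apply/orP; left; apply/eqP.
by field; rewrite gt_eqF.
Qed.

End Pullback.

(** * A norm on polynomials, and normalised translates *)

Section PolyNorm.
Set Implicit Arguments.
Unset Strict Implicit.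
Unset Printing Implicit Defensive.
Local Open Scope complex_scope.
Variable R : realType.
Implicit Types (P Q : {poly R[i]}) (T : R) (z h : R[i]).

(** The sum of the moduli of the terms at radius [T].  It is a
    submultiplicative norm which bounds values on the disc of radius [T]
    and, at a larger radius, derivatives; hence closeness of polynomials
    is measured by a single number. *)
Definition pnorm T P : R := \sum_(i < size P) cmod P`_i * T ^+ i.

Lemma pnorm_wide T P k : (size P <= k)%N -> pnorm T P = \sum_(i < k) cmod P`_i * T ^+ i.
Proof.
move=> Pk; rewrite /pnorm (big_ord_widen _ (fun i => cmod P`_i * T ^+ i) Pk).
rewrite big_mkcond; apply: eq_bigr => i _; case: ltnP => // h.
by rewrite nth_default // cmod0 mul0r.
Qed.

Lemma pnorm_ge0 T P : 0 <= T -> 0 <= pnorm T P.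
Proof. by move=> T0; apply: sumr_ge0 => i _; rewrite mulr_ge0 ?cmod_ge0 ?exprn_ge0. Qed.

Lemma pnormD T P Q : 0 <= T -> pnorm T (P + Q) <= pnorm T P + pnorm T Q.
Proof.
move=> T0; pose k := maxn (size P) (size Q).
rewrite (pnorm_wide T (leq_maxl _ _ : size P <= k)%N) (pnorm_wide T (leq_maxr _ _ : size Q <= k)%N).
rewrite (pnorm_wide T (size_polyD P Q)) -big_split /=; apply: ler_sum => i _.
by rewrite coefD -mulrDl ler_wpM2r ?exprn_ge0 // cmodD.
Qed.

Lemma pnorm0 T : pnorm T 0 = 0.
Proof. by rewrite /pnorm size_poly0 big_ord0. Qed.

Lemma pnormZ T c P : pnorm T (c *: P) = cmod c * pnorm T P.
Proof.
rewrite (pnorm_wide T (size_scale_leq c P)) /pnorm mulr_sumr.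
by apply: eq_bigr => i _; rewrite coefZ cmodM mulrA.
Qed.

Lemma pnormN T P : pnorm T (- P) = pnorm T P.
Proof. by rewrite -scaleN1r pnormZ cmodN cmod1 mul1r. Qed.

Lemma pnorm_sum T (I : Type) (r : seq I) (F : I -> {poly R[i]}) : 0 <= T ->
  pnorm T (\sum_(i <- r) F i) <= \sum_(i <- r) pnorm T (F i).
Proof.
move=> T0; elim: r => [|i r IH]; first by rewrite !big_nil pnorm0.
by rewrite !big_cons; apply: le_trans (pnormD _ _ T0) _; rewrite lerD2l.
Qed.

Lemma pnormXM T i P : pnorm T ('X^i * P) = T ^+ i * pnorm T P.
Proof.
have sz : (size ('X^i * P)%R <= i + size P)%N.
  by have := size_polyMleq ('X^i : {poly R[i]}) P; rewrite size_polyXn addSn.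
rewrite (pnorm_wide T sz) big_split_ord /= big1 ?add0r; last first.
  by move=> j _; rewrite coefXnM ltn_ord cmod0 mul0r.
rewrite /pnorm mulr_sumr; apply: eq_bigr => j _.
by rewrite coefXnM ltnNge leq_addr /= addKn exprD; ring.
Qed.

Lemma pnormM T P Q : 0 <= T -> pnorm T (P * Q) <= pnorm T P * pnorm T Q.
Proof.
move=> T0; rewrite -{1}(coefK P) poly_def mulr_suml.
apply: le_trans (pnorm_sum _ _ T0) _; rewrite {2}/pnorm mulr_suml.
by apply: ler_sum => i _; rewrite -scalerAl pnormZ pnormXM mulrA.
Qed.

Lemma pnormX T P k : 0 <= T -> pnorm T (P ^+ k) <= pnorm T P ^+ k.
Proof.
move=> T0; elim: k => [|k IH].
  by rewrite !expr0 /pnorm size_poly1 big_ord1 coefC /= cmod1 expr0 mul1r.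
rewrite !exprS; apply: le_trans (pnormM _ _ T0) _.
by rewrite ler_wpM2l // pnorm_ge0.
Qed.

Lemma pnorm_le T T' P : 0 <= T -> T <= T' -> pnorm T P <= pnorm T' P.
Proof.
move=> T0 TT; apply: ler_sum => i _; rewrite ler_wpM2l ?cmod_ge0 //.
by apply: lerXn2r; rewrite ?nnegrE //; apply: le_trans TT.
Qed.

Lemma pnorm_eval T P z : cmod z <= T -> cmod P.[z] <= pnorm T P.
Proof.
move=> zT; rewrite horner_coef; apply: le_trans (cmod_sum _ _ _) _.
apply: ler_sum => i _; rewrite cmodM cmodX ler_wpM2l ?cmod_ge0 //.
by apply: lerXn2r; rewrite ?nnegrE ?cmod_ge0 //; apply: le_trans zT; exact: cmod_ge0.
Qed.

Lemma horner_deriv_sum P z : P^`().[z] = \sum_(i < size P) P`_i * (z ^+ i.-1 *+ i).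
Proof.
rewrite -{1}(coefK P) poly_def linear_sum horner_sum /=; apply: eq_bigr => i _.
by rewrite derivZ derivXn hornerZ hornerMn hornerXn.
Qed.

(** Since i <= 2^i, the factor i in the derivative of X^i is absorbed by
    doubling the radius. *)
Lemma pnorm_deriv T P z : 1 <= T -> cmod z <= T -> cmod P^`().[z] <= pnorm (2 * T) P.
Proof.
move=> T1 zT; rewrite horner_deriv_sum; apply: le_trans (cmod_sum _ _ _) _.
have T0 : 0 <= T by lra.
apply: ler_sum => -[i _] _ /=; rewrite cmodM ler_wpM2l ?cmod_ge0 //.
rewrite -mulr_natr cmodM cmodX cmod_nat exprMn mulrC.
apply: ler_pM; rewrite ?ler0n ?exprn_ge0 ?cmod_ge0 //.
  by rewrite -natrX ler_nat ltnW // ltn_expl.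
apply: le_trans (_ : T ^+ i.-1 <= _).
  by apply: lerXn2r; rewrite ?nnegrE ?cmod_ge0.
by apply: ler_weXn2l => //; exact: leq_pred.
Qed.

Lemma pow_remainder T z h i : 1 <= T -> cmod z <= T -> cmod (z + h) <= T ->
  cmod ((z + h) ^+ i - z ^+ i - (z ^+ i.-1 *+ i) * h) <= cmod h ^+ 2 * (4 * T) ^+ i.
Proof.
move=> T1 zT zhT; have T0 : 0 <= T by lra.
have h0 : 0 <= cmod h ^+ 2 by rewrite exprn_ge0 ?cmod_ge0.
elim: i => [|i IH].
  by rewrite !expr0 mulr0n mul0r subr0 subrr cmod0 mulr1.
have -> : (z + h) ^+ i.+1 - z ^+ i.+1 - (z ^+ i.+1.-1 *+ i.+1) * h =
  (z ^+ i.-1 *+ i) * h ^+ 2 + (z + h) * ((z + h) ^+ i - z ^+ i - (z ^+ i.-1 *+ i) * h).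
  case: i {IH} => [|i] /=; first by rewrite !expr0 !expr1 !mulr0n !mulr1n; ring.
  rewrite -[_ *+ i.+2]mulr_natr -[_ *+ i.+1]mulr_natr -[i.+2%:R]natr1.
  by move: (i.+1%:R) => N; rewrite !exprS; ring.
apply: le_trans (cmodD _ _) _.
have e1 : cmod ((z ^+ i.-1 *+ i) * h ^+ 2) <= cmod h ^+ 2 * (4 * T) ^+ i.
  rewrite -mulr_natr mulrC cmodM cmodX ler_wpM2l // cmodM cmodX cmod_nat mulrC exprMn.
  apply: ler_pM; rewrite ?ler0n ?exprn_ge0 ?cmod_ge0 //.
    by rewrite -natrX ler_nat ltnW // ltn_expl.
  apply: le_trans (_ : T ^+ i.-1 <= _); first by apply: lerXn2r; rewrite ?nnegrE ?cmod_ge0.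
  by apply: ler_weXn2l => //; exact: leq_pred.
have e2 : cmod ((z + h) * ((z + h) ^+ i - z ^+ i - (z ^+ i.-1 *+ i) * h)) <=
    T * (cmod h ^+ 2 * (4 * T) ^+ i).
  by rewrite cmodM; apply: ler_pM; rewrite ?cmod_ge0.
rewrite [(4 * T) ^+ i.+1]exprS; set X := cmod h ^+ 2 in h0 e1 e2 *; set Y := (4 * T) ^+ i in e1 e2 *.
have Y0 : 0 <= X * Y by rewrite mulr_ge0 // exprn_ge0 // mulr_ge0.
have : 1 * (X * Y) <= T * (X * Y) by apply: ler_wpM2r.
have -> : X * (4 * T * Y) = 4 * (T * (X * Y)) by ring.
lra.
Qed.

(** Taylor's formula of order 2 with a bound that depends on the
    polynomial only through its norm, so that it passes to limits. *)
Lemma pnorm_remainder T P z h : 1 <= T -> cmod z <= T -> cmod (z + h) <= T ->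
  cmod (P.[z + h] - P.[z] - P^`().[z] * h) <= cmod h ^+ 2 * pnorm (4 * T) P.
Proof.
move=> T1 zT zhT; rewrite horner_deriv_sum !horner_coef mulr_suml -!sumrB.
apply: le_trans (cmod_sum _ _ _) _; rewrite /pnorm mulr_sumr; apply: ler_sum => i _.
rewrite -mulrA -!mulrBr cmodM mulrCA ler_wpM2l ?cmod_ge0 //.
exact: pow_remainder.
Qed.

(** The translate of a polynomial of degree [d] by [a], normalised in such a
    way that the monic ones tend to 1 when [a] tends to infinity. *)
Definition unit_shift (a : R[i]) (d : nat) P := ((- a) ^+ d)^-1 *: (P \Po ('X - a%:P)).

Lemma unit_shift_eval a d P z : (unit_shift a d P).[z] = P.[z - a] / (- a) ^+ d.
Proof. by rewrite /unit_shift hornerZ horner_comp hornerXsubC mulrC. Qed.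

(** With L = 1 - X / a, the polynomial is L^d plus terms with a factor
    1 / a, and L^d - 1 is divisible by L - 1 = - X / a. *)
Lemma unit_shift_near1 d P T e : P \is monic -> size P = d.+1 -> 1 <= T -> 0 < e ->
  exists2 A : R, 1 <= A & forall a, A <= cmod a -> pnorm T (unit_shift a d P - 1) <= e.
Proof.
move=> Pm Ps T1 e0; have T0 : 0 <= T by lra.
pose M := T * \sum_(i < d) 2 ^+ i + \sum_(i < d) cmod P`_i * 2 ^+ i.
have M0 : 0 <= M.
  rewrite addr_ge0 ?mulr_ge0 ?sumr_ge0 // => i _; rewrite ?mulr_ge0 ?cmod_ge0 ?exprn_ge0 //.
exists (Num.max T (M / e)); first by rewrite le_max T1.
move=> a; rewrite ge_max => /andP[aT aM].
have a1 : 1 <= cmod a by lra.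
have a0 : 0 < cmod a by lra.
have an0 : a != 0 by rewrite -cmod_gt0.
have an1 : - a != 0 by rewrite oppr_eq0.
pose L : {poly R[i]} := 1 - a^-1 *: 'X.
have XaE : 'X - a%:P = (- a) *: L.
  rewrite /L scalerBr scalerA mulNr mulfV // !scaleNr scale1r opprK addrC.
  by rewrite alg_polyC.
have pn1 : pnorm T 1 = 1.
  by rewrite /pnorm size_poly1 big_ord1 coefC /= cmod1 expr0 mul1r.
have pnX : pnorm T (a^-1 *: 'X) = T / cmod a.
  rewrite pnormZ cmodV mulrC; congr (_ / _).
  by rewrite -['X]mulr1 -{1}(expr1 'X) pnormXM expr1 pn1 mulr1.
have L2 : pnorm T L <= 2.
  apply: le_trans (pnormD _ _ T0) _; rewrite pnormN pn1 pnX.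
  have : T / cmod a <= 1 by rewrite ler_pdivrMr // mul1r.
  lra.
have Li i : pnorm T (L ^+ i) <= 2 ^+ i.
  apply: le_trans (pnormX _ _ T0) _; apply: lerXn2r; rewrite ?nnegrE //; exact: pnorm_ge0.
have -> : unit_shift a d P - 1 = (- (a^-1 *: 'X)) * (\sum_(i < d) L ^+ i) +
    \sum_(i < d) (P`_i / (- a) ^+ (d - i)) *: L ^+ i.
  rewrite /unit_shift comp_polyE Ps big_ord_recr /= scalerDr.
  have -> : P`_d = 1 by move: Pm; rewrite monicE /lead_coef Ps => /eqP.
  rewrite scale1r XaE exprZn scalerA mulVf ?expf_neq0 // scale1r.
  rewrite -addrA addrC; congr (_ + _).
    rewrite subrX1; congr (_ * _).
      by rewrite /L addrAC subrr add0r.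
  rewrite scaler_sumr; apply: eq_bigr => i _; rewrite exprZn !scalerA; congr (_ *: _).
  have id : (i <= d)%N by exact: ltnW.
  by rewrite -{1}(subnKC id) exprD; field; rewrite !expf_neq0.
apply: le_trans (pnormD _ _ T0) _.
have h1 : pnorm T (- (a^-1 *: 'X) * \sum_(i < d) L ^+ i) <= T / cmod a * \sum_(i < d) 2 ^+ i.
  apply: le_trans (pnormM _ _ T0) _; rewrite pnormN pnX ler_wpM2l ?divr_ge0 ?(ltW a0) //.
  by apply: le_trans (pnorm_sum _ _ T0) _; apply: ler_sum => i _; exact: Li.
have h2 : pnorm T (\sum_(i < d) (P`_i / (- a) ^+ (d - i)) *: L ^+ i) <=
    (\sum_(i < d) cmod P`_i * 2 ^+ i) / cmod a.
  apply: le_trans (pnorm_sum _ _ T0) _; rewrite mulr_suml; apply: ler_sum => i _.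
  rewrite pnormZ cmodf cmodX cmodN.
  have -> : cmod P`_i * 2 ^+ i / cmod a = cmod P`_i * ((cmod a)^-1 * 2 ^+ i) by ring.
  rewrite -mulrA; apply: ler_wpM2l; first exact: cmod_ge0.
  apply: ler_pM; [|exact: pnorm_ge0| |exact: Li].
    by rewrite invr_ge0 exprn_ge0 ?cmod_ge0.
  rewrite lef_pV2 ?posrE ?exprn_gt0 // -{1}(expr1 (cmod a)).
  by apply: ler_weXn2l; rewrite ?subn_gt0.
apply: le_trans (lerD h1 h2) _.
have -> : T / cmod a * \sum_(i < d) 2 ^+ i + (\sum_(i < d) cmod P`_i * 2 ^+ i) / cmod a = M / cmod a.
  by rewrite /M; field; rewrite gt_eqF.
by rewrite ler_pdivrMr // mulrC -ler_pdivrMr.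
Qed.

End PolyNorm.

(** * The density of a curve *)

Section Dens.
Set Implicit Arguments.
Unset Strict Implicit.
Unset Printing Implicit Defensive.
Local Open Scope complex_scope.
Variable R : realType.
Implicit Types (z w : R[i]).

(** For [u] the homogeneous coordinates of a curve at a point and [v] their
    derivatives, this is 2 pi times the area density of the curve. *)
Definition dens (I : finType) (u v : I -> R[i]) : R := wedge u v / nsq u ^+ 2.

Lemma dens_ge0 (I : finType) (u v : I -> R[i]) : 0 <= dens u v.
Proof. by rewrite divr_ge0 ?wedge_ge0 ?exprn_ge0 ?nsq_ge0. Qed.

Lemma nsq_coord (I : finType) (u : I -> R[i]) j : cmod (u j) ^+ 2 <= nsq u.
Proof. by rewrite /nsq (bigD1 j) //= lerDl sumr_ge0 // => i _; rewrite sqr_ge0. Qed.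

Lemma nsq_gt0 (I : finType) (u : I -> R[i]) j : u j != 0 -> 0 < nsq u.
Proof.
by move=> uj; apply: lt_le_trans (nsq_coord u j); rewrite exprn_gt0 // cmod_gt0.
Qed.

Lemma cmodD_sqr z w : cmod (z + w) ^+ 2 <= 2 * cmod z ^+ 2 + 2 * cmod w ^+ 2.
Proof.
have h := cmodD z w; have z0 := cmod_ge0 z; have w0 := cmod_ge0 w.
apply: le_trans (_ : (cmod z + cmod w) ^+ 2 <= _).
  by apply: lerXn2r; rewrite ?nnegrE ?addr_ge0 ?cmod_ge0.
have := sqr_ge0 (cmod z - cmod w); rewrite !expr2; lra.
Qed.

(** In the wedge of the products, Leibniz's rule separates the wedge of u
    from that of v.  If the [u j] have comparable moduli, multiplication by
    them changes all norms by bounded factors, so the constant depends only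
    on the number of coordinates. *)
Lemma dens_prod (I : finType) (u u' v v' : I -> R[i]) (m : R) :
  0 < m -> (forall j, m <= cmod (u j) <= 2 * m) -> (exists j, v j != 0) ->
  dens (fun j => u j * v j) (fun j => u' j * v j + u j * v' j) <=
  32 * #|I|%:R ^+ 2 * (dens u u' + dens v v').
Proof.
move=> m0 um [j0 vj0].
have N1 : 1 <= (#|I|%:R : R) by rewrite ler1n; apply/card_gt0P; exists j0.
have N0 : 0 < (#|I|%:R : R) by apply: lt_le_trans N1.
set N := (#|I|%:R : R) in N0 N1 *.
have nv := nsq_gt0 vj0.
have uj0 : u j0 != 0 by rewrite -cmod_gt0; have /andP[h _] := um j0; lra.
have nu := nsq_gt0 uj0.
have m20 : 0 < m ^+ 2 by rewrite exprn_gt0.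
have m40 : 0 < m ^+ 4 by rewrite exprn_gt0.
have um2 j : m ^+ 2 <= cmod (u j) ^+ 2 /\ cmod (u j) ^+ 2 <= 4 * m ^+ 2.
  have /andP[h1 h2] := um j; have h0 := cmod_ge0 (u j); split.
    by apply: lerXn2r; rewrite ?nnegrE // ltW.
  have -> : 4 * m ^+ 2 = (2 * m) ^+ 2 by ring.
  by apply: lerXn2r; rewrite ?nnegrE //; lra.
(* |uv|^2 >= m^2 |v|^2 and |u|^2 <= 4 N m^2; the cross terms of the wedge
   cost a factor 2 in cmodD_sqr, and 32 N^2 absorbs both constants. *)
have n1 : m ^+ 2 * nsq v <= nsq (fun j => u j * v j).
  rewrite /nsq mulr_sumr; apply: ler_sum => j _; rewrite cmodM exprMn.
  by apply: ler_wpM2r; rewrite ?sqr_ge0 //; case: (um2 j).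
have n2 : nsq u <= 4 * N * m ^+ 2.
  apply: le_trans (_ : \sum_(j : I) 4 * m ^+ 2 <= _).
    by apply: ler_sum => j _; case: (um2 j).
  by rewrite sumr_const -mulr_natl -/N; lra.
have w1 : wedge (fun j => u j * v j) (fun j => u' j * v j + u j * v' j) <=
    2 * nsq v ^+ 2 * wedge u u' + 32 * m ^+ 4 * wedge v v'.
  rewrite /wedge mulr_sumr [X in _ <= _ + X]mulr_sumr -big_split /=.
  apply: ler_sum => a _; rewrite mulr_sumr [X in _ <= _ + X]mulr_sumr -big_split /=.
  apply: ler_sum => b _.
  have -> : u a * v a * (u' b * v b + u b * v' b) - u b * v b * (u' a * v a + u a * v' a) =
    v a * v b * (u a * u' b - u b * u' a) + u a * u b * (v a * v' b - v b * v' a) by ring.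
  apply: le_trans (cmodD_sqr _ _) _; rewrite !cmodM !exprMn.
  set X := cmod (u a * _ - _) ^+ 2; set Y := cmod (v a * _ - _) ^+ 2.
  have X0 : 0 <= X by rewrite sqr_ge0.
  have Y0 : 0 <= Y by rewrite sqr_ge0.
  have e1 : cmod (v a) ^+ 2 * cmod (v b) ^+ 2 * X <= nsq v ^+ 2 * X.
    apply: ler_wpM2r => //; rewrite [leRHS]expr2.
    by apply: ler_pM; rewrite ?sqr_ge0 // nsq_coord.
  have e2 : cmod (u a) ^+ 2 * cmod (u b) ^+ 2 * Y <= 16 * m ^+ 4 * Y.
    apply: ler_wpM2r => //; have -> : 16 * m ^+ 4 = (4 * m ^+ 2) * (4 * m ^+ 2) by ring.
    by apply: ler_pM; rewrite ?sqr_ge0 //; [case: (um2 a)|case: (um2 b)].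
  lra.
have n0 : 0 < m ^+ 2 * nsq v by rewrite mulr_gt0.
rewrite /dens; apply: le_trans (_ : (2 * nsq v ^+ 2 * wedge u u' + 32 * m ^+ 4 * wedge v v') / (m ^+ 2 * nsq v) ^+ 2 <= _).
  apply: ler_pM; rewrite ?wedge_ge0 ?invr_ge0 ?exprn_ge0 ?nsq_ge0 //.
  rewrite lef_pV2 ?posrE ?exprn_gt0 //; last by apply: lt_le_trans n1.
  by apply: lerXn2r; rewrite ?nnegrE ?nsq_ge0 // ltW.
have -> : (2 * nsq v ^+ 2 * wedge u u' + 32 * m ^+ 4 * wedge v v') / (m ^+ 2 * nsq v) ^+ 2 =
   2 * (wedge u u' / m ^+ 4) + 32 * (wedge v v' / nsq v ^+ 2).
  by field; apply/andP; split; rewrite gt_eqF.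
have W0 := wedge_ge0 u u'; have V0 := wedge_ge0 v v'.
have e1 : wedge u u' / m ^+ 4 <= 16 * N ^+ 2 * (wedge u u' / nsq u ^+ 2).
  rewrite mulrCA; apply: ler_wpM2l => //.
  rewrite ler_pdivlMr ?exprn_gt0 // mulrC ler_pdivrMr //.
  have -> : 16 * N ^+ 2 * m ^+ 4 = (4 * N * m ^+ 2) ^+ 2 by ring.
  have nn : 0 <= 4 * N * m ^+ 2 := le_trans (ltW nu) n2.
  by apply: lerXn2r => //; rewrite nnegrE ltW.
have D0 : 0 <= wedge v v' / nsq v ^+ 2 by exact: (dens_ge0 v v').
have N2 : 1 <= N ^+ 2 by rewrite exprn_ege1.
have e2 : 1 * (wedge v v' / nsq v ^+ 2) <= N ^+ 2 * (wedge v v' / nsq v ^+ 2).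
  exact: ler_wpM2r.
set A := wedge u u' / _ in e1 *; set B := wedge v v' / _ in e2 *.
set C := wedge u u' / _ in e1 *; set M := N ^+ 2 in e1 e2 *.
lra.
Qed.

Lemma poly_growth (P : {poly R[i]}) k d : (forall i, (i < size P)%N -> (i + k <= d)%N) ->
  exists2 A : R, 0 <= A & forall z, 1 <= cmod z -> cmod P.[z] * cmod z ^+ k <= A * cmod z ^+ d.
Proof.
move=> H; exists (\sum_(i < size P) cmod P`_i); first by apply: sumr_ge0 => i _; exact: cmod_ge0.
move=> z z1; rewrite horner_coef.
apply: le_trans (_ : (\sum_(i < size P) cmod P`_i * cmod z ^+ i) * cmod z ^+ k <= _).
  apply: ler_wpM2r; first by rewrite exprn_ge0 // cmod_ge0.
  by apply: le_trans (cmod_sum _ _ _) _; apply: ler_sum => i _; rewrite cmodM cmodX.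
rewrite !mulr_suml; apply: ler_sum => i _; rewrite -mulrA -exprD.
apply: ler_wpM2l; first exact: cmod_ge0.
by apply: ler_weXn2l => //; apply: H.
Qed.

(** Compactness: near each point, some function is bounded away from 0. *)
Lemma lower_bound (I : finType) (f : I -> R[i] -> R[i]) (x1 x2 y1 y2 : R) : x1 < x2 -> y1 < y2 ->
  (forall w, in_rect x1 x2 y1 y2 w -> forall j, ccont (f j) w) ->
  (forall w, in_rect x1 x2 y1 y2 w -> exists j, f j w != 0) ->
  exists2 m, 0 < m & forall w, in_rect x1 x2 y1 y2 w -> exists j, m <= cmod (f j w).
Proof.
move=> xx yy cf f0.
pose P a b c d := exists2 m, 0 < m & forall w, in_rect a b c d w -> exists j, m <= cmod (f j w).
apply: (@quartering R P) => //.
- move=> a b c d h1 h2 h3 h4 h5 h6 mx my [M1 p1 q1] [M2 p2 q2] [M3 p3 q3] [M4 p4 q4].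
  exists (Num.min (Num.min M1 M2) (Num.min M3 M4)); first by rewrite !lt_min p1 p2 p3.
  move=> w [/andP[k1 k2] /andP[k3 k4]].
  have wk (M : R) : (exists j, M <= cmod (f j w)) -> Num.min (Num.min M1 M2) (Num.min M3 M4) <= M ->
    exists j, Num.min (Num.min M1 M2) (Num.min M3 M4) <= cmod (f j w).
    by move=> [j hj] h; exists j; apply: le_trans hj.
  have [l1|l1] := leP (complex.Re w) mx; have [l2|l2] := leP (complex.Im w) my.
  + by apply: wk (q1 w _) _; [rewrite /in_rect k1 k3 l1 l2 | rewrite !ge_min lexx].
  + by apply: wk (q3 w _) _; [rewrite /in_rect k1 k4 l1 (ltW l2) | rewrite !ge_min lexx !orbT].
  + by apply: wk (q2 w _) _; [rewrite /in_rect k2 k3 (ltW l1) l2 | rewrite !ge_min lexx !orbT].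
  + by apply: wk (q4 w _) _; [rewrite /in_rect k2 k4 (ltW l1) (ltW l2) | rewrite !ge_min lexx !orbT].
- move=> p q hp hq; have pin : in_rect x1 x2 y1 y2 (p +i* q) by split.
  have [j fj] := f0 _ pin.
  have e0 : 0 < cmod (f j (p +i* q)) / 2 by rewrite divr_gt0 // cmod_gt0.
  have [r r0 H] := cf _ pin j _ e0.
  exists (r / 2); first by lra.
  move=> a b c d h1 h2 h3 h4 h5 h6 h7 h8 ab cd w1 w2.
  exists (cmod (f j (p +i* q)) / 2) => // w win; exists j.
  have zin : in_rect a b c d (p +i* q) by split; apply/andP.
  have dw := cmod_in zin win.
  have := H (w - (p +i* q)); rewrite (addrC (p +i* q)) subrK => H2.
  have H3 : cmod (f j w - f j (p +i* q)) <= cmod (f j (p +i* q)) / 2 by apply: H2; clear -dw w1 w2; lra.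
  have := cmodD (f j w) (- (f j w - f j (p +i* q))); rewrite cmodN opprB addrCA subrr addr0.
  clear -H3; lra.
Qed.

(** A majorant of the densities: it decays like |z|^-4 along generic
    directions, and its integral is that of a product of two Cauchy
    densities. *)
Definition kernz z : R := ((1 + complex.Re z ^+ 2) * (1 + complex.Im z ^+ 2))^-1.

Lemma kernz_gt0 z : 0 < kernz z.
Proof. by rewrite invr_gt0 mulr_gt0 // ltr_pwDl // sqr_ge0. Qed.

Lemma kernz_lower z : ((1 + cmod z ^+ 2) ^+ 2)^-1 <= kernz z.
Proof.
have x0 := sqr_ge0 (complex.Re z); have y0 := sqr_ge0 (complex.Im z).
rewrite lef_pV2 ?posrE ?mulr_gt0 ?exprn_gt0 ?ltr_pwDl ?sqr_ge0 //.
rewrite cmod_sqr; set X := complex.Re z ^+ 2 in x0 *; set Y := complex.Im z ^+ 2 in y0 *.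
rewrite [leRHS]expr2; apply: ler_pM; lra.
Qed.

Variable n : nat.
Implicit Types (F : 'I_n.+1 -> {poly R[i]}).

(** All the polynomials have the same leading term lam X^d.  The inductive
    construction preserves this condition, whereas monicity is lost
    to the normalisation of the translates. *)
Definition uniform F lam d := lam != 0 /\ forall j, size (F j) = d.+1 /\ lead_coef (F j) = lam.
Definition densF F z := dens (fun j => (F j).[z]) (fun j => (F j)^`().[z]).

Lemma lower_terms F lam d j : uniform F lam d ->
  exists2 E : {poly R[i]}, F j = lam *: 'X^d + E & (size E <= d)%N.
Proof.
move=> [l0 /(_ j) [sF lF]]; exists (F j - lam *: 'X^d); first by rewrite addrC subrK.
apply/leq_sizeP => i di; rewrite coefB coefZ coefXn.
have [->|nid] := eqVneq i d; first by rewrite mulr1 -lF /lead_coef sF subrr.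
by rewrite mulr0 subr0 nth_default // sF ltn_neqAle eq_sym nid.
Qed.

(** Far from the origin all the polynomials are close to their common
    leading term, so their moduli are within a factor 2 of each other. *)
Lemma balanced_far F lam d : uniform F lam d -> exists2 r : R, 1 <= r &
  forall z, r <= cmod z -> forall j, 2 / 3 * (cmod lam * cmod z ^+ d) <= cmod (F j).[z] <=
     2 * (2 / 3 * (cmod lam * cmod z ^+ d)).
Proof.
move=> U.
have : forall j, exists A : R, 0 <= A /\ forall z, 1 <= cmod z ->
    cmod ((F j).[z] - lam * z ^+ d) * cmod z ^+ 1 <= A * cmod z ^+ d.
  move=> j; have [E FE sE] := lower_terms j U.
  have [A A0 HA] := @poly_growth E 1 d ltac:(by move=> i iE; rewrite addn1; apply: leq_trans iE sE).
  exists A; split => // z z1; rewrite FE hornerD hornerZ hornerXn addrAC subrr add0r.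
  exact: HA.
move=> /choice [A HA].
have l0 : 0 < cmod lam by rewrite cmod_gt0; case: U.
exists (1 + 3 * (\sum_j A j) / cmod lam).
  by rewrite lerDl divr_ge0 ?mulr_ge0 ?sumr_ge0 ?(ltW l0) // => j _; case: (HA j).
move=> z zr j.
have S0 : 0 <= \sum_j A j by apply: sumr_ge0 => i _; case: (HA i).
have q0 : 0 <= 3 * (\sum_j A j) / cmod lam by rewrite divr_ge0 ?mulr_ge0 // ltW.
have z1 : 1 <= cmod z by lra.
have zA : 3 * A j <= cmod lam * cmod z.
  have h : A j <= \sum_j A j.
    by rewrite (bigD1 j) //= lerDl sumr_ge0 // => i _; case: (HA i).
  have : 3 * (\sum_j A j) / cmod lam <= cmod z by lra.
  rewrite ler_pdivrMr //; lra.
have [_ /(_ z z1)] := HA j; rewrite expr1 => h.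
set e := cmod ((F j).[z] - lam * z ^+ d) in h *.
set Z := cmod z ^+ d in h *.
have Z0 : 0 <= Z by rewrite exprn_ge0 // cmod_ge0.
have e3 : 3 * e <= cmod lam * Z.
  have zp : 0 < cmod z by lra.
  rewrite -(ler_pM2r zp); have : 3 * A j * Z <= cmod lam * cmod z * Z by apply: ler_wpM2r.
  have -> : cmod lam * Z * cmod z = cmod lam * cmod z * Z by ring.
  move: (cmod lam * cmod z * Z) => Y; lra.
have lE : cmod (lam * z ^+ d) = cmod lam * Z by rewrite cmodM cmodX.
have h1 := cmodD ((F j).[z] - lam * z ^+ d) (lam * z ^+ d); rewrite subrK lE -/e in h1.
have h2 := cmodD (F j).[z] (- ((F j).[z] - lam * z ^+ d)).
rewrite cmodN opprB addrCA subrr addr0 lE -/e in h2.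
by apply/andP; split; lra.
Qed.

End Dens.

(** * Gluing *)

Section Glue.
Set Implicit Arguments.
Unset Strict Implicit.
Unset Printing Implicit Defensive.
Local Open Scope complex_scope.
Variables (R : realType) (n : nat).
Implicit Types (z w : R[i]) (F p : 'I_n.+1 -> {poly R[i]}).

(** Writing F_b = F_a + E with E of lower degree, the wedge becomes
    F_a E' - E F_a', which is of order |z|^(2d - 2). *)
Lemma wedge_far F lam d : uniform F lam d -> exists2 A : R, 0 <= A &
  forall z, 1 <= cmod z ->
    wedge (fun j => (F j).[z]) (fun j => (F j)^`().[z]) * cmod z ^+ 4 <= A * (cmod z ^+ d) ^+ 4.
Proof.
move=> U.
have : forall ab : 'I_n.+1 * 'I_n.+1, exists A : R, 0 <= A /\ forall z, 1 <= cmod z ->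
    cmod ((F ab.1).[z] * (F ab.2)^`().[z] - (F ab.2).[z] * (F ab.1)^`().[z]) * cmod z ^+ 2 <=
    A * (cmod z ^+ d) ^+ 2.
  move=> [a b] /=.
  have [Ea FaE sa] := lower_terms a U; have [Eb FbE sb] := lower_terms b U.
  pose E := Eb - Ea.
  have sE : (size E <= d)%N.
    by apply: leq_trans (size_polyD _ _) _; rewrite size_polyN geq_max sb sa.
  have FE : F b = F a + E by rewrite FaE FbE /E; ring.
  have [_ /(_ a) [sF _]] := U.
  have [A1 A10 H1] := @poly_growth R (F a) 0 d ltac:(by move=> i; rewrite sF addn0).
  have dE i : (i < size E^`())%N -> (i + 2 <= d)%N.
    move=> h; rewrite addn2.
    have E0 : E != 0 by apply: contraTneq h => ->; rewrite deriv0 size_poly0.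
    apply: leq_trans sE; apply: leq_ltn_trans h _; exact: lt_size_deriv.
  have [A2 A20 H2] := @poly_growth R E^`() 2 d dE.
  have [A3 A30 H3] := @poly_growth R E 1 d ltac:(by move=> i h; rewrite addn1; apply: leq_trans sE).
  have [A4 A40 H4] := @poly_growth R (F a)^`() 1 d ltac:(by move=> i h; rewrite addn1 -ltnS -sF;
    apply: leq_ltn_trans h _; apply: lt_size_deriv; rewrite -size_poly_eq0 sF).
  exists (A1 * A2 + A3 * A4); split; first by apply: addr_ge0; apply: mulr_ge0.
  move=> z z1.
  have -> : (F a).[z] * (F b)^`().[z] - (F b).[z] * (F a)^`().[z] =
    (F a).[z] * E^`().[z] - E.[z] * (F a)^`().[z].
    by rewrite FE derivD !hornerD; ring.
  have z0 := cmod_ge0 z.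
  apply: le_trans (_ : (cmod (F a).[z] * cmod E^`().[z] + cmod E.[z] * cmod (F a)^`().[z]) * cmod z ^+ 2 <= _).
    by apply: ler_wpM2r; [rewrite exprn_ge0 | apply: le_trans (cmodB _ _) _; rewrite !cmodM].
  have h1 := H1 z z1; have h2 := H2 z z1; have h3 := H3 z z1; have h4 := H4 z z1.
  rewrite expr0 mulr1 in h1.
  have -> : (cmod (F a).[z] * cmod E^`().[z] + cmod E.[z] * cmod (F a)^`().[z]) * cmod z ^+ 2 =
     cmod (F a).[z] * (cmod E^`().[z] * cmod z ^+ 2) +
     (cmod E.[z] * cmod z ^+ 1) * (cmod (F a)^`().[z] * cmod z ^+ 1) by ring.
  have -> : (A1 * A2 + A3 * A4) * (cmod z ^+ d) ^+ 2 =
     (A1 * cmod z ^+ d) * (A2 * cmod z ^+ d) + (A3 * cmod z ^+ d) * (A4 * cmod z ^+ d) by ring.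
  by apply: lerD; apply: ler_pM; rewrite ?mulr_ge0 ?exprn_ge0 ?cmod_ge0.
move=> /choice [A HA].
exists (\sum_a \sum_b A (a, b) ^+ 2).
  by apply: sumr_ge0 => a _; apply: sumr_ge0 => b _; rewrite sqr_ge0.
move=> z z1; rewrite /wedge !mulr_suml; apply: ler_sum => a _; rewrite !mulr_suml.
apply: ler_sum => b _; have [A0 /(_ z z1) h] := HA (a, b).
have -> : forall x : R, x ^+ 2 * cmod z ^+ 4 = (x * cmod z ^+ 2) ^+ 2 by move=> x; ring.
have -> : A (a, b) ^+ 2 * (cmod z ^+ d) ^+ 4 = (A (a, b) * (cmod z ^+ d) ^+ 2) ^+ 2 by ring.
apply: lerXn2r => //; rewrite nnegrE mulr_ge0 ?exprn_ge0 ?cmod_ge0 //.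
Qed.

Lemma in_square z (r : R) : cmod z <= r -> in_rect (-r) r (-r) r z.
Proof.
move=> zr; have := cmod_Re z; have := cmod_Im z; rewrite !ler_norml.
by move=> /andP[h1 h2] /andP[h3 h4]; split; apply/andP; split; lra.
Qed.

Lemma poly_lower F (r : R) : 0 < r -> cofree F ->
  exists2 m : R, 0 < m & forall z, cmod z <= r -> m ^+ 2 <= nsq (fun j => (F j).[z]).
Proof.
move=> r0 cF.
have [m m0 Hm] := @lower_bound R _ (fun j z => (F j).[z]) (-r) r (-r) r ltac:(lra) ltac:(lra)
  (fun w _ j => cdiff_cont (cdiff_horner _ _)) (fun w _ => cF w).
exists m => // z /in_square /Hm [j mj].
apply: le_trans (nsq_coord (fun j => (F j).[z]) j).
by apply: lerXn2r; rewrite ?nnegrE ?cmod_ge0 // ltW.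
Qed.

(** Far away, [wedge_far] gives a decay of order |z|^-4; on a disc the
    density is bounded because the coordinates have no common zero. *)
Lemma dens_kern F lam d : uniform F lam d -> cofree F ->
  exists2 B : R, 0 <= B & forall z, densF F z <= B * kernz z.
Proof.
move=> U cF; have [A A0 HA] := wedge_far U; have [r r1 Hr] := balanced_far U.
have r0 : 0 < r by lra.
have [m m0 Hm] := poly_lower r0 cF.
have l0 : 0 < cmod lam by rewrite cmod_gt0; case: U.
pose kap := (2 / 3 * cmod lam) ^+ 2.
have k0 : 0 < kap by rewrite exprn_gt0 // mulr_gt0.
pose M := \sum_j pnorm (2 * r) (F j).
have Mj j : pnorm (2 * r) (F j) <= M.
  by rewrite /M (bigD1 j) //= lerDl sumr_ge0 // => i _; apply: pnorm_ge0; lra.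
have M0 : 0 <= M by apply: le_trans (Mj ord0); apply: pnorm_ge0; lra.
pose V := \sum_(a < n.+1) \sum_(b < n.+1) (2 * (M * M)) ^+ 2.
have V0 : 0 <= V by apply: sumr_ge0 => a _; apply: sumr_ge0 => b _; rewrite sqr_ge0.
have wnear z : cmod z <= r -> wedge (fun j => (F j).[z]) (fun j => (F j)^`().[z]) <= V.
  move=> zr; apply: ler_sum => a _; apply: ler_sum => b _.
  have f0 j : cmod (F j).[z] <= M by apply: le_trans (Mj j); apply: pnorm_eval; lra.
  have f1 j : cmod (F j)^`().[z] <= M by apply: le_trans (Mj j); apply: pnorm_deriv.
  apply: lerXn2r; rewrite ?nnegrE ?cmod_ge0 ?mulr_ge0 //.
  apply: le_trans (cmodB _ _) _; rewrite !cmodM.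
  have : cmod (F a).[z] * cmod (F b)^`().[z] <= M * M by apply: ler_pM; rewrite ?cmod_ge0.
  have : cmod (F b).[z] * cmod (F a)^`().[z] <= M * M by apply: ler_pM; rewrite ?cmod_ge0.
  lra.
have m40 : 0 < (m ^+ 2) ^+ 2 by rewrite !exprn_gt0.
pose B2 := V / (m ^+ 2) ^+ 2 * (1 + r ^+ 2) ^+ 2.
have B20 : 0 <= B2 by rewrite mulr_ge0 ?sqr_ge0 // divr_ge0 // ltW.
pose B1 := 4 * A / kap ^+ 2.
have B10 : 0 <= B1 by rewrite divr_ge0 ?mulr_ge0 // ?exprn_ge0 // ltW.
exists (B1 + B2); first exact: addr_ge0.
move=> z; have kz := kernz_gt0 z; have kl := kernz_lower z.
have z0 := cmod_ge0 z.
(* B2 serves on the disc where F is not yet balanced, B1 outside. *)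
have [zr|rz] := leP (cmod z) r.
  apply: le_trans (_ : B2 * kernz z <= _); last by apply: ler_wpM2r; [exact: ltW | lra].
  apply: le_trans (_ : V / (m ^+ 2) ^+ 2 <= _).
    apply: ler_pM; rewrite ?wedge_ge0 ?invr_ge0 ?exprn_ge0 ?nsq_ge0 ?wnear //.
    rewrite lef_pV2 ?posrE //; last first.
      by rewrite exprn_gt0 //; apply: lt_le_trans (Hm z zr); rewrite exprn_gt0.
    by apply: lerXn2r; rewrite ?nnegrE ?nsq_ge0 ?sqr_ge0 ?Hm.
  rewrite /B2 -mulrA ler_peMr ?divr_ge0 ?(ltW m40) //.
  have t0 : 0 < (1 + r ^+ 2) ^+ 2 by rewrite exprn_gt0 // ltr_pwDl // sqr_ge0.
  rewrite -ler_pdivrMl // mulr1; apply: le_trans kl.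
  rewrite lef_pV2 ?posrE ?exprn_gt0 ?ltr_pwDl ?sqr_ge0 //.
  apply: lerXn2r; rewrite ?nnegrE ?addr_ge0 ?sqr_ge0 // lerD2l.
  by apply: lerXn2r; rewrite ?nnegrE // ltW.
apply: le_trans (_ : B1 * kernz z <= _); last by apply: ler_wpM2r; [exact: ltW | lra].
have z1 : 1 <= cmod z by lra.
have zp : 0 < cmod z by lra.
have := HA z z1; set Z := cmod z ^+ d; set W := wedge _ _ => hW.
have Z0 : 0 < Z by rewrite exprn_gt0.
have nz : kap * Z ^+ 2 <= nsq (fun j => (F j).[z]).
  apply: le_trans (nsq_coord (fun j => (F j).[z]) ord0).
  have /andP[h _] := Hr z (ltW rz) ord0.
  have -> : kap * Z ^+ 2 = (2 / 3 * (cmod lam * Z)) ^+ 2 by rewrite /kap; ring.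
  by apply: lerXn2r; rewrite ?nnegrE ?cmod_ge0 // !mulr_ge0 ?(ltW Z0) ?(ltW l0) // divr_ge0.
have z40 : 0 < cmod z ^+ 4 by rewrite exprn_gt0.
have kz20 : 0 < kap * Z ^+ 2 by rewrite mulr_gt0 // exprn_gt0.
have W0 : 0 <= W by exact: wedge_ge0.
have Wle : W <= A * Z ^+ 4 / cmod z ^+ 4 by rewrite ler_pdivlMr.
apply: le_trans (_ : (A * Z ^+ 4 / cmod z ^+ 4) / (kap * Z ^+ 2) ^+ 2 <= _).
  apply: ler_pM; rewrite ?invr_ge0 ?exprn_ge0 ?nsq_ge0 //.
  rewrite lef_pV2 ?posrE ?exprn_gt0 //; last exact: lt_le_trans nz.
  by apply: lerXn2r; rewrite ?nnegrE ?nsq_ge0 // ltW.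
have -> : (A * Z ^+ 4 / cmod z ^+ 4) / (kap * Z ^+ 2) ^+ 2 = B1 * (4 * cmod z ^+ 4)^-1.
  by rewrite /B1; field; rewrite !gt_eqF.
apply: ler_wpM2l => //; apply: le_trans kl.
rewrite lef_pV2 ?posrE ?exprn_gt0 ?mulr_gt0 ?ltr_pwDl ?sqr_ge0 //.
have -> : 4 * cmod z ^+ 4 = (2 * cmod z ^+ 2) ^+ 2 by ring.
apply: lerXn2r; rewrite ?nnegrE ?addr_ge0 ?mulr_ge0 ?sqr_ge0 //.
have : 1 <= cmod z ^+ 2 by rewrite exprn_ege1.
lra.
Qed.

Lemma dens_ext (I : finType) (u u' v v' : I -> R[i]) : u =1 u' -> v =1 v' -> dens u v = dens u' v'.
Proof.
move=> E1 E2; congr (_ / _ ^+ 2); last by apply: eq_bigr => j _; rewrite E1.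
by apply: eq_bigr => a _; apply: eq_bigr => b _; rewrite !E1 !E2.
Qed.

Lemma dens_scale (I : finType) c (u v : I -> R[i]) : c != 0 ->
  dens (fun j => u j * c) (fun j => v j * c) = dens u v.
Proof.
move=> c0; have cp : 0 < cmod c by rewrite cmod_gt0.
have e1 : wedge (fun j => u j * c) (fun j => v j * c) = cmod c ^+ 4 * wedge u v.
  rewrite /wedge mulr_sumr; apply: eq_bigr => a _; rewrite mulr_sumr; apply: eq_bigr => b _.
  have -> : u a * c * (v b * c) - u b * c * (v a * c) = (u a * v b - u b * v a) * (c * c) by ring.
  by rewrite !cmodM; ring.
have e2 : nsq (fun j => u j * c) = cmod c ^+ 2 * nsq u.
  by rewrite /nsq mulr_sumr; apply: eq_bigr => a _; rewrite cmodM exprMn mulrC.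
rewrite /dens e1 e2; have [->|h] := eqVneq (nsq u) 0.
  by rewrite mulr0 !expr0n /= invr0 !mulr0.
by field; rewrite h gt_eqF.
Qed.

Lemma unit_shift_deriv a d (P : {poly R[i]}) z : (unit_shift a d P)^`().[z] = P^`().[z - a] / (- a) ^+ d.
Proof.
rewrite /unit_shift derivZ deriv_comp derivXsubC mulr1 hornerZ horner_comp hornerXsubC.
by rewrite mulrC.
Qed.

Definition glue F p a d : 'I_n.+1 -> {poly R[i]} := fun j => F j * unit_shift a d (p j).

Lemma glue_uniform F lam D p a d : uniform F lam D -> uniform p 1 d -> a != 0 ->
  uniform (glue F p a d) (lam / (- a) ^+ d) (D + d).
Proof.
move=> [l0 UF] [_ Up] a0; have ad : (- a) ^+ d != 0 by rewrite expf_neq0 // oppr_eq0.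
split; first by rewrite mulf_neq0 // invr_eq0.
move=> j; have [sF lF] := UF j; have [sp lp] := Up j.
have st : size (unit_shift a d (p j)) = d.+1.
  by rewrite size_scale ?invr_eq0 // size_comp_poly2 ?size_XsubC.
have Fn0 : F j != 0 by rewrite -size_poly_eq0 sF.
have tn0 : unit_shift a d (p j) != 0 by rewrite -size_poly_eq0 st.
split; first by rewrite size_mul // sF st addSn addnS.
rewrite lead_coefM lF lead_coefZ lead_coef_comp ?size_XsubC //.
by rewrite lp lead_coefXsubC expr1n !mulr1.
Qed.

Definition Kprod : R := 32 * n.+1%:R ^+ 2.

Lemma Kprod_gt0 : 0 < Kprod.
Proof. by rewrite mulr_gt0 // exprn_gt0 // ltr0n. Qed.

(** If |a| is at least r1 + r2, each point is at distance at least r1 from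
    0 or at least r2 from [a]; in the first case [F] is balanced, in the second
    one the translate of [p] is, and [dens_prod] applies either way. *)
Lemma glue_dens F lam D p d : uniform F lam D -> cofree F -> uniform p 1 d -> cofree p ->
  exists2 A : R, 1 <= A & forall a, A <= cmod a ->
    cofree (glue F p a d) /\
    forall z, densF (glue F p a d) z <= Kprod * (densF F z + densF p (z - a)).
Proof.
move=> UF cF Up cp.
have [r1 r11 H1] := balanced_far UF; have [r2 r21 H2] := balanced_far Up.
exists (r1 + r2); first by lra.
move=> a Aa; have a0 : 0 < cmod a by lra.
have ac : (- a) ^+ d != 0 by rewrite expf_neq0 // oppr_eq0 -cmod_gt0.
have ac' : ((- a) ^+ d)^-1 != 0 by rewrite invr_eq0.
have dens_p z : densF p (z - a) = dens (fun j => (unit_shift a d (p j)).[z]) (fun j => (unit_shift a d (p j))^`().[z]).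
  rewrite /densF -(dens_scale _ _ ac'); apply: dens_ext => j; [exact/esym/unit_shift_eval|exact/esym/unit_shift_deriv].
have der z j : (glue F p a d j)^`().[z] =
    (F j)^`().[z] * (unit_shift a d (p j)).[z] + (F j).[z] * (unit_shift a d (p j))^`().[z].
  by rewrite /glue derivM hornerD !hornerM.
have evl z j : (glue F p a d j).[z] = (F j).[z] * (unit_shift a d (p j)).[z] by rewrite hornerM.
have l0 : 0 < cmod lam by rewrite cmod_gt0; case: UF.
have key z : (exists j, (glue F p a d j).[z] != 0) /\
    densF (glue F p a d) z <= Kprod * (densF F z + densF p (z - a)).
  (* Far from 0, F is the balanced factor; otherwise z is far from a, and
     the translate of p is. *)
  have [zr|zr] := leP r1 (cmod z).
    have m0 : 0 < 2 / 3 * (cmod lam * cmod z ^+ D).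
      by rewrite mulr_gt0 ?divr_gt0 // mulr_gt0 // exprn_gt0 //; lra.
    have [j pj] := cp (z - a).
    have tj : (unit_shift a d (p j)).[z] != 0 by rewrite unit_shift_eval mulf_neq0.
    split.
      exists j; rewrite evl mulf_neq0 // -cmod_gt0.
      by have /andP[h _] := H1 z zr j; apply: lt_le_trans h.
    rewrite dens_p; have := @dens_prod R _ (fun j => (F j).[z]) (fun j => (F j)^`().[z])
      (fun j => (unit_shift a d (p j)).[z]) (fun j => (unit_shift a d (p j))^`().[z])
      _ m0 (H1 z zr) (ex_intro _ j tj).
    rewrite card_ord -/Kprod; apply: le_trans.
    by rewrite le_eqVlt; apply/orP; left; apply/eqP; apply: dens_ext => i; rewrite ?evl ?der.
  have za : r2 <= cmod (z - a).
    by have := cmodD (a - z) z; rewrite subrK cmodC; lra.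
  pose m := 2 / 3 * (cmod 1 * cmod (z - a) ^+ d) / cmod ((- a) ^+ d).
  have m0 : 0 < m.
    rewrite /m cmod1 mul1r; rewrite divr_gt0 ?mulr_gt0 ?exprn_gt0 ?divr_gt0 //; first lra.
    by rewrite cmod_gt0.
  have tb j : m <= cmod (unit_shift a d (p j)).[z] <= 2 * m.
    have /andP[h1 h2] := H2 _ za j.
    rewrite unit_shift_eval cmodf /m mulrA; apply/andP; split.
      by apply: ler_wpM2r; rewrite ?invr_ge0 ?cmod_ge0.
    by apply: ler_wpM2r; rewrite ?invr_ge0 ?cmod_ge0.
  have [j Fj] := cF z.
  split.
    exists j; rewrite evl mulf_neq0 // -cmod_gt0.
    by have /andP[h _] := tb j; apply: lt_le_trans h.
  rewrite dens_p; have := @dens_prod R _ (fun j => (unit_shift a d (p j)).[z])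
    (fun j => (unit_shift a d (p j))^`().[z]) (fun j => (F j).[z]) (fun j => (F j)^`().[z])
    _ m0 tb (ex_intro _ j Fj).
  rewrite card_ord -/Kprod addrC; apply: le_trans.
  rewrite le_eqVlt; apply/orP; left; apply/eqP; apply: dens_ext => i; rewrite ?evl ?der.
    by rewrite mulrC.
  by ring.
by split=> [z|z]; case: (key z).
Qed.

(** A list of weights and real centres describing a sum of translated
    kernels above the density of [F]; the sum of the weights controls the
    area, whatever the centres are. *)
Definition maj F (L : seq (R * R)) :=
  (forall l, l \in L -> 0 <= l.1) /\
  forall z, densF F z <= \sum_(l <- L) l.1 * kernz (z - l.2%:C).

Lemma glue_maj F L p (B a : R) d : maj F L -> 0 <= B ->
  (forall z, densF p z <= B * kernz z) ->
  (forall z, densF (glue F p a%:C d) z <= Kprod * (densF F z + densF p (z - a%:C))) ->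
  maj (glue F p a%:C d) (rcons [seq (Kprod * l.1, l.2) | l <- L] (Kprod * B, a)).
Proof.
move=> [L0 HL] B0 HB H; have K0 := ltW Kprod_gt0; split.
  move=> l; rewrite mem_rcons inE => /orP[/eqP ->|/mapP[l' /L0 h ->]] /=; exact: mulr_ge0.
move=> z; rewrite -cats1 big_cat big_seq1 big_map /=.
apply: le_trans (H z) _; rewrite mulrDr; apply: lerD.
  have -> : \sum_(j <- L) Kprod * j.1 * kernz (z - j.2%:C) = Kprod * \sum_(l <- L) l.1 * kernz (z - l.2%:C).
    by rewrite mulr_sumr; apply: eq_bigr => l _; rewrite mulrA.
  exact: ler_wpM2l.
by rewrite -mulrA; apply: ler_wpM2l.
Qed.

(** The density depends continuously on the coordinates and on their
    derivatives.  This is what lets the bound on the area of each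
    polynomial curve pass to the limit curve on a disc. *)
Lemma stability F (T eta : R) : 1 <= T -> cofree F -> 0 < eta ->
  exists2 delta : R, 0 < delta & forall z, cmod z <= T ->
    forall H H' : 'I_n.+1 -> R[i],
    (forall j, cmod (H j - (F j).[z]) <= delta /\ cmod (H' j - (F j)^`().[z]) <= delta) ->
    (exists j, H j != 0) /\ dens H H' <= 32 * densF F z + eta.
Proof.
move=> T1 cF eta0; have T0 : 0 < T by lra.
have [m m0 Hm] := poly_lower T0 cF.
pose M := 1 + \sum_j pnorm (2 * T) (F j).
have Mj j : pnorm (2 * T) (F j) <= M - 1.
  rewrite /M (bigD1 j) //= [1 + _]addrC addrK lerDl sumr_ge0 // => i _; apply: pnorm_ge0; lra.
have p0 : 0 <= pnorm (2 * T) (F ord0) by apply: pnorm_ge0; lra.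
have M1 : 1 <= M by have := Mj ord0; lra.
pose N : R := n.+1%:R.
have N1 : 1 <= N by rewrite ler1n.
have N0 : 0 < N by lra.
have m20 : 0 < m ^+ 2 by rewrite exprn_gt0.
have m40 : 0 < (m ^+ 2) ^+ 2 by rewrite exprn_gt0.
(* 72 N^2 M^2 delta is the error on the wedge, with M a bound for all the
   values and derivatives; the factor 16 comes from |H|^2 >= |f|^2 / 4. *)
pose c := 72 * 16 * N ^+ 2 * M ^+ 2.
have c0 : 0 < c.
  by apply: mulr_gt0; [apply: mulr_gt0; [exact: mulr_gt0|exact: exprn_gt0]|apply: exprn_gt0; lra].
pose delta := Num.min 1 (Num.min (m ^+ 2 / (4 * N)) (eta * (m ^+ 2) ^+ 2 / c)).
have d0 : 0 < delta.
  by rewrite !lt_min ltr01 /=; apply/andP; split; apply: divr_gt0 => //; apply: mulr_gt0.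
have d1 : delta <= 1 by rewrite ge_min lexx.
have d2 : delta ^+ 2 <= delta by rewrite expr2 ler_piMr // ltW.
have dm : delta * (4 * N) <= m ^+ 2.
  have N4 : 0 < 4 * N by apply: mulr_gt0.
  by rewrite -ler_pdivlMr // /delta !ge_min lexx !orbT.
have de : delta * c <= eta * (m ^+ 2) ^+ 2.
  by rewrite -ler_pdivlMr // /delta !ge_min lexx !orbT.
exists delta => // z zT H H' HH.
have F0 j : cmod (F j).[z] <= M - 1 by apply: le_trans (Mj j); apply: pnorm_eval; lra.
have F1 j : cmod (F j)^`().[z] <= M - 1 by apply: le_trans (Mj j); apply: pnorm_deriv.
set f := fun j => (F j).[z] in HH F0; set f' := fun j => (F j)^`().[z] in HH F1.
have nf : m ^+ 2 <= nsq f := Hm z zT.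
have nf0 : 0 < nsq f by apply: lt_le_trans nf.
have nH : nsq f <= 4 * nsq H.
  have : nsq f <= 2 * nsq H + N * (2 * delta ^+ 2).
    have -> : N * (2 * delta ^+ 2) = \sum_(j < n.+1) 2 * delta ^+ 2.
      by rewrite sumr_const card_ord -[RHS]mulr_natl.
    rewrite /nsq mulr_sumr -big_split /=; apply: ler_sum => j _.
    have -> : f j = H j + (- (H j - f j)) by ring.
    apply: le_trans (cmodD_sqr _ _) _; rewrite lerD2l ler_pM2l // cmodN.
    apply: lerXn2r; rewrite ?nnegrE ?cmod_ge0 ?(ltW d0) //; by case: (HH j).
  have : N * (2 * delta ^+ 2) <= N * (2 * delta) by apply: ler_wpM2l; [exact: ltW|lra].
  lra.
have nH0 : 0 < nsq H by lra.
split.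
  apply: contrapT => nex; move: nH0; rewrite /nsq big1 ?ltxx // => j _.
  have [->|h] := eqVneq (H j) 0; first by rewrite cmod0 expr0n.
  by case: nex; exists j.
have wH : wedge H H' <= 2 * wedge f f' + 72 * N ^+ 2 * M ^+ 2 * delta.
  have -> : 72 * N ^+ 2 * M ^+ 2 * delta = \sum_(a < n.+1) \sum_(b < n.+1) 72 * M ^+ 2 * delta.
    rewrite (eq_bigr (fun=> N * (72 * M ^+ 2 * delta))); last first.
      by move=> a _; rewrite sumr_const card_ord -[LHS]mulr_natl.
    by rewrite sumr_const card_ord -mulr_natl -/N; ring.
  rewrite /wedge mulr_sumr -big_split /=; apply: ler_sum => a _.
  rewrite mulr_sumr -big_split /=; apply: ler_sum => b _.
  set W := f a * f' b - f b * f' a.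
  have E : H a * H' b - H b * H' a = W + (H a * H' b - H b * H' a - W) by ring.
  rewrite E; apply: le_trans (cmodD_sqr _ _) _; rewrite lerD2l.
  have e a' b' : cmod (H a' * H' b' - f a' * f' b') <= 3 * M * delta.
    have -> : H a' * H' b' - f a' * f' b' =
      (H a' - f a') * (f' b' + (H' b' - f' b')) + f a' * (H' b' - f' b') by ring.
    apply: le_trans (cmodD _ _) _; rewrite !cmodM.
    have [h1 _] := HH a'; have [_ h2] := HH b'.
    have h3 := cmodD (f' b') (H' b' - f' b').
    have h4 : cmod (f' b' + (H' b' - f' b')) <= M by have := F1 b'; lra.
    have h5 : cmod (f a') <= M by have := F0 a'; lra.
    have : cmod (H a' - f a') * cmod (f' b' + (H' b' - f' b')) <= delta * M.
      by apply: ler_pM; rewrite ?cmod_ge0.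
    have : cmod (f a') * cmod (H' b' - f' b') <= M * delta by apply: ler_pM; rewrite ?cmod_ge0.
    have : 0 <= M * delta by rewrite mulr_ge0 ?(ltW d0) //; lra.
    lra.
  have e6 : cmod (H a * H' b - H b * H' a - W) <= 6 * M * delta.
    have -> : H a * H' b - H b * H' a - W =
      (H a * H' b - f a * f' b) - (H b * H' a - f b * f' a) by rewrite /W; ring.
    by apply: le_trans (cmodB _ _) _; have := e a b; have := e b a; lra.
  have : cmod (H a * H' b - H b * H' a - W) ^+ 2 <= (6 * M * delta) ^+ 2.
    by apply: lerXn2r; rewrite ?nnegrE ?cmod_ge0 // !mulr_ge0 ?(ltW d0) //; lra.
  have -> : (6 * M * delta) ^+ 2 = 36 * (M ^+ 2 * delta ^+ 2) by ring.
  have : M ^+ 2 * delta ^+ 2 <= M ^+ 2 * delta by apply: ler_wpM2l => //; rewrite sqr_ge0.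
  lra.
rewrite /dens; apply: le_trans (_ : (2 * wedge f f' + 72 * N ^+ 2 * M ^+ 2 * delta) / (nsq f / 4) ^+ 2 <= _).
  apply: ler_pM; rewrite ?wedge_ge0 ?invr_ge0 ?exprn_ge0 ?nsq_ge0 //.
  rewrite lef_pV2 ?posrE ?exprn_gt0 ?divr_gt0 //.
  by apply: lerXn2r; rewrite ?nnegrE ?divr_ge0 ?nsq_ge0 //; lra.
have -> : (2 * wedge f f' + 72 * N ^+ 2 * M ^+ 2 * delta) / (nsq f / 4) ^+ 2 =
  32 * (wedge f f' / nsq f ^+ 2) + (delta * c) / nsq f ^+ 2.
  by rewrite /c; field; rewrite gt_eqF.
rewrite -/(dens f f') -/(densF F z) lerD2l ler_pdivrMr ?exprn_gt0 //.
apply: le_trans de _; apply: ler_wpM2l; first exact: ltW.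
by apply: lerXn2r; rewrite ?nnegrE ?(ltW m20) ?(ltW nf0).
Qed.

End Glue.

(** * Areas and the characteristic function *)

Section Area.
Set Implicit Arguments.
Unset Strict Implicit.
Unset Printing Implicit Defensive.
Local Open Scope complex_scope.
Variable R : realType.
Local Notation mu := (@lebesgue_measure R).
Local Notation mu2 := (mu \x mu)%E.

(** The integral is a difference of two suprema over simple functions, so it
    is monotone on arbitrary functions.  The pullback density, defined with
    charts that vary with the point, is thus compared directly to measurable
    majorants. *)
Lemma le_integral_pointwise d (T : measurableType d) (m : {measure set T -> \bar R})
  (D : set T) (f g : T -> \bar R) : (forall x, D x -> (f x <= g x)%E) ->
  (integral m D f <= integral m D g)%E.
Proof.
move=> fg; have fg' x : ((f \_ D) x <= (g \_ D) x)%E.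
  by rewrite /patch; case: ifPn => //; rewrite inE => /fg.
rewrite /integral; apply: leeB; apply: le_ereal_sup => _ [h /= H <-]; exists h => // x /=.
  by apply: le_trans (H x) _; rewrite !funeposE ge_max !le_max fg' lexx orbT.
by apply: le_trans (H x) _; rewrite !funenegE ge_max !le_max leeN2 fg' lexx orbT.
Qed.

Lemma FTC_E (f F : R -> R) a b : a < b -> {within `[a, b], continuous f} ->
  (forall t, a <= t <= b -> derivable F t 1 /\ derive1 F t = f t) ->
  (\int[mu]_(x in `[a, b]) (f x)%:E = (F b - F a)%:E)%E.
Proof.
move=> ab cf dF.
have Cn t : a <= t <= b -> F x @[x --> t] --> F t.
  by move=> /dF [D _]; move: D => /derivable1_diffP /differentiable_continuous.
have ab' := ltW ab.
rewrite (@continuous_FTC2 R f F a b ab) // ?EFinB //.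
  split => [t||].
  + rewrite in_itv /= => /andP[h1 h2].
    have tab : a <= t <= b by lra.
    by have [] := dF t tab.
  + by apply: cvg_at_right_filter; apply: Cn; rewrite lexx.
  + by apply: cvg_at_left_filter; apply: Cn; rewrite lexx andbT.
move=> t; rewrite in_itv /= => /andP[h1 h2].
have tab : a <= t <= b by lra.
by have [_] := dF _ tab.
Qed.

(** The integral of c / t over [1, r] is c ln r. *)
Lemma nevanlinna_le n (h : Cplx R -> CP R n) (r c : R) : 1 <= r -> 0 <= c ->
  (forall t, 1 <= t -> t <= r ->
    (\int[mu2]_(z in [set z : R * R | (z.1 ^+ 2 + z.2 ^+ 2 < t ^+ 2)%R])
       (FS_pullback h (z.1 +i* z.2))%:E <= c%:E)%E) ->
  (nevanlinna h r <= (c * ln r)%:E)%E.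
Proof.
move=> r1 c0 H; rewrite /nevanlinna.
apply: (@le_trans _ _ (\int[mu]_(t in `[1%R, r]) (t^-1 * c)%:E)%E).
  apply: le_integral_pointwise => t /=; rewrite in_itv /= => /andP[t1 tr].
  by rewrite EFinM; apply: lee_wpmul2l; [rewrite lee_fin invr_ge0; lra | exact: H].
move: r1; rewrite le_eqVlt => /orP[/eqP <-|r1].
  by rewrite set_itv1 integral_set1 ln1 mulr0.
rewrite (@FTC_E (fun t => t^-1 * c) (fun t => c * ln t) 1 r r1).
- by rewrite ln1 mulr0 subr0.
- apply: continuous_in_subspaceT => t; rewrite inE /= in_itv /= => /andP[t1 _].
  apply: cvgM; last exact: cvg_cst.
  by apply: cvgV => //; rewrite gt_eqF //; lra.
- move=> t /andP[t1 _].
  have D : is_derive t (1 : R) (@ln R) t^-1 by apply: is_derive1_ln; lra.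
  have [D1 D2] := @is_deriveZ _ _ _ (@ln R) c t 1 _ D.
  by split => //; rewrite derive1E mulrC.
Qed.

(** A majorant whose integral is under control; the condition is stable under
    nonnegative linear combinations. *)
Definition mass_le (G : R * R -> R) (c : R) := [/\ measurable_fun setT G,
  forall z, 0 <= G z & (\int[mu2]_z (G z)%:E <= c%:E)%E].

Lemma mass_leD G1 G2 c1 c2 : mass_le G1 c1 -> mass_le G2 c2 ->
  mass_le (fun z => G1 z + G2 z) (c1 + c2).
Proof.
move=> [m1 p1 i1] [m2 p2 i2]; split.
- exact: measurable_funD.
- by move=> z; rewrite addr_ge0.
change (\int[mu2]_z ((G1 z)%:E + (G2 z)%:E) <= (c1 + c2)%:E)%E.
rewrite ge0_integralD //; first by rewrite EFinD leeD.
- by move=> z _; rewrite lee_fin.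
- exact/measurable_EFinP.
- by move=> z _; rewrite lee_fin.
- exact/measurable_EFinP.
Qed.

Lemma mass_leZ G c k : 0 <= k -> mass_le G c -> mass_le (fun z => k * G z) (k * c).
Proof.
move=> k0 [m p i]; split.
- exact: measurable_funM.
- by move=> z; rewrite mulr_ge0.
change (\int[mu2]_z (k%:E * (G z)%:E) <= (k * c)%:E)%E.
rewrite ge0_integralZl //; first by rewrite EFinM lee_wpmul2l.
- exact/measurable_EFinP.
- by move=> z _; rewrite lee_fin.
Qed.

Lemma mass_le_prod (U V : R -> R) (A B : R) : measurable_fun setT U -> measurable_fun setT V ->
  (forall x, 0 <= U x) -> (forall x, 0 <= V x) -> 0 <= A ->
  (\int[mu]_x (U x)%:E <= A%:E)%E -> (\int[mu]_x (V x)%:E <= B%:E)%E ->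
  mass_le (fun z => U z.1 * V z.2) (A * B).
Proof.
move=> mU mV U0 V0 A0 IU IV.
have mG : measurable_fun setT (fun z : R * R => U z.1 * V z.2).
  apply: measurable_funM; first exact: measurableT_comp mU measurable_fst.
  exact: measurableT_comp mV measurable_snd.
split => //; first by move=> z; rewrite mulr_ge0.
rewrite fubini_tonelli1; last 2 first.
- exact/measurable_EFinP.
- by move=> z; rewrite lee_fin mulr_ge0.
rewrite /fubini_F /=.
have mV' : measurable_fun setT (fun y => (V y)%:E) by exact/measurable_EFinP.
have E x : (\int[mu]_y (U x * V y)%:E = (U x)%:E * \int[mu]_y (V y)%:E)%E.
  change (\int[mu]_y ((U x)%:E * (V y)%:E) = (U x)%:E * \int[mu]_y (V y)%:E)%E.
  by rewrite ge0_integralZl // ?lee_fin // => y _; rewrite lee_fin.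
have -> : (\int[mu]_x \int[mu]_y (U x * V y)%:E = \int[mu]_x ((U x)%:E * \int[mu]_y (V y)%:E))%E.
  by apply: eq_integral => x _; exact: E.
have IV0 : (0 <= \int[mu]_y (V y)%:E)%E by apply: integral_ge0 => y _; rewrite lee_fin.
rewrite ge0_integralZr //; last 2 first.
- exact/measurable_EFinP.
- by move=> x _; rewrite lee_fin.
rewrite EFinM; apply: lee_pmul => //.
by apply: integral_ge0 => y _; rewrite lee_fin.
Qed.

Definition cauchy_dens (a x : R) : R := (1 + (x - a) ^+ 2)^-1.

Lemma cauchy_dens_ge0 a x : 0 <= cauchy_dens a x.
Proof. by rewrite invr_ge0 addr_ge0 // sqr_ge0. Qed.

Lemma cauchy_dens_cont a : continuous (cauchy_dens a).
Proof.
move=> x; apply: cvgV.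
  by rewrite gt_eqF // ltr_pwDl // sqr_ge0.
apply: cvgD; first exact: cvg_cst.
by apply: (@cvgM _ _ _ _ (fun x => x - a) (fun x => x - a)); apply: cvgB; [exact: cvg_id|exact: cvg_cst|exact: cvg_id|exact: cvg_cst].
Qed.

(** Restriction to a square makes all integrals proper; the bounds do not
    depend on [r] for the Cauchy densities. *)
Definition cut (r : R) (f : R -> R) : R -> R := f \_ `[-r, r].

Lemma restr_measurable (f : R -> R) (r : R) : measurable_fun setT f ->
  measurable_fun setT (cut r f).
Proof.
move=> mf; apply/(measurable_restrictT _ _).1 => //.
exact: measurable_funTS.
Qed.

Lemma restr_int (f : R -> R) (r : R) :
  (\int[mu]_x ((cut r f) x)%:E = \int[mu]_(x in `[(-r)%R, r]) (f x)%:E)%E.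
Proof.
rewrite [RHS]integral_mkcond; apply: eq_integral => x _.
by rewrite /cut /patch; case: ifP.
Qed.

(** A primitive is an arctangent, whose variation is at most pi. *)
Lemma cauchy_mass a r : 0 < r ->
  (\int[mu]_x ((cut r (cauchy_dens a)) x)%:E <= pi%:E)%E.
Proof.
move=> r0; rewrite restr_int.
have rr : -r < r by rewrite -subr_gt0 opprK addr_gt0.
rewrite (@FTC_E (cauchy_dens a) (fun x => atan (x - a)) _ _ rr).
- rewrite lee_fin; have := atan_ltpi2 (r - a); have := atan_gtNpi2 (- r - a); lra.
- by apply: continuous_subspaceT => x; exact: cauchy_dens_cont.
- move=> t _.
  have D1 : is_derive t (1 : R) (fun x => x - a) 1.
    apply: rdiff_is_derive => e e0; exists 1 => // s _.
    have -> : t + s - a - (t - a) - 1 * s = 0 by ring.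
    by rewrite normr0 mulr_ge0 // ltW.
  have D2 := is_derive1_atan (t - a).
  have [D3 D4] := @is_derive1_comp R (@atan R) (fun x => x - a) t _ _ D2 D1.
  by split => //; rewrite derive1E; apply: etrans D4 _; rewrite mulr1.
Qed.

Lemma kernz_prod (a x y : R) : kernz ((x +i* y) - a%:C) = cauchy_dens a x * cauchy_dens 0 y.
Proof. by rewrite /kernz /cauchy_dens subr0 invfM ReB ImB /= subr0. Qed.

Lemma mass_kern (a r : R) : 0 < r ->
  mass_le (fun z => (cut r (cauchy_dens a)) z.1 * (cut r (cauchy_dens 0)) z.2) (pi * pi).
Proof.
move=> r0.
have mf b : measurable_fun setT (cut r (cauchy_dens b)).
  by apply: restr_measurable; apply: continuous_measurable_fun; exact: cauchy_dens_cont.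
have p b x : 0 <= (cut r (cauchy_dens b)) x.
  by rewrite /cut /patch; case: ifP => // _; exact: cauchy_dens_ge0.
apply: mass_le_prod => //; [exact: pi_ge0|exact: cauchy_mass|exact: cauchy_mass].
Qed.

Lemma mass_square (r : R) : 0 < r ->
  mass_le (fun z => (cut r (cst 1)) z.1 * (cut r (cst 1)) z.2)
    ((2 * r) * (2 * r)).
Proof.
move=> r0.
have mf : measurable_fun setT (cut r (cst 1)) by apply: restr_measurable.
have p x : 0 <= (cut r (cst 1)) x by rewrite /cut /patch; case: ifP.
have I : (\int[mu]_x ((cut r (cst 1)) x)%:E <= (2 * r)%:E)%E.
  rewrite restr_int.
  change (\int[mu]_(x in `[(-r)%R, r]) (cst 1%:E x) <= (2 * r)%:E)%E.
  rewrite integral_cst //= mul1e lebesgue_measure_itv /= lte_fin.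
  case: ifP => _; last by rewrite lee_fin mulr_ge0 // ltW.
  by rewrite -EFinD lee_fin opprK; lra.
by apply: mass_le_prod => //; rewrite mulr_ge0 // ltW.
Qed.

Lemma disc_bounds (r x y : R) : 0 < r -> x ^+ 2 + y ^+ 2 < r ^+ 2 ->
  x \in `[-r, r] /\ y \in `[-r, r].
Proof.
move=> r0 h; rewrite !in_itv /=.
by split; apply/andP; split; nra.
Qed.

(** The bound on the sum of kernels does not depend on the centres nor on
    the radius; the error [eta] is multiplied by the area of the square
    around the disc. *)
Lemma area_bound (f : R * R -> R) (L : seq (R * R)) (r k eta : R) : 0 < r -> 0 <= k -> 0 <= eta ->
  (forall l, l \in L -> 0 <= l.1) ->
  (forall x y, x ^+ 2 + y ^+ 2 < r ^+ 2 ->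
    f (x, y) <= k * (\sum_(l <- L) l.1 * kernz ((x +i* y) - l.2%:C)) + eta) ->
  (\int[mu2]_(z in [set z : R * R | (z.1 ^+ 2 + z.2 ^+ 2 < r ^+ 2)%R]) (f z)%:E <=
    (k * ((\sum_(l <- L) l.1) * (pi * pi)) + eta * (4 * r ^+ 2))%:E)%E.
Proof.
move=> r0 k0 eta0 L0 Hf.
(* The kernels and the constant eta are cut to the square circumscribed to
   the disc, which does not change them on the disc. *)
pose Kr a (z : R * R) := (cut r (cauchy_dens a)) z.1 * (cut r (cauchy_dens 0)) z.2.
pose Q (z : R * R) := (cut r (cst 1)) z.1 * (cut r (cst 1)) z.2.
have ML : mass_le (fun z => \sum_(l <- L) l.1 * Kr l.2 z) ((\sum_(l <- L) l.1) * (pi * pi)).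
  elim: L L0 {Hf} => [|l L IH] L0.
    rewrite big_nil mul0r.
    have -> : (fun z => \sum_(l <- [::]) l.1 * Kr l.2 z) = cst 0.
      by apply/funext => z; rewrite big_nil.
    split => //; have -> // : (\int[mu2]_z (cst 0 z : R)%:E = 0)%E.
    by apply: integral0_eq.
  have h1 := mass_leZ (L0 l (mem_head _ _)) (mass_kern l.2 r0).
  have h2 := IH (fun x xL => L0 x (mem_behead (s := l :: L) xL)).
  have E : (fun z => \sum_(j <- l :: L) j.1 * Kr j.2 z) =
    (fun z => l.1 * Kr l.2 z + \sum_(j <- L) j.1 * Kr j.2 z).
    by apply/funext => z; rewrite big_cons.
  by rewrite E big_cons mulrDl; exact: mass_leD.
have [mG pG iG] := mass_leD (mass_leZ k0 ML) (mass_leZ eta0 (mass_square r0)).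
have -> : 4 * r ^+ 2 = 2 * r * (2 * r) by ring.
apply: le_trans iG; rewrite integral_mkcond; apply: le_integral_pointwise => -[x y] _.
rewrite {1}/patch; case: ifPn; last by move=> _; rewrite lee_fin; exact: (pG (x, y)).
rewrite inE /= => hr; rewrite lee_fin; apply: le_trans (Hf x y hr) _.
have [hx hy] := disc_bounds r0 hr.
have px (g : R -> R) t : t \in `[-r, r] -> (cut r g) t = g t.
  by move=> ht; rewrite /cut /patch ifT // inE.
rewrite !px // !mulr1 lerD2r; apply: ler_wpM2l => //.
rewrite le_eqVlt; apply/orP; left; apply/eqP; apply: eq_bigr => l _.
by rewrite /Kr !px // kernz_prod.
Qed.

End Area.

(** * The inductive construction *)

Section Arithmetic.
Set Implicit Arguments.
Unset Strict Implicit.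
Unset Printing Implicit Defensive.
Local Open Scope complex_scope.

Lemma le_of_le_mul1 (R : realType) (u v w t : R) :
  u <= v * w -> 0 <= w -> w * (v + 1) <= t -> u <= t.
Proof. lra. Qed.

Lemma le_add_slack (R : realType) (u v w s t : R) :
  u <= v -> 1 <= s -> 1 <= t -> u + w <= (s + 1) + (w + v) + t.
Proof. lra. Qed.

End Arithmetic.

Section Induction.
Set Implicit Arguments.
Unset Strict Implicit.
Unset Printing Implicit Defensive.
Local Open Scope complex_scope.
Variables (R : realType) (n : nat).
Variables (p : nat -> 'I_n.+1 -> {poly R[i]}) (m : nat -> nat) (d : nat -> nat) (B : nat -> R).
Hypothesis up : forall N, uniform (p N) 1 (d N).
Hypothesis cp : forall N, cofree (p N).
Hypothesis B0 : forall N, 0 <= B N.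
Hypothesis Bp : forall N z, densF (p N) z <= B N * kernz z.
Variables (phi : R -> R) (eps : R).
Hypothesis eps0 : 0 < eps.
Hypothesis phi_big : forall c, exists2 S : R, 1 <= S & forall r, S <= r -> c <= phi r.

Local Notation K := (Kprod R n).

(** The tuple [sF] constructed so far, a bound [sC] for the total weight of a
    majorant of its density, and the promise made to the limit: on the disc of
    radius [sS], values and derivatives will be modified by at most [sd]. *)
Record state := State { sF : 'I_n.+1 -> {poly R[i]}; sC : R; sS : R; sd : R }.

(** The tolerance [sd] is so small that the area of any such modification
    over the disc exceeds 32 times the bound for [sF] by at most [eps]. *)
Definition stable x := forall z, cmod z <= sS x -> forall H H' : 'I_n.+1 -> R[i],
  (forall j, cmod (H j - (sF x j).[z]) <= sd x /\ cmod (H' j - (sF x j)^`().[z]) <= sd x) ->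
  (exists j, H j != 0) /\ dens H H' <= 32 * densF (sF x) z + eps / (4 * sS x ^+ 2).

(** The last clause looks one step ahead: beyond [sS], phi dominates the
    area of the tuple which will be built from this one, wherever that tuple
    is glued. *)
Definition state_inv N x := [/\ exists lam D, uniform (sF x) lam D, cofree (sF x),
  exists2 L, maj (sF x) L & \sum_(l <- L) l.1 <= sC x, 1 <= sS x &
  [/\ 0 < sd x, stable x, 0 <= sC x &
    forall r, sS x <= r -> 32 * (pi * pi) * (K * (sC x + B N)) + eps <= phi r]].

(** The conclusion bears on all functions within the tolerance of the new
    tuple, hence on the limit. *)
Definition near_target N y := exists a c : R[i], forall z, cmod z <= (m N).+1%:R ->
  cmod (z + a) <= sS y /\ forall H : 'I_n.+1 -> R[i],
    (forall j, cmod (H j - (sF y j).[z + a]) <= sd y) ->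
    forall j, cmod (c * H j - (p N j).[z]) <= (m N).+1%:R^-1.

Definition state_succ N x y := [/\ sC y = K * (sC x + B N), sS x + 1 <= sS y, sd y <= sd x / 2,
  forall j, pnorm (4 * sS x) (sF y j - sF x j) <= sd x / 4 & near_target N y].

Lemma le_sum_ord (A : 'I_n.+1 -> R) j : (forall i, 0 <= A i) -> A j <= \sum_i A i.
Proof. by move=> A0; rewrite (bigD1 j) //= lerDl sumr_ge0. Qed.

Lemma unit_shift_near1_all D (q : 'I_n.+1 -> {poly R[i]}) T e : uniform q 1 D -> 1 <= T -> 0 < e ->
  exists2 A : R, 1 <= A & forall a, A <= cmod a -> forall j, pnorm T (unit_shift a D (q j) - 1) <= e.
Proof.
move=> [_ uq] T1 e0.
have : forall j, exists A : R, 1 <= A /\ forall a, A <= cmod a -> pnorm T (unit_shift a D (q j) - 1) <= e.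
  move=> j; have [sq lq] := uq j.
  have [|A A1 HA] := @unit_shift_near1 R D (q j) T e _ sq T1 e0; first by rewrite monicE lq.
  by exists A.
move=> /choice [A HA].
have A0 i : 0 <= A i by have [h _] := HA i; lra.
exists (\sum_i A i).
  by apply: le_trans (le_sum_ord ord0 A0); have [] := HA ord0.
by move=> a Aa j; have [_] := HA j; apply; apply: le_trans Aa; exact: le_sum_ord.
Qed.

(** The order of the choices matters.  The weight C' of the new tuple is
    known in advance; then [a] is taken large, for the gluing estimate, for
    the closeness to the previous tuple, and for the previous tuple to be
    almost constant near [a]; the new radius and tolerance come last. *)
Lemma state_step N x : state_inv N x -> exists y, state_inv N.+1 y /\ state_succ N x y.
Proof.
case: x => F C S delta [/= [lam [D U]] cF [L ML LC] S1 [d0 _ C0 phiS]].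
have S0 : 0 <= 4 * S by lra.
have l0 : lam != 0 by case: U.
have K0 := Kprod_gt0 R n.
have [A1 A11 H1] := glue_dens U cF (up N) (cp N).
pose M1 := \sum_j pnorm (4 * S) (F j).
have M1j j : pnorm (4 * S) (F j) <= M1.
  by apply: le_sum_ord => i; exact: pnorm_ge0.
have M10 : 0 <= M1 by apply: le_trans (M1j ord0); exact: pnorm_ge0.
have e2 : 0 < delta / 4 / (M1 + 1) by rewrite !divr_gt0 //; lra.
have S41 : 1 <= 4 * S by lra.
have [A2 A21 H2] := unit_shift_near1_all (up N) S41 e2.
pose rho : R := (m N).+1%:R.
have rho1 : 1 <= rho by rewrite ler1n.
have rho0 : 0 <= rho by lra.
pose M2 := \sum_j pnorm rho (p N j).
have M2j j : pnorm rho (p N j) <= M2 by apply: le_sum_ord => i; exact: pnorm_ge0.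
have M20 : 0 <= M2 by apply: le_trans (M2j ord0); exact: pnorm_ge0.
have e3 : 0 < rho^-1 / 2 / (M2 + 1) by rewrite !divr_gt0 ?invr_gt0 //; lra.
have U1 : uniform (fun j => lam^-1 *: F j) 1 D.
  split=> [|j]; first exact: oner_neq0.
  have [_ /(_ j) [sF lF]] := U; split; first by rewrite size_scale ?invr_eq0.
  by rewrite lead_coefZ lF mulVf.
have [A3 A31 H3] := unit_shift_near1_all U1 rho1 e3.
(* A1 serves the area of the glued tuple, A2 its closeness to F on the
   disc of radius S, A3 the near constancy of F around a. *)
pose a : R := A1 + A2 + A3.
have a0 : 0 < a by rewrite /a; lra.
have ca : cmod a%:C = a by rewrite cmod_real gtr0_norm.
have an0 : a%:C != 0 :> R[i] by rewrite -cmod_gt0 ca.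
have [cG dG] := H1 a%:C ltac:(by rewrite ca /a; lra).
have ta j := H2 a%:C ltac:(by rewrite ca /a; lra) j.
have tb j := H3 (- a%:C) ltac:(by rewrite cmodN ca /a; lra) j.
set G := glue F (p N) a%:C (d N) in cG dG.
have UG := glue_uniform U (up N) an0; rewrite -/G in UG.
have MG := glue_maj ML (B0 N) (Bp N) dG; rewrite -/G in MG.
pose C' := K * (C + B N).
have C'0 : 0 <= C' by rewrite mulr_ge0 ?addr_ge0 // ltW.
have [Sp Sp1 HSp] := phi_big (32 * (pi * pi) * (K * (C' + B N.+1)) + eps).
pose S' := (S + 1) + (a + rho) + Sp.
have S'1 : 1 <= S' by rewrite /S'; lra.
have eta0 : 0 < eps / (4 * S' ^+ 2) by rewrite divr_gt0 // mulr_gt0 // exprn_gt0 //; lra.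
have [de de0 Hde] := stability S'1 cG eta0.
(* Near a the new tuple is close to lam a^D / (-a)^d times the translate
   of p, and c undoes this factor. *)
pose c : R[i] := (- a%:C) ^+ d N / (lam * a%:C ^+ D).
have c0 := cmod_ge0 c.
pose delta' := Num.min de (Num.min (delta / 2) (rho^-1 / 2 / (cmod c + 1))).
have d'0 : 0 < delta'.
  rewrite !lt_min de0 /=; apply/andP; split; first lra.
  by rewrite !divr_gt0 ?invr_gt0 //; lra.
have d'1 : delta' <= de by rewrite ge_min lexx.
have d'2 : delta' <= delta / 2 by rewrite /delta' !ge_min lexx !orbT.
have d'3 : delta' * (cmod c + 1) <= rho^-1 / 2.
  by rewrite -ler_pdivlMr ?/delta' ?ge_min ?lexx ?orbT //; lra.
exists (State G C' S' delta'); split.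
  split => //=.
  - by exists (lam / (- a%:C) ^+ d N), (D + d N)%N.
  - exists (rcons [seq (K * l.1, l.2) | l <- L] (K * B N, a)) => //.
    rewrite -cats1 big_cat big_seq1 big_map /= -mulr_sumr /C' mulrDr lerD2r.
    by apply: ler_wpM2l => //; exact: ltW.
  - split => //.
      move=> z /= zS H H' HH; apply: Hde => // j; have [h1 h2] := HH j; split.
        exact: le_trans h1 d'1.
      exact: le_trans h2 d'1.
    by move=> r rS; apply: HSp; apply: le_trans rS; rewrite /S'; lra.
split => //=.
- by rewrite /S'; lra.
- move=> j; have -> : G j - F j = F j * (unit_shift a%:C (d N) (p N j) - 1) by rewrite /G /glue mulrBr mulr1.
  apply: le_trans (pnormM _ _ S0) _.
  apply: le_trans (_ : (M1 + 1) * (delta / 4 / (M1 + 1)) <= _).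
    apply: ler_pM; rewrite ?pnorm_ge0 //; have := M1j j; lra.
  by rewrite mulrC divfK // gt_eqF //; lra.
- exists a%:C, c => z zr; split.
    apply: le_trans (cmodD _ _) _; rewrite ca /S'.
    exact: le_add_slack.
  move=> H HH j.
  have pz : cmod (p N j).[z] <= M2 by apply: le_trans (M2j j); exact: pnorm_eval.
  have E : c * (G j).[z + a%:C] = (unit_shift (- a%:C) D (lam^-1 *: F j)).[z] * (p N j).[z].
    rewrite /G /glue hornerM !unit_shift_eval addrK !opprK hornerZ /c; field.
    by rewrite l0 !expf_neq0 // oppr_eq0.
  have -> : c * H j - (p N j).[z] = c * (H j - (G j).[z + a%:C]) +
    ((unit_shift (- a%:C) D (lam^-1 *: F j)).[z] - 1) * (p N j).[z].
    by rewrite mulrBr E; ring.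
  apply: le_trans (cmodD _ _) _; rewrite [X in X + _ <= _]cmodM [X in _ + X <= _]cmodM.
  have h1 : cmod c * cmod (H j - (G j).[z + a%:C]) <= rho^-1 / 2.
    have h : cmod (H j - (G j).[z + a%:C]) <= delta' by exact: (HH j).
    have q : cmod c * cmod (H j - (G j).[z + a%:C]) <= cmod c * delta' by apply: ler_wpM2l.
    exact: le_of_le_mul1 q (ltW d'0) d'3.
  have h2 : cmod ((unit_shift (- a%:C) D (lam^-1 *: F j)).[z] - 1) * cmod (p N j).[z] <= rho^-1 / 2.
    have -> : rho^-1 / 2 = rho^-1 / 2 / (M2 + 1) * (M2 + 1) by rewrite divfK // gt_eqF //; lra.
    apply: ler_pM; rewrite ?cmod_ge0 //; last lra.
    have -> : (unit_shift (- a%:C) D (lam^-1 *: F j)).[z] - 1 =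
      (unit_shift (- a%:C) D (lam^-1 *: F j) - 1).[z] by rewrite hornerD hornerN hornerC.
    by apply: le_trans (tb j); exact: pnorm_eval.
  by apply: le_trans (lerD h1 h2) _; rewrite -splitr.
Qed.

Lemma state_start : exists x, state_inv 0%N x /\ sC x = 0.
Proof.
have [S S1 HS] := phi_big (32 * (pi * pi) * (K * (0 + B 0%N)) + eps).
pose F : 'I_n.+1 -> {poly R[i]} := fun=> 1.
have cF : cofree F by move=> z; exists ord0; rewrite /F hornerC oner_neq0.
have eta0 : 0 < eps / (4 * S ^+ 2) by rewrite divr_gt0 // mulr_gt0 // exprn_gt0 //; lra.
have [de de0 Hde] := stability S1 cF eta0.
exists (State F 0 S de); split => //; split => //=.
- exists 1, 0%N; split=> [|j]; first exact: oner_neq0.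
  by rewrite /F size_poly1 lead_coef1.
- exists [::]; last by rewrite big_nil.
  split => // z; rewrite big_nil /densF /dens /wedge big1 ?mul0r // => a _.
  rewrite big1 // => b _; rewrite /F -polyC1 derivC !hornerC !mulr0 subrr cmod0.
  by rewrite expr0n.
Qed.

Theorem state_sequence : exists X : nat -> state, sC (X 0%N) = 0 /\
  forall N, state_inv N (X N) /\ state_succ N (X N) (X N.+1).
Proof.
have [x0 [I0 C0]] := state_start.
have next (Nx : {Nx : nat * state | state_inv Nx.1 Nx.2}) :
    {y : state | state_inv (sval Nx).1.+1 y /\ state_succ (sval Nx).1 (sval Nx).2 y}.
  by apply: cid; case: Nx => -[N x] /= /state_step.
pose T := {Nx : nat * state | state_inv Nx.1 Nx.2}.
pose nxt (t : T) : T := exist (fun Nx : nat * state => state_inv Nx.1 Nx.2)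
  ((sval t).1.+1, sval (next t)) (proj1 (svalP (next t))).
pose t0 : T := exist (fun Nx : nat * state => state_inv Nx.1 Nx.2) (0%N, x0) I0.
pose s N := iter N nxt t0.
have sN N : (sval (s N)).1 = N by elim: N => [//|N IH] /=; rewrite IH.
exists (fun N => (sval (s N)).2); split => // N; split.
  by have := svalP (s N); rewrite sN.
have H : state_succ (sval (s N)).1 (sval (s N)).2 (sval (s N.+1)).2.
  exact: proj2 (svalP (next (s N))).
by rewrite sN in H.
Qed.

End Induction.

(** * Limits of polynomials *)

Section Limit.
Set Implicit Arguments.
Unset Strict Implicit.
Unset Printing Implicit Defensive.
Local Open Scope complex_scope.
Variable R : realType.

(** The intervals [x N - del N, x N + del N] meet two by two, hence have
    a common point; this gives the limit together with the error at every
    stage. *)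
Lemma real_nested_limit (x del : nat -> R) N0 : (forall N M, (N0 <= N)%N -> (N <= M)%N -> `|x M - x N| <= del N) ->
  (forall N, 0 <= del N) ->
  exists l, forall N, (N0 <= N)%N -> `|l - x N| <= del N.
Proof.
move=> H d0.
have C M N : (N0 <= M)%N -> (N0 <= N)%N -> x M - del M <= x N + del N.
  move=> hM hN; have := d0 M; have := d0 N.
  case: (leqP M N) => [MN|/ltnW NM].
    by have := H M N hM MN; rewrite ler_norml => /andP[]; lra.
  by have := H N M hN NM; rewrite ler_norml => /andP[]; lra.
pose E := [set x M - del M | M in [set M | (N0 <= M)%N]].
exists (sup E) => N hN; rewrite ler_norml; apply/andP; split.
  suff : x N - del N <= sup E by lra.
  apply: ub_le_sup; last by exists N.
  by exists (x N + del N) => _ [M hM <-]; exact: C.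
suff : sup E <= x N + del N by lra.
by apply: ge_sup; [exists (x N - del N); exists N | move=> _ [M hM <-]; exact: C].
Qed.

Lemma complex_nested_limit (u : nat -> R[i]) (del : nat -> R) N0 :
  (forall N M, (N0 <= N)%N -> (N <= M)%N -> cmod (u M - u N) <= del N) ->
  (forall N, 0 <= del N) ->
  exists l, forall N, (N0 <= N)%N -> cmod (l - u N) <= 2 * del N.
Proof.
move=> H d0.
have [a Ha] := @real_nested_limit (fun N => complex.Re (u N)) del N0
  ltac:(by move=> N M h1 h2; rewrite -ReB; apply: le_trans (cmod_Re _) _; exact: H) d0.
have [b Hb] := @real_nested_limit (fun N => complex.Im (u N)) del N0
  ltac:(by move=> N M h1 h2; rewrite -ImB; apply: le_trans (cmod_Im _) _; exact: H) d0.
exists (a +i* b) => N hN; apply: le_trans (cmod_le_ReIm _) _; rewrite ReB ImB /=.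
by have := Ha N hN; have := Hb N hN; lra.
Qed.

(** The increments tend to 0 geometrically, so the errors add up to at most
    the tolerance of each stage.  The second-order remainder is bounded
    uniformly in N by the norms, which makes the limit of the derivatives
    the derivative of the limit. *)
Lemma entire_limit (F : nat -> {poly R[i]}) (S del : nat -> R) :
  (forall N, 1 <= S N) -> (forall N, S N + 1 <= S N.+1) ->
  (forall N, 0 < del N) -> (forall N, del N.+1 <= del N / 2) ->
  (forall N, pnorm (4 * S N) (F N.+1 - F N) <= del N / 4) ->
  exists G G' : R[i] -> R[i], forall z, cdiff G z (G' z) /\
    forall N, cmod z <= S N -> cmod (G z - (F N).[z]) <= del N /\
      cmod (G' z - (F N)^`().[z]) <= del N.
Proof.
move=> S1 SS d0 dd HF.
have Smono N M : (N <= M)%N -> S N <= S M.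
  move/subnK <-; elim: (M - N)%N => [//|k IH]; rewrite addSn.
  by have := SS (k + N)%N; lra.
have pn N M : (N <= M)%N -> pnorm (4 * S N) (F M - F N) <= del N / 2 - del M / 2.
  move/subnK <-; have S0 : 0 <= 4 * S N by have := S1 N; lra.
  elim: (M - N)%N => [|k IH]; first by rewrite add0n !subrr pnorm0.
  rewrite addSn; have -> : F (k + N).+1 - F N = (F (k + N).+1 - F (k + N)%N) + (F (k + N)%N - F N).
    by ring.
  apply: le_trans (pnormD _ _ S0) _.
  have h : pnorm (4 * S N) (F (k + N).+1 - F (k + N)%N) <= del (k + N)%N / 4.
    apply: le_trans (HF _); apply: pnorm_le => //.
    by have := Smono N (k + N)%N (leq_addl _ _); lra.
  by have := dd (k + N)%N; lra.
have pn' N M : (N <= M)%N -> pnorm (4 * S N) (F M - F N) <= del N / 2.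
  by move=> /pn h; apply: le_trans h _; have := d0 M; lra.
have ev N M z : (N <= M)%N -> cmod z <= S N -> cmod ((F M).[z] - (F N).[z]) <= del N / 2.
  move=> NM zS; rewrite -hornerN -hornerD; apply: le_trans (pn' N M NM).
  by apply: pnorm_eval; have := S1 N; lra.
have ed N M z : (N <= M)%N -> cmod z <= S N -> cmod ((F M)^`().[z] - (F N)^`().[z]) <= del N / 2.
  move=> NM zS; rewrite -hornerN -hornerD -derivN -derivD; apply: le_trans (pn' N M NM).
  apply: le_trans (pnorm_deriv _ (S1 N) zS) _; apply: pnorm_le; have := S1 N; lra.
have reach z : exists N, cmod z + 1 <= S N.
  have SN N : N%:R <= S N.
    elim: N => [|N IH]; first by have := S1 0%N; lra.
    by rewrite -natr1; have := SS N; lra.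
  exists (Num.bound (cmod z + 1)); apply: le_trans (SN _); apply: ltW.
  by apply: archi_boundP; have := cmod_ge0 z; lra.
have start z : exists N, cmod z <= S N /\ forall M, cmod z <= S M -> (N <= M)%N.
  have ex : exists N, cmod z <= S N by have [N hN] := reach z; exists N; lra.
  by have := @ex_minnP (fun N => cmod z <= S N) ex; case=> N h1 h2; exists N.
have d20 N : 0 <= del N / 2 by have := d0 N; lra.
have : forall z, exists l, forall N, cmod z <= S N -> cmod (l - (F N).[z]) <= del N.
  move=> z; have [N0 [h1 h2]] := start z.
  have [l Hl] := @complex_nested_limit (fun N => (F N).[z]) (fun N => del N / 2) N0
    (fun N M h3 h4 => ev N M z h4 (le_trans h1 (Smono _ _ h3))) d20.
  by exists l => N /h2 /Hl; have -> : 2 * (del N / 2) = del N by field.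
move=> /choice [G HG].
have : forall z, exists l, forall N, cmod z <= S N -> cmod (l - (F N)^`().[z]) <= del N.
  move=> z; have [N0 [h1 h2]] := start z.
  have [l Hl] := @complex_nested_limit (fun N => (F N)^`().[z]) (fun N => del N / 2) N0
    (fun N M h3 h4 => ed N M z h4 (le_trans h1 (Smono _ _ h3))) d20.
  by exists l => N /h2 /Hl; have -> : 2 * (del N / 2) = del N by field.
move=> /choice [G' HG'].
exists G, G' => z; split; last by move=> N zN; split; [exact: HG | exact: HG'].
have [N hN] := reach z.
pose Q := pnorm (4 * S N) (F N) + del N.
have S40 : 0 <= 4 * S N by have := S1 N; lra.
have Q0 : 0 <= Q by rewrite addr_ge0 ?pnorm_ge0 // ltW.
(* The estimate holds for the polynomial of a late stage M up to an error
   e, with a bound Q which does not depend on M. *)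
have key h : cmod h < 1 -> cmod (G (z + h) - G z - G' z * h) <= cmod h ^+ 2 * Q.
  move=> h1; apply/ler_addgt0Pl => e e0.
  have zN : cmod z <= S N by lra.
  have zhN : cmod (z + h) <= S N by have := cmodD z h; lra.
  have [k hk] := @half_small R (del N) (e / 3) (ltW (d0 N)) ltac:(lra).
  have dk : del (k + N)%N <= del N / 2 ^+ k.
    elim: k {hk} => [|k IH]; first by rewrite expr0 divr1.
    rewrite addSn exprS; apply: le_trans (dd _) _.
    by rewrite invfM mulrCA [leRHS]mulrC; apply: ler_wpM2r.
  set M := (k + N)%N in dk.
  have NM : (N <= M)%N by exact: leq_addl.
  have SM := Smono _ _ NM.
  have r1 := pnorm_remainder (F M) (S1 N) zN zhN.
  have r2 : pnorm (4 * S N) (F M) <= Q.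
    have -> : F M = F N + (F M - F N) by ring.
    apply: le_trans (pnormD _ _ S40) _; rewrite /Q lerD2l.
    by apply: le_trans (pn' _ _ NM) _; have := d0 N; lra.
  have a1 := HG (z + h) M (le_trans zhN SM).
  have a2 := HG z M (le_trans zN SM).
  have a3 := HG' z M (le_trans zN SM).
  have a4 : cmod (G' z - (F M)^`().[z]) * cmod h <= del M * 1.
    by apply: ler_pM; rewrite ?cmod_ge0 // ltW.
  have r3 : cmod h ^+ 2 * pnorm (4 * S N) (F M) <= cmod h ^+ 2 * Q.
    by apply: ler_wpM2l; rewrite ?sqr_ge0.
  have -> : G (z + h) - G z - G' z * h = ((F M).[z + h] - (F M).[z] - (F M)^`().[z] * h) +
     ((G (z + h) - (F M).[z + h]) - ((G z - (F M).[z]) + (G' z - (F M)^`().[z]) * h)) by ring.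
  have b1 := cmodD ((F M).[z + h] - (F M).[z] - (F M)^`().[z] * h)
     ((G (z + h) - (F M).[z + h]) - ((G z - (F M).[z]) + (G' z - (F M)^`().[z]) * h)).
  have b2 := cmodB (G (z + h) - (F M).[z + h]) ((G z - (F M).[z]) + (G' z - (F M)^`().[z]) * h).
  have b3 := cmodD (G z - (F M).[z]) ((G' z - (F M)^`().[z]) * h).
  rewrite cmodM in b3.
  clear -b1 b2 b3 r1 r3 a1 a2 a4 dk hk; lra.
move=> e e0; exists (Num.min 1 (e / (Q + 1))).
  by rewrite lt_min ltr01 divr_gt0 //; lra.
move=> h; rewrite lt_min => /andP[h1]; rewrite ltr_pdivlMr; last lra.
move=> h2; apply: le_trans (key h h1) _; rewrite expr2 -mulrA mulrC.
by have := cmod_ge0 h; clear -h2 Q0; nra.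
Qed.

End Limit.

(** * The universal curve *)

Section Main.
Set Implicit Arguments.
Unset Strict Implicit.
Unset Printing Implicit Defensive.
Local Open Scope complex_scope.
Variables (R : realType) (n : nat).

(** The two facts on phi that the construction uses.  The positive lower
    bound for r >= 1 comes from continuity and positivity on a segment, and leaves
    room for the errors, even before the first gluing. *)
Lemma phi_bounds (phi : R -> R) : (forall r, 0 < r -> 0 < phi r) ->
  {within `]0, +oo[, continuous phi} -> phi r @[r --> +oo] --> +oo ->
  (exists2 e : R, 0 < e & forall r, 1 <= r -> e <= phi r) /\
  (forall c, exists2 S : R, 1 <= S & forall r, S <= r -> c <= phi r).
Proof.
move=> pos cont lim.
have big c : exists2 S : R, 1 <= S & forall r, S <= r -> c <= phi r.
  have [M [_ HM]] := proj1 (cvgryPge phi) lim c.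
  exists (Num.max 1 (M + 1)); first by rewrite le_max lexx.
  by move=> r; rewrite ge_max => /andP[_ h]; apply: HM; lra.
split => //; have [S S1 HS] := big 1.
have cS : {within `[1, S], continuous phi}.
  apply: continuous_subspaceW cont => x /=; rewrite !in_itv /= => /andP[x1 _].
  by rewrite andbT; lra.
have [c cin Hc] := EVT_min S1 cS.
have c1 : 1 <= c by move: cin; rewrite in_itv /= => /andP[].
have pc : 0 < phi c by apply: pos; lra.
exists (Num.min 1 (phi c)); first by rewrite lt_min ltr01.
move=> r r1; have [rS|Sr] := leP r S; rewrite ge_min.
  by rewrite Hc ?orbT // in_itv /= r1.
by rewrite HS // ltW.
Qed.

Lemma point_of_vector (v : 'I_n.+1 -> R[i]) : (exists j, v j != 0) ->
  exists p : CP R n, exists2 c, c != 0 & forall j, hcoord p 0 j = c * v j.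
Proof.
move=> [j vj]; pose w : 'rV[R[i]]_n.+1 := \row_j v j.
have w0 : w != 0 by apply/rV0Pn; exists j; rewrite mxE.
have dw : \dim <[w]>%VS == 1%N by rewrite dim_vline w0.
pose p : CP R n := exist _ <[w]>%VS dw; exists p.
have /vlineP[c hc] : hcoord p \in <[w]>%VS by exact: memv_pick.
exists c; first by have := hcoord_neq0 p; rewrite hc; apply: contraNneq => ->; rewrite scale0r.
by move=> i; rewrite hc !mxE.
Qed.

(** Compactness is applied to the covering of the plane by the
    discs of integer radii. *)
Lemma compact_bounded_cplx (K : set (Cplx R)) : compact K ->
  exists2 r : R, 0 <= r & forall z, K z -> cmod z <= r.
Proof.
move=> /compact_near_coveringP cK.
have := cK nat \oo (fun k z => cmod z <= k%:R) _.
move=> /(_ _) [|N _ HN]; last first.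
  by exists N%:R => // z Kz; apply: (HN N) => //=.
move=> x _; pose b := Num.bound (cmod x + 1).
have hb : cmod x + 1 < b%:R by apply: archi_boundP; have := cmod_ge0 x; lra.
exists ([set w | cmod (w - x) < 1], [set k | (b <= k)%N]) => /=.
  split; last by exists b.
  by apply/near_cmod; exists 1.
move=> [w k] /= [h1 h2].
have : b%:R <= (k%:R : R) by rewrite ler_nat.
have := cmodD (w - x) x; rewrite subrK; lra.
Qed.

Section Curve.
Variables (G G' : 'I_n.+1 -> R[i] -> R[i]) (h : Cplx R -> CP R n).
Hypothesis dG : forall j z, cdiff (G j) z (G' j z).
Hypothesis hG : forall z, exists2 c, c != 0 & forall j, hcoord (h z) 0 j = c * G j z.

(** In the charts, the coordinates of the curve are quotients of
    holomorphic functions, the unknown factors [c] having cancelled. *)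
Lemma entire_of_lift : entire_curve h.
Proof.
move=> z j; rewrite /chart_dom /= => hz.
have [c c0 Hc] := hG z.
have Gz : G j z != 0 by move: hz; rewrite Hc mulf_eq0 negb_or => /andP[].
have e0 : 0 < cmod (G j z) / 2 by rewrite divr_gt0 // cmod_gt0.
have [r r0 H] := cdiff_cont (dG j z) e0.
apply/near_cmod; exists r => // w wr.
have Gw : G j w != 0.
  have := H (w - z) wr; rewrite (addrC z) subrK => h1.
  rewrite -cmod_gt0; have := cmodD (G j w) (- (G j w - G j z)).
  rewrite cmodN opprB addrCA subrr addr0.
  have : 0 < cmod (G j z) by rewrite cmod_gt0.
  lra.
have [cw cw0 Hw] := hG w.
split=> [|a]; first by rewrite Hw mulf_neq0.
have D := cdiffM (dG (lift j a) w) (cdiffV Gw (dG j w)).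
apply: cdiff_derivable; apply: cdiff_ext D => x.
have [cx cx0 Hx] := hG x; rewrite mxE !Hx.
have [->|Gx] := eqVneq (G j x) 0; first by rewrite mulr0 invr0 !mulr0.
by field; rewrite cx0 Gx.
Qed.

(** The factor 1 / pi of [FS_pullback_le] is dropped. *)
Lemma pullback_dens z : (exists j, G j z != 0) ->
  FS_pullback h z <= dens (G^~ z) (G'^~ z).
Proof.
move=> Gz.
apply: le_trans (FS_pullback_le (F := G) (F' := G'^~ z) _ Gz (fun j => dG j z)) _.
  by exists 1 => // w _; have [c c0 Hc] := hG (z + w); exists c.
rewrite -/(dens (G^~ z) (G'^~ z)) -[leRHS]mul1r; apply: ler_wpM2r; first exact: dens_ge0.
by rewrite invf_le1 ?pi_gt0 //; have := pi_ge2 R; lra.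
Qed.

Variables (p : nat -> 'I_n.+1 -> {poly R[i]}) (m : nat -> nat).
Hypothesis dense : forall (A : 'I_n.+1 -> R[i] -> R[i]) S rho eta M, 0 < S -> 0 <= rho -> rho < S -> 0 < eta ->
     (forall z, in_rect (-S) S (-S) S z -> forall j, hol (A j) z) ->
     exists N (e : R), [/\ (M <= m N)%N, 0 < e, e <= 1 & forall z, cmod z <= rho -> forall j,
       cmod (e%:C * (p N j).[z] - A j z) <= eta].
Hypothesis targets : forall N, exists a c : R[i], forall z, cmod z <= (m N).+1%:R ->
  forall j, cmod (c * G j (z + a) - (p N j).[z]) <= (m N).+1%:R^-1.

(** The given curve is approximated by some [p_N], itself
    approximated by a translate of [h].  The lift of the given curve is
    bounded away from 0 on a square, so closeness of coordinates implies
    closeness in the projective space by [dist_FS_small]. *)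
Lemma universal_of_targets : universal h.
Proof.
split; first exact: entire_of_lift.
move=> g eg K /compact_bounded_cplx [rho rho0 HK].
have S0 : 0 < rho + 1 by lra.
have rS : rho < rho + 1 by lra.
have sq : - (rho + 1) < rho + 1 by lra.
have [A HA] := lift_square eg S0.
have [mu mu0 Hmu] := @lower_bound R _ A _ _ _ _ sq sq
  (fun w wi j => hol_cont ((HA w wi).1 j))
  (fun w wi => let: ex_intro2 c c0 Hc := (HA w wi).2 in
     let: ex_intro j hj := hcoord_nz (g w) in
     ex_intro _ j (eq_ind_r (fun x => x != 0) (mulf_neq0 c0 hj) (Hc j))).
have approx (e : R) : 0 < e -> exists a : Cplx R, forall z, K z -> dist_FS (h (z + a)) (g z) < e.
  move=> /(dist_FS_small n) [t t0 Ht].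
  pose eta := t * mu / 2; have eta0 : 0 < eta by rewrite divr_gt0 // mulr_gt0.
  pose M := Num.bound (rho + eta^-1).
  have hM : rho + eta^-1 < M%:R.
    by apply: archi_boundP; rewrite addr_ge0 // invr_ge0 ltW.
  have [N [e' [MN e'0 e'1 HN]]] := dense M S0 rho0 rS eta0 (fun z zi => (HA z zi).1).
  have mN : rho + eta^-1 <= (m N).+1%:R.
    by apply: le_trans (ltW hM) _; rewrite ler_nat; apply: leq_trans MN _.
  have ie0 : 0 < eta^-1 by rewrite invr_gt0.
  have [a [c Hac]] := targets N.
  exists a => z Kz; have zr := HK z Kz.
  have zi : in_rect (- (rho + 1)) (rho + 1) (- (rho + 1)) (rho + 1) z.
    by apply: in_square; lra.
  have zm : cmod z <= (m N).+1%:R by lra.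
  have [_ [cg cg0 Hg]] := HA z zi.
  have [ch ch0 Hh] := hG (z + a).
  apply: (Ht _ _ (e'%:C * c / ch) cg mu mu0 cg0).
    by have [k hk] := Hmu z zi; exists k; rewrite -Hg.
  move=> j; rewrite -Hg Hh.
  have -> : e'%:C * c / ch * (ch * G j (z + a)) - A j z =
    e'%:C * (c * G j (z + a) - (p N j).[z]) + (e'%:C * (p N j).[z] - A j z).
    by field.
  apply: le_trans (cmodD _ _) _; rewrite cmodM cmod_real gtr0_norm //.
  have h1 := HN z zr j.
  have h2 : cmod (c * G j (z + a) - (p N j).[z]) <= eta.
    apply: le_trans (Hac z zm j) _; rewrite -[leRHS]invrK.
    by rewrite lef_pV2 ?posrE //; lra.
  have h3 : e' * cmod (c * G j (z + a) - (p N j).[z]) <= 1 * eta.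
    by apply: ler_pM; rewrite ?cmod_ge0 // ltW.
  have -> : t * mu = eta + eta by rewrite /eta; field.
  by lra.
have : forall k : nat, exists a : Cplx R, forall z, K z -> dist_FS (h (z + a)) (g z) < k.+1%:R^-1.
  by move=> k; apply: approx; rewrite invr_gt0 ltr0n.
move=> /choice [a Ha]; exists a => e e0.
have [N _ HN] := near_infty_natSinv_lt (PosNum e0).
by exists N => // k /HN /= ke z Kz; apply: lt_trans (Ha k z Kz) ke.
Qed.

End Curve.

End Main.

Theorem theorem1p2 (R : realType) (n : nat) (n_ge1 : (1 <= n)%N)
    (phi : R -> R)
    (phi_pos : forall r : R, 0 < r -> 0 < phi r)
    (phi_cont : {within `]0, +oo[, continuous phi})
    (phi_lim : phi r @[r --> +oo] --> +oo) :
  exists h : Cplx R -> CP R n,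
    universal h /\
    forall r : R, 1 <= r -> (nevanlinna h r <= (phi r * ln r)%:E)%E.
Proof.
have [[eps eps0 phi1] phi_big] := phi_bounds phi_pos phi_cont phi_lim.
have [p [m [Hp dense]]] := dense_family R n_ge1.
have : forall N, exists dB : nat * R, [/\ uniform (p N) 1 dB.1, 0 <= dB.2 &
    forall z, densF (p N) z <= dB.2 * kernz z].
  move=> N; have [cf [d Hd]] := Hp N.
  have U : uniform (p N) 1 d.
    split=> [|j]; first exact: oner_neq0.
    by have [/monicP h1 h2] := Hd j.
  by have [B B0 HB] := dens_kern U cf; exists (d, B).
move=> /choice [dB HdB].
have [X [X0 HX]] := @state_sequence R n p m (fun N => (dB N).1) (fun N => (dB N).2)
  (fun N => let: And3 h _ _ := HdB N in h) (fun N => (Hp N).1)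
  (fun N => let: And3 _ h _ := HdB N in h) (fun N => let: And3 _ _ h := HdB N in h)
  phi eps eps0 phi_big.
have S1 N : 1 <= sS (X N) by have [[]] := HX N.
have SS N : sS (X N) + 1 <= sS (X N.+1) by have [_ []] := HX N.
have d0 N : 0 < sd (X N) by have [[_ _ _ _ []]] := HX N.
have dd N : sd (X N.+1) <= sd (X N) / 2 by have [_ []] := HX N.
have : forall j, exists GG : (R[i] -> R[i]) * (R[i] -> R[i]), forall z, cdiff GG.1 z (GG.2 z) /\
    forall N, cmod z <= sS (X N) -> cmod (GG.1 z - (sF (X N) j).[z]) <= sd (X N) /\
      cmod (GG.2 z - (sF (X N) j)^`().[z]) <= sd (X N).
  move=> j; have [|G [G' HG]] := @entire_limit R (fun N => sF (X N) j) _ _ S1 SS d0 dd.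
    by move=> N; have [_ []] := HX N.
  by exists (G, G').
move=> /choice [GG HGG].
pose G j := (GG j).1; pose G' j := (GG j).2.
have dG j z : cdiff (G j) z (G' j z) by case: (HGG j z).
have near z N : cmod z <= sS (X N) -> (exists j, G j z != 0) /\
    dens (G^~ z) (G'^~ z) <= 32 * densF (sF (X N)) z + eps / (4 * sS (X N) ^+ 2).
  move=> zN; have [[_ _ _ _ [_ st _ _]] _] := HX N.
  by apply: st => // j; have [_] := HGG j z; apply.
have reach r : exists N, r <= sS (X N).
  have SN N : N%:R <= sS (X N).
    elim: N => [|N IH]; first by have := S1 0%N; lra.
    by rewrite -natr1; have := SS N; lra.
  have [r0|r0] := leP 0 r; last by exists 0%N; have := S1 0%N; lra.
  by exists (Num.bound r); apply: le_trans (SN _); apply: ltW; apply: archi_boundP.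
have G0 z : exists j, G j z != 0.
  by have [N hN] := reach (cmod z); have [] := near z N hN.
have : forall z : Cplx R, exists q : CP R n, exists2 c, c != 0 & forall j, hcoord q 0 j = c * G j z.
  by move=> z; exact: point_of_vector.
move=> /choice [h hG]; exists h; split.
  apply: (universal_of_targets dG hG dense) => N.
  have [_ [_ _ _ _ [a [c Hac]]]] := HX N; exists a, c => z /Hac [zS]; apply.
  by move=> j; have [_] := HGG j (z + a); move=> /(_ N.+1 zS) [].
move=> r r1; apply: nevanlinna_le => //.
  by apply: le_trans (phi1 r r1); exact: ltW.
move=> t t1 tr.
(* The first stage whose disc contains the disc of radius r: phi r
   dominates its area by the last clause of the previous invariant, or, at
   the stage 0, because this area is at most eps. *)
have [N hN Nmin] := @ex_minnP (fun N => r <= sS (X N)) (reach r).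
have phir : 32 * (pi * pi) * sC (X N) + eps <= phi r.
  case: N hN Nmin => [|k] hN Nmin; first by rewrite X0 mulr0 add0r; exact: phi1.
  have [[_ _ _ _ [_ _ _ H]] [CE _ _ _ _]] := HX k.
  rewrite CE; apply: H; rewrite leNgt; apply/negP => h1.
  by have := Nmin k (ltW h1); rewrite ltnn.
have [[_ _ [L [L0 HL] LC] SN1 [_ _ C0 _]] _] := HX N.
set S := sS (X N) in hN SN1 *; set C := sC (X N) in phir LC C0 *.
have t0 : 0 < t by lra.
have eta0 : 0 <= eps / (4 * S ^+ 2).
  by apply: divr_ge0; [exact: ltW | apply: mulr_ge0 => //; exact: sqr_ge0].
have pp : 0 <= pi * pi :> R by rewrite mulr_ge0 // pi_ge0.
apply: le_trans (@area_bound R (fun z => FS_pullback h (z.1 +i* z.2)%C) L t 32 (eps / (4 * S ^+ 2))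
  t0 ltac:(by []) eta0 L0 _) _.
  move=> x y xy /=.
  have zt : cmod (x +i* y)%C <= S.
    apply: le_trans (_ : t <= _); last by lra.
    rewrite -(@ler_pXn2r _ 2%N) ?nnegrE ?cmod_ge0 ?(ltW t0) //.
    by rewrite cmod_sqr /= ltW.
  have [Gz Dz] := near _ N zt.
  apply: le_trans (pullback_dens dG hG Gz) _; apply: le_trans Dz _.
  by rewrite lerD2r; apply: ler_wpM2l => //; exact: HL.
rewrite lee_fin.
have e1 : eps / (4 * S ^+ 2) * (4 * t ^+ 2) <= eps.
  have S20 : 0 < 4 * S ^+ 2 by rewrite mulr_gt0 // exprn_gt0 //; lra.
  rewrite mulrAC ler_pdivrMr //; apply: ler_wpM2l; first exact: ltW.
  by rewrite ler_pM2l //; apply: lerXn2r; rewrite ?nnegrE; lra.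
have e2 : 32 * ((\sum_(l <- L) l.1) * (pi * pi)) <= 32 * (pi * pi) * C.
  by rewrite -mulrA ler_pM2l // [leLHS]mulrC; apply: ler_wpM2l.
lra.
Qed.
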